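(* Let $A$ be a unital AF $C^*$-algebra and let $\alpha$ be an automorphism of $A$. If $\alpha$ has the approximate Rohlin property, then $\alpha$ has the Rohlin property.
   Context: $\mathbb{N}$ denotes the positive integers, $[x,y]=xy-yx$ for $x,y\in A$, and $1$ is the identity of $A$. Rohlin property: an automorphism $\alpha$ of a unital $C^*$-algebra $A$ has the Rohlin property if for any $k\in\mathbb{N}$ there are $m\in\mathbb{N}$ and positive integers $k_0,\dots,k_{m-1}\geq k$ such that: for any finite subset $F$ of $A$ and any $\varepsilon>0$ there are projections $e_{i,j}$, $i=0,\dots,m-1$, $j=0,\dots,k_i-1$, in $A$ with (1) $\sum_{i=0}^{m-1}\sum_{j=0}^{k_i-1}e_{i,j}=1$; (2) $\|\alpha(e_{i,j})-e_{i,j+1}\|<\varepsilon$; (3) $\|[x,e_{i,j}]\|<\varepsilon$; for all $i=0,\dots,m-1$, $j=0,\dots,k_i-1$ and $x\in F$, where $e_{i,k_i}=e_{i,0}$. An $\varepsilon$-approximate cyclic stack of height $m$ for $\alpha$ is a family of mutually orthogonal projections $e_0,\dots,e_{m-1}$ with $\|\alpha(e_i)-e_{i+1}\|<\varepsilon$ for $i=0,\dots,m-2$ and $\|\alpha(e_{m-1})-e_0\|<\varepsilon$. Approximate Rohlin property: an automorphism $\alpha$ of a unital AF algebra $A$ has the approximate Rohlin property if for any $m,n\in\mathbb{N}$, any $\varepsilon>0$, and any finite-dimensional $C^*$-subalgebra $B$ of $A$ there is an $\varepsilon$-approximate cyclic stack $e_0,\dots,e_{m-1}$ for $\alpha$ with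 all $e_i\in A\cap B'$ (where $A\cap B'$ is the set of elements of $A$ commuting with every element of $B$) such that (1) $[e_0]=[e_1]=\cdots=[e_{m-1}]$ and (2) $[e_0]\geq n\left[1-\sum_{i=0}^{m-1}e_i\right]$, where $[\cdot]$ denotes the class in $K_0(A\cap B')$ and $\ge$ is the usual order on $K_0(A\cap B')$. *)

(* Defs.v *)
From HB Require Import structures.
From mathcomp Require Import all_boot all_order all_algebra.
From mathcomp Require Import complex.
From mathcomp Require Import all_classical all_reals all_analysis.

Set Implicit Arguments.
Unset Strict Implicit.
Unset Printing Implicit Defensive.

Import Order.TTheory GRing.Theory Num.Theory.
Import numFieldNormedType.Exports.

Local Open Scope classical_set_scope.
Local Open Scope ring_scope.
Local Open Scope complex_scope.
Local Open Scope quotient_scope.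

(* Unital C*-algebras over R[i], the zero algebra being allowed. As always for
   a normedModType R[i], the norm takes its values in R[i]. Ring structures and
   norms over an external field have no common extension in the hierarchy, so
   the two are put separately on the carrier cstar_sort. *)
Record cstarAlgType (R : realType) := CStarAlg {
  cstar_space : completeNormedModType R[i] ;
  cstar_one : cstar_space ;
  cstar_mul : cstar_space -> cstar_space -> cstar_space ;
  cstar_star : cstar_space -> cstar_space ;
  cstar_mulA : associative cstar_mul ;
  cstar_mul1x : left_id cstar_one cstar_mul ;
  cstar_mulx1 : right_id cstar_one cstar_mul ;
  cstar_mulDl : left_distributive cstar_mul +%R ;
  cstar_mulDr : right_distributive cstar_mul +%R ;
  cstar_scaleAl : forall (c : R[i]) x y,
    c *: cstar_mul x y = cstar_mul (c *: x) y ;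
  cstar_scaleAr : forall (c : R[i]) x y,
    c *: cstar_mul x y = cstar_mul x (c *: y) ;
  cstar_starD : {morph cstar_star : x y / x + y} ;
  cstar_starZ : forall (c : R[i]) x,
    cstar_star (c *: x) = Num.conj c *: cstar_star x ;
  cstar_starM : forall x y,
    cstar_star (cstar_mul x y) = cstar_mul (cstar_star y) (cstar_star x) ;
  cstar_starK : involutive cstar_star ;
  cstar_normM : forall x y, `|cstar_mul x y| <= `|x| * `|y| ;
  cstar_norm : forall x, `|cstar_mul (cstar_star x) x| = `|x| ^+ 2
}.

Definition cstar_sort (R : realType) (A : cstarAlgType R) : Type :=
  cstar_space A.
Coercion cstar_sort : cstarAlgType >-> Sortclass.

HB.instance Definition _ (R : realType) (A : cstarAlgType R) :=
  CompleteNormedModule.copy (cstar_sort A) (cstar_space A).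

HB.instance Definition _ (R : realType) (A : cstarAlgType R) :=
  GRing.Zmodule_isPzRing.Build (cstar_sort A)
    (@cstar_mulA R A) (@cstar_mul1x R A) (@cstar_mulx1 R A)
    (@cstar_mulDl R A) (@cstar_mulDr R A).

Section CStarTheory.
Variables (R : realType) (A : cstarAlgType R).
Local Notation C := R[i].
Implicit Types (c : C) (x y : A).

Definition star (x : A) : A := cstar_star x.

Lemma starD : {morph star : x y / x + y}. Proof. exact: cstar_starD. Qed.
Lemma starZ c x : star (c *: x) = Num.conj c *: star x.
Proof. exact: cstar_starZ. Qed.
Lemma starM x y : star (x * y) = star y * star x.
Proof. exact: cstar_starM. Qed.
Lemma starK : involutive star. Proof. exact: cstar_starK. Qed.
Lemma scaleAl c x y : c *: (x * y) = (c *: x) * y.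
Proof. exact: cstar_scaleAl. Qed.
Lemma scaleAr c x y : c *: (x * y) = x * (c *: y).
Proof. exact: cstar_scaleAr. Qed.
Lemma normM x y : `|x * y| <= `|x| * `|y|.
Proof. exact: cstar_normM. Qed.
Lemma norm_star x : `|star x * x| = `|x| ^+ 2.
Proof. exact: cstar_norm. Qed.

Lemma star0 : star 0 = 0.
Proof. by apply: (@addrI _ (star 0)); rewrite -starD !addr0. Qed.

Lemma star1 : star 1 = 1.
Proof. by rewrite -[LHS]mulr1 -{2}(starK 1) -starM mulr1 starK. Qed.

Lemma star_sum (I : finType) (F : I -> A) :
  star (\sum_i F i) = \sum_i star (F i).
Proof. exact: (big_morph star starD star0). Qed.

End CStarTheory.

(* C*-subalgebras need not contain the unit of A. *)
Record csubalg (R : realType) (A : cstarAlgType R) := CSubalg {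
  csub_set :> set A ;
  csub0 : csub_set 0 ;
  csubD : forall x y, csub_set x -> csub_set y -> csub_set (x + y) ;
  csubZ : forall (c : R[i]) x, csub_set x -> csub_set (c *: x) ;
  csubM : forall x y, csub_set x -> csub_set y -> csub_set (x * y) ;
  csub_star : forall x, csub_set x -> csub_set (star x) ;
  csub_closed : closed csub_set
}.

Record ucsubalg (R : realType) (A : cstarAlgType R) := UCSubalg {
  ucsub_csub :> csubalg A ;
  ucsub1 : csub_set ucsub_csub 1
}.

Definition fin_dim (R : realType) (A : cstarAlgType R) (B : csubalg A) : Prop :=
  exists (d : nat) (b : 'I_d -> A), (forall i, csub_set B (b i)) /\
    forall x, csub_set B x -> exists c : 'I_d -> R[i], x = \sum_i c i *: b i.

Definition is_AF (R : realType) (A : cstarAlgType R) : Prop :=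
  exists B : nat -> csubalg A,
    [/\ forall n, fin_dim (B n),
        forall n, B n `<=` B n.+1
      & dense (\bigcup_n B n)].

Section Commutant.
Variables (R : realType) (A : cstarAlgType R) (B : csubalg A).

Definition commutant_set : set A := [set x | forall b, csub_set B b -> x * b = b * x].

Lemma commutant0 : commutant_set 0.
Proof. by move=> b _; rewrite mul0r mulr0. Qed.

Lemma commutantD x y :
  commutant_set x -> commutant_set y -> commutant_set (x + y).
Proof. by move=> hx hy b Bb; rewrite mulrDl mulrDr hx // hy. Qed.

Lemma commutantZ (c : R[i]) x : commutant_set x -> commutant_set (c *: x).
Proof. by move=> hx b Bb; rewrite -scaleAl -scaleAr hx. Qed.

Lemma commutantM x y :
  commutant_set x -> commutant_set y -> commutant_set (x * y).
Proof. by move=> hx hy b Bb; rewrite -mulrA hy // mulrA hx // mulrA. Qed.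

Lemma commutant_star x : commutant_set x -> commutant_set (star x).
Proof.
by move=> hx b Bb; rewrite -[b]starK -!starM hx //; exact: csub_star.
Qed.

Lemma commutant_closed : closed commutant_set.
Proof.
move=> x clx b Bb; apply/eqP; rewrite -subr_eq0 -normr_eq0.
apply/eqP/le_anti; rewrite normr_ge0 andbT.
apply/ler_addgt0Pl => e e0; rewrite addr0.
have k0 : 0 < 2%:R * (`|b| + 1) by rewrite mulr_gt0 // ltr_wpDl.
have [y [hy]] := clx _ (nbhsx_ballx x _ (divr_gt0 e0 k0)).
rewrite -ball_normE /= => xy.
have -> : x * b - b * x = (x - y) * b - b * (x - y).
  by rewrite mulrBl mulrBr (hy b Bb) opprB addrA subrK.
apply: (le_trans (ler_normB _ _)).
apply: (le_trans (lerD (normM _ _) (normM _ _))).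
rewrite [X in _ + X]mulrC -mulr2n -mulr_natl.
rewrite (le_trans (y := `|x - y| * (2%:R * (`|b| + 1)))) //.
  by rewrite mulrCA ler_wpM2l // ler_wpM2l // lerDl.
by rewrite -ler_pdivlMr // ltW.
Qed.

Lemma commutant1 : commutant_set 1.
Proof. by move=> b _; rewrite mul1r mulr1. Qed.

(* A `&` B', as a unital C*-subalgebra of A *)
Definition commutant : ucsubalg A :=
  @UCSubalg _ _ (@CSubalg _ _ commutant_set commutant0 commutantD
    commutantZ commutantM commutant_star commutant_closed) commutant1.

End Commutant.

Definition is_projection (R : realType) (A : cstarAlgType R) (p : A) : Prop :=
  p * p = p /\ star p = p.

Record projection (R : realType) (A : cstarAlgType R) (D : csubalg A) :=
  Projection {
    proj_val :> A ;
    projP : csub_set D proj_val ;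
    proj_projP : is_projection proj_val
  }.

Section Grothendieck.
Variable V : nmodType.

Definition groth_eq (x y : V * V) : bool :=
  `[< exists r, x.1 + y.2 + r = y.1 + x.2 + r >].

Lemma groth_eq_refl : reflexive groth_eq.
Proof. by move=> x; apply/asboolP; exists 0. Qed.

Lemma groth_eq_sym : symmetric groth_eq.
Proof.
by move=> x y; apply/asboolP/asboolP => -[r h]; exists r; rewrite h.
Qed.

Lemma groth_eq_trans : transitive groth_eq.
Proof.
move=> y x z /asboolP[r h] /asboolP[s k]; apply/asboolP.
exists (r + s + y.1 + y.2).
have -> : x.1 + z.2 + (r + s + y.1 + y.2) =
          (x.1 + y.2 + r) + (y.1 + z.2 + s).
  by rewrite [LHS](AC (2*4) ((1*6*3)*(5*2*4))).
rewrite h k.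
by rewrite [LHS](AC (3*3) ((4*2)*(3*6*1*5))).
Qed.

Canonical groth_equiv :=
  EquivRel groth_eq groth_eq_refl groth_eq_sym groth_eq_trans.

(* the class of (a, b) is the formal difference a - b *)
Definition groth : Type := {eq_quot groth_eq}.
HB.instance Definition _ := EqQuotient.on groth.
HB.instance Definition _ := Choice.on groth.

Definition groth_pair (x : V * V) : groth := \pi_groth x.

Lemma groth_pairE x y :
  (groth_pair x = groth_pair y) <-> exists r, x.1 + y.2 + r = y.1 + x.2 + r.
Proof.
split=> [/eqP|h]; first by rewrite /groth_pair eqmodE => /asboolP.
by apply/eqP; rewrite /groth_pair eqmodE; apply/asboolP.
Qed.

Lemma groth_repr (x : groth) : groth_pair (repr x) = x.
Proof. exact: reprK. Qed.

Definition groth_zero : groth := groth_pair (0, 0).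
Definition groth_opp (x : groth) : groth := groth_pair ((repr x).2, (repr x).1).
Definition groth_add (x y : groth) : groth :=
  groth_pair ((repr x).1 + (repr y).1, (repr x).2 + (repr y).2).

Lemma groth_addE x y :
  groth_add (groth_pair x) (groth_pair y) = groth_pair (x.1 + y.1, x.2 + y.2).
Proof.
have /groth_pairE[r h] := groth_repr (groth_pair x).
have /groth_pairE[s k] := groth_repr (groth_pair y).
apply/groth_pairE; exists (r + s) => /=.
rewrite [LHS](AC (2*2*2) ((1*3*5)*(2*4*6))) [X in _ = X](AC (2*2*2) ((1*3*5)*(2*4*6))).
by rewrite /= h k.
Qed.

Lemma groth_oppE x : groth_opp (groth_pair x) = groth_pair (x.2, x.1).
Proof.
have /groth_pairE[r h] := groth_repr (groth_pair x).
apply/groth_pairE; exists r => /=.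
by rewrite [_.2 + x.1]addrC -h [x.2 + _]addrC.
Qed.

Lemma groth_addA : associative groth_add.
Proof.
move=> x y z; rewrite -[x]groth_repr -[y]groth_repr -[z]groth_repr.
by rewrite !groth_addE /= !addrA.
Qed.

Lemma groth_addC : commutative groth_add.
Proof. by move=> x y; congr groth_pair; congr pair; exact: addrC. Qed.

Lemma groth_add0 : left_id groth_zero groth_add.
Proof.
move=> x; rewrite -[x]groth_repr groth_addE /= !add0r.
by case: (repr x).
Qed.

Lemma groth_addN : left_inverse groth_zero groth_opp groth_add.
Proof.
move=> x; rewrite -[x]groth_repr groth_oppE groth_addE.
by apply/groth_pairE; exists 0; rewrite /= !addr0 !add0r addrC.
Qed.

HB.instance Definition _ := GRing.isZmodule.Build groth
  groth_addA groth_addC groth_add0 groth_addN.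

End Grothendieck.

Section Adjoint.
Variables (R : realType) (A : cstarAlgType R).

Definition adjmx m n (v : 'M[A]_(m, n)) : 'M[A]_(n, m) :=
  (map_mx (@star R A) v)^T.

Lemma adjmxK m n (v : 'M[A]_(m, n)) : adjmx (adjmx v) = v.
Proof. by apply/matrixP => i j; rewrite !mxE starK. Qed.

Lemma adjmxM m n p (v : 'M[A]_(m, n)) (w : 'M[A]_(n, p)) :
  adjmx (v *m w) = adjmx w *m adjmx v.
Proof.
apply/matrixP => i j; rewrite !mxE star_sum; apply: eq_bigr => k _.
by rewrite !mxE starM.
Qed.

Lemma adjmx0 m n : adjmx (0 : 'M[A]_(m, n)) = 0.
Proof. by apply/matrixP => i j; rewrite !mxE star0. Qed.

Lemma adjmx_block m1 m2 n1 n2 (a : 'M[A]_(m1, n1)) (b : 'M[A]_(m1, n2))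
    (c : 'M[A]_(m2, n1)) (d : 'M[A]_(m2, n2)) :
  adjmx (block_mx a b c d) =
  block_mx (adjmx a) (adjmx c) (adjmx b) (adjmx d).
Proof. by rewrite /adjmx map_block_mx tr_block_mx. Qed.

Lemma adjmx_row m n1 n2 (a : 'M[A]_(m, n1)) (b : 'M[A]_(m, n2)) :
  adjmx (row_mx a b) = col_mx (adjmx a) (adjmx b).
Proof. by rewrite /adjmx map_row_mx tr_row_mx. Qed.

End Adjoint.

Section K0.
Variables (R : realType) (A : cstarAlgType R) (D : ucsubalg A).

Definition mx_in m n (v : 'M[A]_(m, n)) : Prop := forall i j, csub_set D (v i j).

Lemma mx_in0 m n : mx_in (0 : 'M[A]_(m, n)).
Proof. by move=> i j; rewrite mxE; exact: csub0. Qed.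

Lemma mx_inM m n p (v : 'M[A]_(m, n)) (w : 'M[A]_(n, p)) :
  mx_in v -> mx_in w -> mx_in (v *m w).
Proof.
move=> hv hw i j; rewrite mxE; elim/big_ind: _ => //.
- exact: csub0.
- exact: csubD.
- by move=> k _; exact: csubM.
Qed.

Lemma mx_in_adj m n (v : 'M[A]_(m, n)) : mx_in v -> mx_in (adjmx v).
Proof. by move=> hv i j; rewrite !mxE; exact: csub_star. Qed.

Lemma mx_in_block m1 m2 n1 n2 (a : 'M[A]_(m1, n1)) (b : 'M[A]_(m1, n2))
    (c : 'M[A]_(m2, n1)) (d : 'M[A]_(m2, n2)) :
  mx_in a -> mx_in b -> mx_in c -> mx_in d -> mx_in (block_mx a b c d).
Proof.
move=> ha hb hc hd i j; rewrite !mxE.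
by case: (fintype.split i) => ?; rewrite !mxE; case: (fintype.split j) => ?.
Qed.

Lemma mx_in_row m n1 n2 (a : 'M[A]_(m, n1)) (b : 'M[A]_(m, n2)) :
  mx_in a -> mx_in b -> mx_in (row_mx a b).
Proof. by move=> ha hb i j; rewrite mxE; case: (fintype.split j). Qed.

(* projections in the matrix algebras M_n(D), n >= 0 *)
Record mxproj := MxProj {
  mxproj_dim : nat ;
  mxproj_mx :> 'M[A]_mxproj_dim ;
  mxproj_in : mx_in mxproj_mx ;
  mxproj_idem : mxproj_mx *m mxproj_mx = mxproj_mx ;
  mxproj_adj : adjmx mxproj_mx = mxproj_mx
}.

HB.instance Definition _ := gen_eqMixin mxproj.
HB.instance Definition _ := gen_choiceMixin mxproj.

(* Murray-von Neumann equivalence of projections in matrix algebras over D of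
   possibly different sizes, through rectangular partial isometries *)
Definition mvn (p q : mxproj) : bool :=
  `[< exists v : 'M[A]_(mxproj_dim q, mxproj_dim p),
      [/\ mx_in v, adjmx v *m v = p & v *m adjmx v = q] >].

Lemma mvn_refl : reflexive mvn.
Proof.
move=> p; apply/asboolP; exists p; rewrite mxproj_adj mxproj_idem.
by split=> //; exact: mxproj_in.
Qed.

Lemma mvn_sym : symmetric mvn.
Proof.
suff S p q : mvn p q -> mvn q p by move=> p q; apply/idP/idP; exact: S.
move=> /asboolP[v [hv h k]]; apply/asboolP; exists (adjmx v).
by rewrite adjmxK; split=> //; exact: mx_in_adj.
Qed.

Lemma mvn_trans : transitive mvn.
Proof.
move=> q p r /asboolP[v [hv vp vq]] /asboolP[w [hw wq wr]]; apply/asboolP.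
exists (w *m v); rewrite adjmxM; split; first exact: mx_inM.
  by rewrite mulmxA -(mulmxA _ _ w) wq -vq mulmxA vp -mulmxA vp mxproj_idem.
by rewrite mulmxA -(mulmxA w) vq -wq mulmxA wr -mulmxA wr mxproj_idem.
Qed.

Canonical mvn_equiv := EquivRel mvn mvn_refl mvn_sym mvn_trans.

Lemma mxproj0_idem : (0 : 'M[A]_0) *m (0 : 'M[A]_0) = 0. Proof. exact: mul0mx. Qed.

Definition mxproj0 : mxproj :=
  @MxProj 0 0 (@mx_in0 0 0) mxproj0_idem (@adjmx0 R A 0 0).

Section DirectSum.
Variables p q : mxproj.

Definition dsum_mx := block_mx p 0 0 q.

Lemma dsum_in : mx_in dsum_mx.
Proof. by apply: mx_in_block; [exact: mxproj_in|exact: mx_in0..|exact: mxproj_in]. Qed.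

Lemma dsum_idem : dsum_mx *m dsum_mx = dsum_mx.
Proof.
by rewrite mulmx_block !mulmx0 !mul0mx !addr0 add0r !mxproj_idem.
Qed.

Lemma dsum_adj : adjmx dsum_mx = dsum_mx.
Proof. by rewrite adjmx_block !adjmx0 !mxproj_adj. Qed.

Definition dsum : mxproj := MxProj dsum_in dsum_idem dsum_adj.

End DirectSum.

Lemma mvn_dsum p p' q q' :
  mvn p p' -> mvn q q' -> mvn (dsum p q) (dsum p' q').
Proof.
move=> /asboolP[v [hv v1 v2]] /asboolP[w [hw w1 w2]]; apply/asboolP.
exists (block_mx v 0 0 w); rewrite adjmx_block !adjmx0; split.
- by apply: mx_in_block => //; exact: mx_in0.
- by rewrite mulmx_block !mulmx0 !mul0mx !addr0 add0r v1 w1.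
- by rewrite mulmx_block !mulmx0 !mul0mx !addr0 add0r v2 w2.
Qed.

Lemma mvn_dsumC p q : mvn (dsum p q) (dsum q p).
Proof.
apply/asboolP; exists (block_mx 0 (mxproj_mx q) (mxproj_mx p) 0).
rewrite adjmx_block !adjmx0 !mxproj_adj; split.
- by apply: mx_in_block; try exact: mx_in0; exact: mxproj_in.
- by rewrite mulmx_block !mulmx0 !mul0mx !addr0 !add0r !mxproj_idem.
- by rewrite mulmx_block !mulmx0 !mul0mx !addr0 !add0r !mxproj_idem.
Qed.

Lemma mvn_dsum0 p : mvn (dsum mxproj0 p) p.
Proof.
apply/asboolP; exists (row_mx 0 (mxproj_mx p)).
rewrite adjmx_row adjmx0 mxproj_adj; split.
- by apply: mx_in_row; [exact: mx_in0|exact: mxproj_in].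
- by rewrite mul_col_row !mulmx0 !mul0mx mxproj_idem.
- by rewrite mul_row_col mul0mx add0r mxproj_idem.
Qed.

Lemma mvn_cast (p q : mxproj) (e : mxproj_dim p = mxproj_dim q) :
  castmx (e, e) (mxproj_mx p) = q -> mvn p q.
Proof.
case: p q e => [n p pin pi pa] [m q qin qi qa] /= e.
case: m / e q qin qi qa => q qin qi qa /=; rewrite castmx_id => pq.
by apply/asboolP; exists p; rewrite /= pa pi pq.
Qed.

Lemma mvn_dsumA p q r : mvn (dsum p (dsum q r)) (dsum (dsum p q) r).
Proof.
pose e := addnA (mxproj_dim p) (mxproj_dim q) (mxproj_dim r).
apply: (@mvn_cast (dsum p (dsum q r)) (dsum (dsum p q) r) e).
rewrite /= /dsum_mx /= /dsum_mx -[in LHS]row_mx0 -[in LHS]col_mx0.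
rewrite block_mxA castmx_comp col_mx0 row_mx0.
by rewrite castmx_id.
Qed.

(* the semigroup V(D) of classes of projections in matrices over D *)
Definition Vsg : Type := {eq_quot mvn}.
HB.instance Definition _ := EqQuotient.on Vsg.
HB.instance Definition _ := Choice.on Vsg.

Definition Vclass (p : mxproj) : Vsg := \pi_Vsg p.

Lemma VclassP p q : Vclass p = Vclass q <-> mvn p q.
Proof.
by split=> [/eqP|h]; [|apply/eqP]; rewrite /Vclass eqmodE.
Qed.

Lemma Vclass_repr x : Vclass (repr x) = x. Proof. exact: reprK. Qed.

Definition Vadd (x y : Vsg) : Vsg := Vclass (dsum (repr x) (repr y)).

Lemma VaddE p q : Vadd (Vclass p) (Vclass q) = Vclass (dsum p q).
Proof. by apply/VclassP/mvn_dsum; apply/VclassP; rewrite Vclass_repr. Qed.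

Lemma VaddA : associative Vadd.
Proof.
move=> x y z; rewrite -[x]Vclass_repr -[y]Vclass_repr -[z]Vclass_repr !VaddE.
exact/VclassP/mvn_dsumA.
Qed.

Lemma VaddC : commutative Vadd.
Proof. by move=> x y; exact/VclassP/mvn_dsumC. Qed.

Lemma Vadd0 : left_id (Vclass mxproj0) Vadd.
Proof. by move=> x; rewrite -[x]Vclass_repr VaddE; exact/VclassP/mvn_dsum0. Qed.

HB.instance Definition _ := GRing.isNmodule.Build Vsg VaddA VaddC Vadd0.

Definition K0 : Type := groth Vsg.
HB.instance Definition _ := GRing.Zmodule.on K0.

Definition K0_class (p : mxproj) : K0 := groth_pair (Vclass p, 0).

Definition K0_le (x y : K0) : Prop := exists p, y - x = K0_class p.

Section Size1.
Variable p : projection D.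

Definition proj_mx1 : 'M[A]_1 := \matrix_(_, _) (p : A).

Lemma proj_mx1_in : mx_in proj_mx1.
Proof. by move=> i j; rewrite mxE; exact: projP. Qed.

Lemma proj_mx1_idem : proj_mx1 *m proj_mx1 = proj_mx1.
Proof.
by apply/matrixP => i j; rewrite !mxE big_ord1 !mxE; case: (proj_projP p).
Qed.

Lemma proj_mx1_adj : adjmx proj_mx1 = proj_mx1.
Proof. by apply/matrixP => i j; rewrite !mxE; case: (proj_projP p). Qed.

Definition K0_proj : K0 :=
  K0_class (MxProj proj_mx1_in proj_mx1_idem proj_mx1_adj).

End Size1.

End K0.

Record automorphism (R : realType) (A : cstarAlgType R) := Automorphism {
  aut_fun :> A -> A ;
  autD : {morph aut_fun : x y / x + y} ;
  autZ : forall (c : R[i]) x, aut_fun (c *: x) = c *: aut_fun x ;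
  autM : {morph aut_fun : x y / x * y} ;
  aut_star : forall x, aut_fun (star x) = star (aut_fun x) ;
  aut_bij : bijective aut_fun
}.

Section RohlinProperties.
Variables (R : realType) (A : cstarAlgType R) (alpha : automorphism A).

(* ordS j is the cyclic successor j + 1 mod k i, so that e_{i,k_i} = e_{i,0} *)
Definition rohlin_property : Prop :=
  forall k : nat, (0 < k)%N ->
  exists (m : nat) (ks : 'I_m -> nat),
    [/\ (0 < m)%N, forall i, (k <= ks i)%N &
    forall (F : set A) (eps : R), finite_set F -> 0 < eps ->
    exists e : forall i : 'I_m, 'I_(ks i) -> A,
      [/\ forall i j, is_projection (e i j),
          \sum_(i < m) \sum_(j < ks i) e i j = 1,
          forall i j, `|alpha (e i j) - e i (ordS j)| < eps%:C
        & forall i j x, F x -> `|x * e i j - e i j * x| < eps%:C]].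

Definition approx_cyclic_stack (eps : R) (m : nat) (e : 'I_m -> A) : Prop :=
  [/\ forall i, is_projection (e i),
      forall i j, i != j -> e i * e j = 0
    & forall i, `|alpha (e i) - e (ordS i)| < eps%:C].

(* The height of the stack is m.+1, so that it ranges over positive integers;
   f is the projection 1 - \sum_i e i, made an element of the commutant. *)
Definition approx_rohlin_property : Prop :=
  forall (m n : nat) (eps : R) (B : csubalg A),
    (0 < n)%N -> 0 < eps -> fin_dim B ->
  exists (e : 'I_m.+1 -> projection (commutant B))
         (f : projection (commutant B)),
    [/\ approx_cyclic_stack eps e,
        f = 1 - \sum_i (e i : A) :> A,
        forall i j, K0_proj (e i) = K0_proj (e j)
      & K0_le (K0_proj f *+ n) (K0_proj (e ord0))].

End RohlinProperties.

(* Main.v *)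
Require Import Defs.
From HB Require Import structures.
From mathcomp Require Import all_boot all_order all_algebra.
From mathcomp Require Import complex.
From mathcomp Require Import all_classical all_reals all_analysis.
From mathcomp Require Import ring lra zify.
From Stdlib Require Ncring Ncring_tac.
Set Implicit Arguments.
Unset Strict Implicit.
Unset Printing Implicit Defensive.
Import Order.TTheory GRing.Theory Num.Theory.
Import numFieldNormedType.Exports.
Local Open Scope classical_set_scope.
Local Open Scope ring_scope.

(**
The proof turns the approximate conditions into exact ones. Let [Q] be the algebra of
bounded sequences in [A] modulo null sequences, and [beta] the automorphism that [alpha]
induces on it ([alpha] is isometric by [aut_nrm]). Projections of [Q] that commute with
the constant sequences, are cyclically permuted by [beta] up to a small error and have
sum 1 lift to projections of [A] with sum 1 ([lift_projections]); so the Rohlin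
projections need only be found among the central sequences, where the approximate
Rohlin property gives an exact cyclic stack [e, beta e, ..., beta^(m-1) e] with
[beta^m e = e] ([stack_sequence]). Let [f] be 1 minus the sum of this stack.

If [f] were 0 and [k] divided [m], the sums over residue classes modulo [k] would be
one tower of height [k]. In general [f] is small: three copies of [f] fit below [e].
Suppose that [Y_0, ..., Y_m] are isometries from [f] into [e] that change slowly and
satisfy [beta^m Y_m = Y_0]. Then [V_i = beta^i Y_i] embeds [f] in [beta^i e], [beta V_i]
is close to [V_(i+1)], and the last [V] returns to [V_0]. An element [U] close to 1
corrects [beta] so that it permutes the [V_i] cyclically and fixes [f]. On these
[m + 1] copies of [f] the corrected map has as eigenvalues the [m]-th roots of unity
and, for [f] itself, once more 1. In their cyclic order these are within
[4 pi / (m + 1)] of the [m + 1]-st roots of unity, so a second small correction makes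
the map a cyclic shift of [m + 1] copies of [f]. If [k] divides [m] and [k + 1] divides
[m + 1], sums over residue classes modulo [k + 1] of these copies, and modulo [k] of
what they leave of the stack, are two towers of heights [k + 1] and [k] with total
sum 1 ([towers]).

The path [Y] has to lead from an isometry [z] to [z' = beta^(-m) z]. Rotating one into
the other takes orthogonal ranges, which these do not have. But a second stack, of
height two and commuting with everything so far, gives [q0 + q1 + q2 = 1] with [q0] and
[q1] equivalent and [q2] smaller ([layer_sequence]). Using the three copies of [f]
below [e], everything can be moved under [q0], then under [q1], and then into place
([layered_path]).

The hypotheses are about K_0 and the proof is about partial isometries. An inequality
in K_0 is one between projections after a projection [r] has been added to both sides,
and [r] must be cancelled. In a finite-dimensional star algebra it can be, by comparing
the ranks of the operators [x |-> a x b] ([finite_comparison]). The commutant of a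
finite-dimensional subalgebra is again a limit of finite-dimensional ones, since
averaging with a separability idempotent projects onto it ([commutant_approx]); so the
cancellation holds there as well, up to an error ([commutant_comparison]) that vanishes
in [Q].
*)

(** * Identities in noncommutative rings *)

(** Reification of ring expressions, for a decision procedure that does not assume
commutativity. *)
#[local] Instance pz_ops (T : pzRingType) : @Ncring.Ring_ops T 0 1 +%R *%R (fun x y => x - y) -%R eq.
Proof. Defined.

#[local] Instance pz_ring (T : pzRingType) : @Ncring.Ring T 0 1 +%R *%R (fun x y => x - y) -%R eq (@pz_ops T).
Proof.
split.
- by split=> [x|x y ->|x y z -> ->].
- by move=> ? ? -> ? ? ->.
- by move=> ? ? -> ? ? ->.
- by move=> ? ? -> ? ? ->.
- by move=> ? ? ->.
- exact: (@add0r T).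
- exact: (@addrC T).
- exact: (@addrA T).
- exact: (@mul1r T).
- exact: (@mulr1 T).
- exact: (@mulrA T).
- exact: (@mulrDl T).
- by move=> x y z; exact: (@mulrDr T).
- by [].
- exact: (@subrr T).
Qed.

Ltac ncring := Ncring_tac.non_commutative_ring.

(** * Traces of idempotent matrices *)

(** If [M = C R] is a full-rank factorization, [M M = M] forces [R C = 1], and the
trace of [C R] is that of [R C]. *)
Lemma mxtrace_idem (F : fieldType) n (M : 'M[F]_n) :
  M *m M = M -> \tr M = (\rank M)%:R.
Proof.
move=> MM; rewrite -{1}[M]mulmx_base mxtrace_mulC.
suff -> : row_base M *m col_base M = 1%:M by rewrite mxtrace1.
have := MM; rewrite -{1 2 3}[M]mulmx_base mulmxA.
move/(row_free_inj (row_base_free M)).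
rewrite -[in RHS](mulmx1 (col_base M)) -mulmxA => h.
have fr : row_free (col_base M)^T by rewrite /row_free mxrank_tr; exact: col_base_full.
apply: trmx_inj; apply: (row_free_inj fr); rewrite -!trmx_mul; congr trmx; exact: h.
Qed.

(** * Finite-dimensional algebras with a proper involution *)

(** The scalars enter through a ring morphism [sg] and the involution is any additive
map, so that one theory serves for a C*-algebra, for the matrices over it, and for
the algebra of its bounded sequences. *)
Record star_axioms (C : numClosedFieldType) (T : pzRingType)
    (sg : C -> T) (st : T -> T) : Prop := StarAxioms {
  star_sgC : forall c x, sg c * x = x * sg c ;
  star_stM : forall x y, st (x * y) = st y * st x ;
  star_stK : forall x, st (st x) = x ;
  star_sg : forall c, st (sg c) = sg c^* }.

Record star_subalg (C : numClosedFieldType) (T : pzRingType)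
    (sg : C -> T) (st : T -> T) (S : T -> Prop) : Prop := StarSubalg {
  ssub1 : S 1 ;
  ssubD : forall x y, S x -> S y -> S (x + y) ;
  ssubZ : forall c x, S x -> S (sg c * x) ;
  ssubM : forall x y, S x -> S y -> S (x * y) ;
  ssub_st : forall x, S x -> S (st x) }.

Definition finspan (C : numClosedFieldType) (T : pzRingType)
    (sg : C -> T) (S : T -> Prop) : Prop :=
  exists (I : finType) (d : I -> T), (forall i, S (d i)) /\
    forall x, S x -> exists c : I -> C, x = \sum_i sg (c i) * d i.

(** What the C*-identity leaves when norms are forgotten. It is enough for the
finite-dimensional theory, and it passes to matrices. *)
Definition proper_star (T : pzRingType) (st : T -> T) (S : T -> Prop) :=
  forall x, S x -> st x * x = 0 -> x = 0.

Definition sproj (T : pzRingType) (st : T -> T) (p : T) :=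
  p * p = p /\ st p = p.

Section Spectral.
Variables (C : numClosedFieldType) (T : pzRingType).
Variables (sg : {rmorphism C -> T}) (st : {additive T -> T}) (S : T -> Prop).
Hypothesis ax : star_axioms sg st.
Hypothesis SS : star_subalg sg st S.
Hypothesis fS : finspan sg S.

Let sgC := star_sgC ax.
Let stM := star_stM ax.
Let stK := star_stK ax.
Let stsg := star_sg ax.

Lemma star_st1 : st 1 = 1.
Proof. by rewrite -[1 in LHS](rmorph1 sg) stsg conjC1 rmorph1. Qed.

Lemma sub_sg c : S (sg c).
Proof. by rewrite -[sg c]mulr1; apply: (ssubZ SS); exact: (ssub1 SS). Qed.

Lemma sub0 : S 0.
Proof. by rewrite -(rmorph0 sg); exact: sub_sg. Qed.

Lemma subN x : S x -> S (- x).
Proof. by move=> Sx; rewrite -mulN1r -(rmorph1 sg) -rmorphN; exact: (ssubZ SS). Qed.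

Lemma subB x y : S x -> S y -> S (x - y).
Proof. by move=> Sx Sy; apply: (ssubD SS) => //; exact: subN. Qed.

Lemma sub_sum (I : Type) (r : seq I) (P : pred I) (F : I -> T) :
  (forall i, P i -> S (F i)) -> S (\sum_(i <- r | P i) F i).
Proof.
by move=> SF; elim/big_ind: _ => //; [exact: sub0|exact: (ssubD SS)].
Qed.

Section Element.
Variable h : T.
Hypothesis Sh : S h.

Let ev (p : {poly C}) := \sum_(i < size p) sg p`_i * h ^+ i.

Let ev_wide n (p : {poly C}) : (size p <= n)%N ->
  ev p = \sum_(i < n) sg p`_i * h ^+ i.
Proof.
move=> le_pn; rewrite /ev (big_ord_widen n (fun i => sg p`_i * h ^+ i)) //.
rewrite big_mkcond; apply: eq_bigr => i _; case: ltnP => // hi.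
by rewrite nth_default // rmorph0 mul0r.
Qed.

Let evZ c (p : {poly C}) : ev (c *: p) = sg c * ev p.
Proof.
rewrite (ev_wide (n := size p)) ?size_scale_leq // /ev mulr_sumr.
by apply: eq_bigr => i _; rewrite coefZ rmorphM mulrA.
Qed.

Let evMX (p : {poly C}) a : ev (p * ('X - a%:P)) = ev p * (h - sg a).
Proof.
have sp : (size (p * ('X - a%:P))%R <= (size p).+1)%N.
  by rewrite (leq_trans (size_polyMleq _ _)) // size_XsubC addnS addn1 /= .
rewrite (ev_wide sp) mulrBr /ev.
transitivity (\sum_(i < (size p).+1) (sg (p * 'X)`_i * h ^+ i)
   - \sum_(i < (size p).+1) sg (p * a%:P)`_i * h ^+ i).
  by rewrite -sumrB; apply: eq_bigr => i _; rewrite mulrBr coefB rmorphB mulrBl.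
congr (_ - _).
  rewrite big_ord_recl coefMX /= rmorph0 mul0r add0r mulr_suml.
  by apply: eq_bigr => i _; rewrite coefMX /= exprSr mulrA.
rewrite big_ord_recr /= coefMC nth_default // mul0r rmorph0 mul0r addr0 mulr_suml.
by apply: eq_bigr => i _; rewrite coefMC rmorphM -!mulrA (sgC a).
Qed.

Let kill (s : seq C) x := foldr (fun l y => (h - sg l) * y) x s.

Let sub_hl l : S (h - sg l). Proof. by apply: subB => //; exact: sub_sg. Qed.

Let comm_hl l l' : (h - sg l) * (h - sg l') = (h - sg l') * (h - sg l).
Proof.
have -> : (h - sg l) * (h - sg l') = h*h - h*sg l' - sg l*h + sg l* sg l' by ncring.
by rewrite -(sgC l') (sgC l h) (sgC l); ncring.
Qed.

Let kill_comm s l x : kill s ((h - sg l) * x) = (h - sg l) * kill s x.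
Proof. by elim: s => //= m s ->; rewrite !mulrA comm_hl. Qed.

Let killM s x y : kill s (x * y) = kill s x * y.
Proof. by elim: s => //= l s ->; rewrite mulrA. Qed.

Let ev_prod (s : seq C) : ev (\prod_(l <- s) ('X - l%:P)) = kill s 1.
Proof.
elim: s => [|l s IH]; first by rewrite big_nil (ev_wide (n := 1)) ?size_poly1 // big_ord1 coef1 rmorph1 mul1r.
by rewrite big_cons mulrC evMX IH /= -killM -kill_comm mul1r mulr1.
Qed.

(** The powers of [h] are linearly dependent, so a polynomial in [h] vanishes; over
an algebraically closed field it is a product of linear factors. *)
Lemma annihilating_roots : exists s : seq C, kill s 1 = 0.
Proof.
case: fS => I [d [dS span]].
have hX n : S (h ^+ n).
  by elim: n => [|n IH]; rewrite ?expr0 ?exprS; [exact: (ssub1 SS)|exact: (ssubM SS)].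
have /choice[c cE] : forall n, exists c : I -> C, h ^+ n = \sum_i sg (c i) * d i.
  by move=> n; exact: span.
pose M := \matrix_(n < #|I|.+1, j < #|I|) c n (enum_val j).
have : kermx M != 0.
  by rewrite kermx_eq0 /row_free neq_ltn ltnS rank_leq_col.
case/rowV0Pn => u /sub_kermxP uM u0.
pose p := rVpoly u.
have p0 : p != 0 by apply: contra_neq u0 => p0; rewrite -(rVpolyK u) -/p p0 linear0.
have evp : ev p = 0.
  rewrite (ev_wide (n := #|I|.+1)) ?size_poly //.
  under eq_bigr => n _ do rewrite coef_rVpoly_ord cE mulr_sumr.
  rewrite exchange_big /= big1 // => i _.
  under eq_bigr => n _ do rewrite mulrA -rmorphM.
  rewrite -mulr_suml -rmorph_sum.
  have /rowP/(_ (enum_rank i)) := uM; rewrite !mxE => h0.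
  rewrite [X in sg X](_ : _ = 0) ?rmorph0 ?mul0r // -[RHS]h0.
  by apply: eq_bigr => n _; rewrite mxE enum_rankK.
have [s ps] := closed_field_poly_normal p.
exists s; rewrite -ev_prod; have := evp; rewrite ps evZ => /(congr1 (fun x => sg (lead_coef p)^-1 * x)).
by rewrite mulrA -rmorphM mulVf ?lead_coef_eq0 // rmorph1 mul1r mulr0.
Qed.

Hypothesis pS : proper_star st S.
Hypothesis hh : st h = h.

Let stB x y : st (x - y) = st x - st y. Proof. exact: raddfB. Qed.

Let eig_real l w : S w -> h * w = sg l * w -> l^* != l -> w = 0.
Proof.
move=> Sw hw ll; apply: pS => //.
have e : sg l^* * (st w * w) = sg l * (st w * w).
  by rewrite mulrA -stsg -stM -(sgC l w) -hw stM hh -mulrA hw mulrA -sgC -mulrA.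
have : sg (l^* - l) * (st w * w) = 0 by rewrite rmorphB mulrBl e subrr.
move/(congr1 (fun x => sg (l^* - l)^-1 * x)).
by rewrite mulrA -rmorphM mulVf ?subr_eq0 // rmorph1 mul1r mulr0.
Qed.

(** Hermitian elements have no generalized eigenvectors: if [l] is real and [y] is
[(h - l) x], then [y^* y] is [x^* (h - l) y = 0]; if it is not, [y = 0] already
because eigenvalues are real. *)
Let eig_square l x : S x -> (h - sg l) * ((h - sg l) * x) = 0 -> (h - sg l) * x = 0.
Proof.
move=> Sx h2; have [ll|ll] := eqVneq l^* l; last first.
  apply: (eig_real _ _ ll); first exact: (ssubM SS).
  by apply/eqP; rewrite -subr_eq0 -mulrBl h2.
apply: pS; first exact: (ssubM SS).
by rewrite stM stB stsg hh ll -mulrA h2 mulr0.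
Qed.

(** Induction on the factors. If the product of the others splits [(h - l) x] into
eigenvectors [F m], then dividing those with [m != l] by [m - l] gives a part of
[x], and the rest of [x] is an eigenvector for [l]. *)
Let eig_decomposition s x : S x -> kill s x = 0 ->
  exists (t : seq C) (F : C -> T), [/\ uniq t, forall l, S (F l),
    forall l, h * F l = sg l * F l & x = \sum_(l <- t) F l].
Proof.
elim: s x => [|l s IH] x Sx /=.
  move=> ->; exists [::], (fun=> 0); split=> //; rewrite ?big_nil //.
  - by move=> _; exact: sub0.
  - by move=> l; rewrite !mulr0.
rewrite -kill_comm => /IH[|t [F [ut SF hF xE]]]; first exact: (ssubM SS).
pose y := \sum_(m <- t | m != l) sg (m - l)^-1 * F m.
have Sy : S y by apply: sub_sum => m _; exact: (ssubZ SS).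
have hy : (h - sg l) * y = \sum_(m <- t | m != l) F m.
  rewrite mulr_sumr; apply: eq_bigr => m ml.
  rewrite mulrA -sgC -mulrA mulrBl hF -mulrBl -rmorphB mulrA -rmorphM.
  by rewrite mulVf ?subr_eq0 // rmorph1 mul1r.
have hx' : (h - sg l) * (x - y) = 0.
  apply: eig_square; first exact: subB.
  rewrite mulrBr hy xE (bigID (fun m => m != l)) /= addrAC subrr add0r mulr_sumr.
  rewrite big1 // => m; rewrite negbK => /eqP ->.
  by rewrite mulrBl hF subrr.
exists (l :: [seq m <- t | m != l]), (fun m => if m == l then x - y else sg (m - l)^-1 * F m).
split=> [|m|m|].
- by rewrite /= filter_uniq // andbT mem_filter eqxx.
- by case: eqP => _; [exact: subB|exact: (ssubZ SS)].
- case: eqP => [->|_].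
    by apply/eqP; rewrite -subr_eq0 -mulrBl hx'.
  by rewrite mulrA -sgC -mulrA hF mulrA sgC -!mulrA; congr (_ * _); rewrite sgC.
rewrite big_cons eqxx big_filter -[LHS](subrK y); congr (_ + _).
by apply: eq_bigr => m /negPf ->.
Qed.

(** The components [x_l] of [1] in the eigenspaces are automatically orthogonal
projections: [x_l^* x_m = 0] for [l != m] because the eigenvalues are real, whence
[x_l^* = x_l^* 1 = x_l^* x_l]. *)
Lemma spectral_decomposition : exists (t : seq C) (F : C -> T),
  [/\ [/\ uniq t, {in t, forall l, l^* = l} & forall l, S (F l)],
      {in t, forall l, sproj st (F l)},
      {in t &, forall l m, l != m -> F l * F m = 0},
      {in t, forall l, F l != 0 /\ h * F l = sg l * F l}
    & 1 = \sum_(l <- t) F l].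
Proof.
have [s ks] := annihilating_roots.
have [t0 [F [ut0 SF hF E0]]] := eig_decomposition (ssub1 SS) ks.
pose t := [seq l <- t0 | F l != 0].
have E : 1 = \sum_(l <- t) F l.
  rewrite E0 [RHS]big_filter [RHS]big_mkcond; apply: eq_bigr => l _.
  by case: eqP.
have ut : uniq t by exact: filter_uniq.
have real_t : {in t, forall l, l^* = l}.
  move=> l; rewrite mem_filter => /andP[F0 _]; apply/eqP.
  by apply: contraNT F0 => ll; apply/eqP; exact: eig_real ll.
have orth l m : l \in t -> m \in t -> l != m -> st (F l) * F m = 0.
  move=> lt mt lm.
  have e : sg l * (st (F l) * F m) = sg m * (st (F l) * F m).
    rewrite mulrA -{1}(real_t _ lt) -stsg -stM -(sgC l (F l)) -hF stM hh -mulrA hF.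
    by rewrite mulrA -sgC -mulrA.
  have : sg (l - m) * (st (F l) * F m) = 0 by rewrite rmorphB mulrBl e subrr.
  move/(congr1 (fun x => sg (l - m)^-1 * x)).
  by rewrite mulrA -rmorphM mulVf ?subr_eq0 // rmorph1 mul1r mulr0.
have idem l : l \in t -> st (F l) = st (F l) * F l.
  move=> lt; rewrite -[LHS]mulr1 E mulr_sumr (bigD1_seq l) //= big_seq_cond.
  rewrite [X in _ + X]big1 ?addr0 // => m /andP[mt ml].
  by rewrite orth // eq_sym.
have sa l : l \in t -> st (F l) = F l.
  by move=> lt; rewrite -[RHS]stK [in RHS](idem l lt) stM stK -idem.
exists t, F; split=> //.
- by move=> l lt; split; [rewrite -{1}(sa l lt) -idem // sa|exact: sa].
- by move=> l m lt mt lm; rewrite -(sa l lt) orth.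
- by move=> l; rewrite mem_filter => /andP[].
Qed.

End Element.
End Spectral.

(** * Projections near approximate projections *)

Section NearProjection.
Variables (C : numClosedFieldType) (T : pzRingType).
Variables (sg : {rmorphism C -> T}) (st : {additive T -> T}) (S : T -> Prop).
Hypothesis ax : star_axioms sg st.
Hypothesis SS : star_subalg sg st S.
Hypothesis fS : finspan sg S.
Hypothesis pS : proper_star st S.

(** [p] is the spectral projection of [h] for the eigenvalues [>= 1/2]; the cofactor
[k] has coefficients [(l - chi l) / (l ^ 2 - l)], of modulus at most 2. The last
equation expresses this bound without a norm, so that it remains usable for
matrices; [b] is the square root of [4 - k ^ 2]. *)
Lemma near_projection h : S h -> st h = h -> exists p k l b,
  [/\ [/\ S p, S k, S l & S b], sproj st p, h - p = (h * h - h) * k, p = h * l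
    & st k * k + st b * b = sg 4].
Proof.
move=> Sh hh.
have [t [F [[ut rt SF] pF oF hF E]]] := spectral_decomposition ax SS fS Sh pS hh.
pose fc g := \sum_(l <- t) sg (g l) * F l.
have Sfc g : S (fc g) by apply: (sub_sum SS) => l _; exact: (ssubZ SS).
have fcM g g' : fc g * fc g' = fc (fun l => g l * g' l).
  rewrite /fc mulr_suml; apply: eq_big_seq => l lt.
  rewrite mulr_sumr (bigD1_seq l) //= big_seq_cond big1 ?addr0 => [|m /andP[mt ml]].
    rewrite -mulrA (mulrA (F l)) -(star_sgC ax) -!mulrA rmorphM -mulrA.
    by case: (pF l lt) => -> _.
  by rewrite -mulrA (mulrA (F l)) -(star_sgC ax) -!mulrA oF // ?mulr0 // eq_sym.
have fcst g : st (fc g) = fc (fun l => (g l)^*).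
  rewrite /fc raddf_sum; apply: eq_big_seq => l lt.
  by rewrite (star_stM ax) (star_sg ax) (star_sgC ax); case: (pF l lt) => _ ->.
have fcB g g' : fc g - fc g' = fc (fun l => g l - g' l).
  by rewrite -sumrB; apply: eq_bigr => l _; rewrite rmorphB mulrBl.
have fcD g g' : fc g + fc g' = fc (fun l => g l + g' l).
  by rewrite -big_split; apply: eq_bigr => l _; rewrite rmorphD mulrDl.
have fcE g g' : {in t, g =1 g'} -> fc g = fc g'.
  by move=> gg; apply: eq_big_seq => l lt; rewrite gg.
have fcC c : fc (fun=> c) = sg c by rewrite /fc -mulr_sumr -E mulr1.
have hE : h = fc id.
  rewrite -[LHS]mulr1 E mulr_sumr; apply: eq_big_seq => l lt.
  by case: (hF l lt).
pose chi (l : C) : C := (2^-1 <= l)%R%:R.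
pose kap (l : C) := if 2^-1 <= l then l^-1 else (l - 1)^-1.
pose bet (l : C) := sqrtC (4 - kap l ^+ 2).
have realt l : l \in t -> l \is Num.real by move=> /rt h1; apply/CrealP.
have kr l : l \in t -> kap l \is Num.real.
  by move=> lt; rewrite /kap; case: ifP => _; rewrite rpredV ?rpredB ?rpred1 // realt.
have h0 : 0 < 2^-1 :> C by rewrite invr_gt0 ltr0n.
have gt1 l : l \in t -> ~~ (2^-1 <= l) -> l < 2^-1.
  by move=> lt; have lr := realt l lt; rewrite -real_ltNge // ?gtr0_real.
have k4 l : l \in t -> 0 <= 4 - kap l ^+ 2.
  move=> lt; rewrite subr_ge0 /kap; case: ifP => [hl|/negbT/(gt1 _ lt) hl].
    have l0 : 0 < l by exact: lt_le_trans hl.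
    rewrite exprVn -[4]invrK lef_pV2 ?posrE ?invr_gt0 ?ltr0n ?exprn_gt0 //.
    rewrite (_ : 4^-1 = 2^-1 ^+ 2); last by field.
    by rewrite ler_sqr ?nnegrE // ltW.
  have l1 : 2^-1 < 1 - l by rewrite ltrBrDl -ltrBrDr (lt_le_trans hl) // le_eqVlt; apply/orP; left; apply/eqP; field.
  rewrite -(sqrrN (l - 1)^-1) -invrN opprB exprVn -[4]invrK lef_pV2 ?posrE ?invr_gt0 ?ltr0n ?exprn_gt0 //; last exact: lt_trans l1.
  rewrite (_ : 4^-1 = 2^-1 ^+ 2); last by field.
  by rewrite ler_sqr ?nnegrE // ltW // (lt_trans h0).
exists (fc chi), (fc kap), (fc (fun l => chi l * l^-1)), (fc bet); split.
- by split; exact: Sfc.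
- split; rewrite ?fcM ?fcst; apply: fcE => l lt.
    by rewrite /chi -natrM mulnb andbb.
  by rewrite /chi conjC_nat.
- rewrite hE fcM !fcB fcM; apply: fcE => l lt.
  rewrite /chi /kap; case: ifP => [hl|/negbT/(gt1 _ lt) hl] /=.
    have l0 : l != 0 by rewrite gt_eqF // (lt_le_trans h0).
    by field.
  have l1 : l - 1 != 0.
    by rewrite subr_eq0 lt_eqF // (lt_trans hl) // invf_lt1 ?ltr0n // ltr1n.
  by field.
- rewrite hE fcM; apply: fcE => l lt; rewrite /chi.
  case: (boolP (2^-1 <= l)) => [hl|_] /=; last by rewrite mul0r mulr0.
  by rewrite mul1r mulfV // gt_eqF // (lt_le_trans h0).
- rewrite !fcst !fcM fcD -fcC; apply: fcE => l lt.
  have b0 : 0 <= bet l by rewrite sqrtC_ge0 k4.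
  rewrite (geC0_conj b0) (CrealP (kr l lt)) -!expr2 sqrtCK; ring.
Qed.

End NearProjection.

(** * The operators x |-> a x b of a finite-dimensional star algebra *)

Section Operators.
Variables (C : numClosedFieldType) (T : pzRingType).
Variables (sg : {rmorphism C -> T}) (st : {additive T -> T}) (S : T -> Prop).
Hypothesis ax : star_axioms sg st.
Hypothesis SS : star_subalg sg st S.

Let sgC := star_sgC ax.
Let stM := star_stM ax.
Let stK := star_stK ax.
Let stsg := star_sg ax.

(** A spanning family of least size is free: a relation would eliminate one term. *)
Lemma finspan_basis : finspan sg S -> exists n (d : 'I_n -> T),
  [/\ forall i, S (d i),
      forall x, S x -> exists v : 'rV[C]_n, x = \sum_i sg (v 0 i) * d i
    & forall v : 'rV[C]_n, \sum_i sg (v 0 i) * d i = 0 -> v = 0].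
Proof.
case=> I [d0 [d0S d0span]].
pose P n := `[< exists d : 'I_n -> T, (forall i, S (d i)) /\
   forall x, S x -> exists v : 'rV[C]_n, x = \sum_i sg (v 0 i) * d i >].
have exP : exists n, P n.
  exists #|I|; apply/asboolP; exists (fun i => d0 (enum_val i)); split=> // x /d0span[c ->].
  exists (\row_i c (enum_val i)); rewrite (reindex _ (onW_bij _ (@enum_val_bij I))) /=.
  by apply: eq_bigr => i _; rewrite mxE.
case: (ex_minnP exP) => n /asboolP[d [dS dspan]] minn.
exists n, d; split=> // v v0; apply/rowP => k; rewrite mxE; apply: contrapT => /eqP vk.
case: n d dS dspan minn v v0 k vk => [|n] d dS dspan minn v v0 k vk; first by case: k vk.
suff /minn : P n by rewrite ltnn.
have dk : d k = \sum_i sg (- (v 0 k)^-1 * v 0 (lift k i)) * d (lift k i).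
  move: v0; rewrite (bigD1_ord k) //= => /(congr1 (fun x => sg (v 0 k)^-1 * x)).
  rewrite mulr0 mulrDr mulrA -rmorphM mulVf // rmorph1 mul1r => /eqP.
  rewrite addr_eq0 => /eqP ->; rewrite mulr_sumr -sumrN; apply: eq_bigr => i _.
  by rewrite mulNr rmorphN rmorphM mulNr mulrA.
apply/asboolP; exists (fun i => d (lift k i)); split=> // x /dspan[w ->].
exists (\row_i (w 0 (lift k i) - w 0 k * (v 0 k)^-1 * v 0 (lift k i))).
rewrite (bigD1_ord k) //= dk mulr_sumr -big_split; apply: eq_bigr => i _.
by rewrite mxE /= mulrA -rmorphM -mulrDl -rmorphD; congr (sg _ * _); ring.
Qed.

Variables (n : nat) (d : 'I_n -> T).
Hypothesis dS : forall i, S (d i).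
Hypothesis dspan : forall x, S x -> exists v : 'rV[C]_n, x = \sum_i sg (v 0 i) * d i.
Hypothesis dfree : forall v : 'rV[C]_n, \sum_i sg (v 0 i) * d i = 0 -> v = 0.

Definition lincomb (v : 'rV[C]_n) : T := \sum_i sg (v 0 i) * d i.

Lemma lincombD u v : lincomb (u + v) = lincomb u + lincomb v.
Proof. by rewrite -big_split; apply: eq_bigr => i _; rewrite mxE rmorphD mulrDl. Qed.

Lemma lincombZ c v : lincomb (c *: v) = sg c * lincomb v.
Proof. by rewrite mulr_sumr; apply: eq_bigr => i _; rewrite mxE rmorphM mulrA. Qed.

Lemma lincombB u v : lincomb (u - v) = lincomb u - lincomb v.
Proof. by rewrite -scaleN1r lincombD lincombZ rmorphN1 mulN1r. Qed.

Lemma lincomb_inj : injective lincomb.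
Proof.
by move=> u v uv; apply/eqP; rewrite -subr_eq0; apply/eqP/dfree; rewrite -/(lincomb _) lincombB uv subrr. Qed.

Lemma lincombS v : S (lincomb v).
Proof. by apply: (sub_sum SS) => i _; exact: (ssubZ SS). Qed.

Lemma coord_exists x : exists v, S x -> x = lincomb v.
Proof. by have [/dspan[v ->]|Sx] := pselect (S x); [exists v|exists 0]. Qed.

Definition coord x : 'rV[C]_n := sval (cid (coord_exists x)).

Lemma coordK x : S x -> lincomb (coord x) = x.
Proof. by move=> Sx; rewrite /coord; case: cid => v /= ->. Qed.

(** The operator [x |-> a x b] on [S] in the basis [d], acting on row vectors. *)
Definition sandwich_mx a b : 'M[C]_n := \matrix_i coord (a * d i * b).

Lemma sandwich_mxE a b v : S a -> S b ->
  lincomb (v *m sandwich_mx a b) = a * lincomb v * b.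
Proof.
move=> Sa Sb; rewrite /lincomb mulr_sumr mulr_suml.
transitivity (\sum_i \sum_j sg (v 0 i) * (sg (coord (a * d i * b) 0 j) * d j)).
  rewrite exchange_big; apply: eq_bigr => j _ /=; rewrite mxE rmorph_sum mulr_suml.
  by apply: eq_bigr => i _; rewrite rmorphM -mulrA mxE.
apply: eq_bigr => i _; rewrite -mulr_sumr -/(lincomb _) coordK; last first.
  by do 2?apply: (ssubM SS).
by rewrite !mulrA (sgC _ a).
Qed.

Lemma mx_lincomb_inj (M N : 'M[C]_n) :
  (forall v, lincomb (v *m M) = lincomb (v *m N)) -> M = N.
Proof. by move=> MN; apply/row_matrixP => i; rewrite !rowE; exact: lincomb_inj. Qed.

Lemma sandwich_mxM a b a' b' : S a -> S b -> S a' -> S b' ->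
  sandwich_mx a b *m sandwich_mx a' b' = sandwich_mx (a' * a) (b * b').
Proof.
move=> Sa Sb Sa' Sb'; apply: mx_lincomb_inj => v.
by rewrite mulmxA !sandwich_mxE ?mulrA //; exact: (ssubM SS).
Qed.

Lemma sandwich_mxDl a a' b : S a -> S a' -> S b ->
  sandwich_mx (a + a') b = sandwich_mx a b + sandwich_mx a' b.
Proof.
move=> Sa Sa' Sb; apply: mx_lincomb_inj => v.
by rewrite mulmxDr lincombD !sandwich_mxE ?mulrDl //; exact: (ssubD SS).
Qed.

Lemma sandwich_mxZl c a b : S a -> S b ->
  sandwich_mx (sg c * a) b = c *: sandwich_mx a b.
Proof.
move=> Sa Sb; apply: mx_lincomb_inj => v.
by rewrite -scalemxAr lincombZ !sandwich_mxE ?mulrA //; exact: (ssubZ SS).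
Qed.

Definition sandwich_tr a b := \tr (sandwich_mx a b).

Lemma sandwich_trD a a' b : S a -> S a' -> S b ->
  sandwich_tr (a + a') b = sandwich_tr a b + sandwich_tr a' b.
Proof. by move=> *; rewrite /sandwich_tr sandwich_mxDl // mxtraceD. Qed.

Lemma sandwich_trZ c a b : S a -> S b -> sandwich_tr (sg c * a) b = c * sandwich_tr a b.
Proof. by move=> *; rewrite /sandwich_tr sandwich_mxZl // mxtraceZ. Qed.

Lemma sandwich_trC a a' p : S a -> S a' -> S p -> p * p = p ->
  sandwich_tr (a * a') p = sandwich_tr (a' * a) p.
Proof.
move=> Sa Sa' Sp pp; rewrite /sandwich_tr -{1}pp -{1}[p in RHS]pp.
by rewrite -!sandwich_mxM // mxtrace_mulC.
Qed.

Lemma sandwich_tr_rank e p : S e -> S p -> e * e = e -> p * p = p ->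
  sandwich_tr e p = (\rank (sandwich_mx e p))%:R.
Proof. by move=> Se Sp ee pp; apply: mxtrace_idem; rewrite sandwich_mxM // ee pp. Qed.

Lemma sandwich_mx_eq0 a b : S a -> S b -> sandwich_mx a b = 0 ->
  forall x, S x -> a * x * b = 0.
Proof.
move=> Sa Sb h0 x Sx; rewrite -(coordK Sx) -sandwich_mxE // h0 mulmx0.
by rewrite /lincomb big1 // => i _; rewrite mxE rmorph0 mul0r.
Qed.

Lemma sandwich_mx0 a b : S a -> S b -> (forall x, S x -> a * x * b = 0) ->
  sandwich_mx a b = 0.
Proof.
move=> Sa Sb h0; apply: mx_lincomb_inj => v; rewrite sandwich_mxE // h0; last exact: lincombS.
by rewrite mulmx0 /lincomb big1 // => i _; rewrite mxE rmorph0 mul0r.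
Qed.

Let tau a := sandwich_tr a 1.
Let S1 := ssub1 SS.

Let tauD a b : S a -> S b -> tau (a + b) = tau a + tau b.
Proof. by move=> *; exact: sandwich_trD. Qed.

Let tauZ c a : S a -> tau (sg c * a) = c * tau a.
Proof. by move=> *; exact: sandwich_trZ. Qed.

Let tauC a b : S a -> S b -> tau (a * b) = tau (b * a).
Proof. by move=> *; apply: sandwich_trC; rewrite ?mulr1. Qed.

Hypothesis pS : proper_star st S.

Let fS : finspan sg S.
Proof. by exists 'I_n, d; split=> // x /dspan[v ->]; exists (v 0). Qed.

Let tau_sum (I : eqType) (r : seq I) (F : I -> T) : (forall i, S (F i)) ->
  tau (\sum_(i <- r) F i) = \sum_(i <- r) tau (F i).
Proof.
move=> SF; elim: r => [|i r IH]; last by rewrite !big_cons tauD ?IH //; exact: (sub_sum SS).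
rewrite !big_nil -[0](mul0r 1) -(rmorph0 sg) tauZ ?mul0r //.
Qed.

(** [h ^ 2] is a combination of the spectral projections with squares of real
numbers as coefficients, and [tau] of an idempotent is a rank. *)
Let tau_sq h : S h -> st h = h -> 0 <= tau (h * h) /\ (tau (h * h) = 0 -> h = 0).
Proof.
move=> Sh hh.
have [t [F [[ut rt SF] pF oF hF E]]] := spectral_decomposition ax SS fS Sh pS hh.
have hE : h = \sum_(l <- t) sg l * F l.
  by rewrite -[LHS]mulr1 E mulr_sumr; apply: eq_big_seq => l /hF[].
have h2 : h * h = \sum_(l <- t) sg (l ^+ 2) * F l.
  rewrite -[LHS]mulr1 E mulr_sumr; apply: eq_big_seq => l /hF[_ e].
  by rewrite -mulrA e mulrA -sgC -mulrA e mulrA -rmorphM.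
have tF l : l \in t -> exists k, tau (F l) = k%:R /\ (k = 0%N -> F l = 0).
  move=> lt; have [ii _] := pF l lt; exists (\rank (sandwich_mx (F l) 1)).
  split=> [|/eqP]; first by apply: sandwich_tr_rank; rewrite ?mulr1.
  rewrite mxrank_eq0 => /eqP/sandwich_mx_eq0 -/(_ (SF l) S1 1 S1).
  by rewrite !mulr1.
have pos l : l \in t -> 0 <= l ^+ 2 * tau (F l).
  move=> lt; rewrite mulr_ge0 //; last by have [k [-> _]] := tF l lt; exact: ler0n.
  by rewrite real_exprn_even_ge0 //; apply/CrealP/rt.
rewrite h2 tau_sum; last by move=> l; exact: (ssubZ SS).
under eq_bigr => l _ do rewrite tauZ //.
split; first by rewrite big_seq; apply: sumr_ge0 => l; exact: pos.
rewrite big_seq => /eqP; rewrite psumr_eq0 // => /allP z.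
rewrite hE big1_seq // => l /= lt; have := z l lt; rewrite lt mulf_eq0 /=.
rewrite expf_eq0 /= => /orP[/eqP ->|]; first by rewrite rmorph0 mul0r.
by have [k [-> k0]] := tF l lt; rewrite pnatr_eq0 => /eqP/k0 ->; rewrite mulr0.
Qed.

(** [4 tau(st a * a) = tau(s^2) + tau(t^2)] for the hermitian [s = a + st a] and
[t = i (a - st a)], because [tau] is a trace. *)
Let tau_pos a : S a -> 0 <= tau (st a * a) /\ (tau (st a * a) = 0 -> a = 0).
Proof.
move=> Sa; have Sb := ssub_st SS Sa.
pose s := a + st a; pose t := sg 'i * (a - st a).
have Ss : S s by exact: (ssubD SS).
have St : S t by apply: (ssubZ SS); exact: (subB SS).
have ss : st s = s by rewrite raddfD stK addrC.
have tt : st t = t.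
  rewrite stM stsg raddfB stK conjCi rmorphN /t sgC; ncring.
have e : tau (s * s) + tau (t * t) = 4 * tau (st a * a).
  have -> : t * t = st a * a + a * st a - a * a - st a * st a.
    rewrite /t -mulrA (mulrA _ (sg 'i)) -sgC !mulrA -rmorphM -expr2 sqrCi rmorphN1.
    by ncring.
  have -> : s * s = a * a + a * st a + st a * a + st a * st a by rewrite /s; ncring.
  have -> : 4 * tau (st a * a) = tau (st a * a + st a * a + (a * st a + a * st a)).
    by rewrite !tauD ?(tauC Sa Sb); [ring|by do ?[apply: (ssubD SS)]; exact: (ssubM SS)..].
  rewrite -tauD; first by congr tau; ncring.
    by do ?[apply: (ssubD SS)]; exact: (ssubM SS).
  by do ?[apply: (subB SS)|apply: (ssubD SS)|apply: (ssubM SS)].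
have [s0 s1] := tau_sq Ss ss; have [t0 t1] := tau_sq St tt.
have p4 : (0 : C) < 4 by rewrite ltr0n.
split; first by rewrite -(pmulr_rge0 _ p4) -e addr_ge0.
move=> z; move: e; rewrite z mulr0 => /eqP; rewrite paddr_eq0 // => /andP[/eqP/s1 sz /eqP/t1 tz].
have e : a - st a = 0.
  by have := congr1 (fun x => sg 'i^-1 * x) tz; rewrite /t mulrA -rmorphM mulVf ?neq0Ci // rmorph1 mul1r mulr0.
have : sg 2 * a = 0.
  have -> : sg 2 * a = s + (a - st a) by rewrite rmorphD rmorph1 /s; ncring.
  by rewrite sz e addr0.
move/(congr1 (fun x => sg 2^-1 * x)); rewrite mulrA -rmorphM mulVf ?pnatr_eq0 //.
by rewrite rmorph1 mul1r mulr0.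
Qed.

Let gram := \matrix_(i, j) tau (d i * d j).

Let gram_unit : gram \in unitmx.
Proof.
rewrite -row_free_unit -kermx_eq0; apply/rowV0P => v /sub_kermxP vG.
apply: dfree; rewrite -/(lincomb v).
have tz y : S y -> tau (lincomb v * y) = 0.
  move=> Sy; rewrite -(coordK Sy) {2}/lincomb mulr_sumr tau_sum; last first.
    by move=> j; apply: (ssubM SS); [exact: lincombS|exact: (ssubZ SS)].
  apply: big1 => j _; rewrite mulrA -sgC -mulrA tauZ; last first.
    by apply: (ssubM SS) => //; exact: lincombS.
  have /rowP/(_ j) := vG; rewrite !mxE => h0.
  rewrite -[RHS](mulr0 (coord y 0 j)); congr (_ * _); rewrite -[RHS]h0; rewrite /lincomb mulr_suml tau_sum; last first.
    by move=> i; apply: (ssubM SS) => //; exact: (ssubZ SS).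
  by apply: eq_bigr => i _; rewrite mxE -mulrA tauZ //; exact: (ssubM SS).
have [_ h] := tau_pos (ssub_st SS (lincombS v)).
rewrite -[LHS]stK h ?raddf0 // stK tz //.
by apply: (ssub_st SS); exact: lincombS.
Qed.

(** The basis dual to [d] for the pairing [tau (x * y)]. *)
Let dual j := lincomb (row j (invmx gram)^T).

Let dualS j : S (dual j). Proof. exact: lincombS. Qed.

Let dualE i j : tau (d i * dual j) = (i == j)%:R.
Proof.
have -> : (i == j)%:R = (gram *m invmx gram) i j by rewrite mulmxV // mxE.
rewrite /dual {1}/lincomb mulr_sumr tau_sum; last first.
  by move=> k; apply: (ssubM SS) => //; exact: (ssubZ SS).
rewrite mxE; apply: eq_bigr => k _; rewrite mulrA -sgC -mulrA tauZ; last exact: (ssubM SS).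
by rewrite !mxE mulrC.
Qed.

Let tau_dual x j : S x -> tau (x * dual j) = coord x 0 j.
Proof.
move=> Sx; rewrite -{1}(coordK Sx) {1}/lincomb mulr_suml tau_sum; last first.
  by move=> k; apply: (ssubM SS) => //; exact: (ssubZ SS).
have e k : tau (sg (coord x 0 k) * d k * dual j) = coord x 0 k * (k == j)%:R.
  by rewrite -mulrA tauZ ?dualE //; exact: (ssubM SS).
rewrite (bigD1 j) //= big1 ?addr0 => [|k kj]; rewrite e ?eqxx ?mulr1 //.
by rewrite (negPf kj) mulr0.
Qed.

Let expand_d x : S x -> x = \sum_j sg (tau (x * dual j)) * d j.
Proof. by move=> Sx; rewrite -[LHS]coordK //; apply: eq_bigr => j _; rewrite tau_dual. Qed.

Let tau_nondeg x : S x -> (forall y, S y -> tau (y * x) = 0) -> x = 0.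
Proof. by move=> Sx /(_ (st x) (ssub_st SS Sx)); apply: (tau_pos Sx).2. Qed.

Let tauB a b : S a -> S b -> tau (a - b) = tau a - tau b.
Proof.
move=> Sa Sb; rewrite -mulN1r -(rmorphN1 sg) tauD ?tauZ ?mulN1r //.
exact: (ssubZ SS).
Qed.

Let expand_dual x : S x -> x = \sum_j sg (tau (d j * x)) * dual j.
Proof.
move=> Sx; apply/eqP; rewrite -subr_eq0; apply/eqP.
have SR : S (\sum_j sg (tau (d j * x)) * dual j).
  by apply: (sub_sum SS) => j _; exact: (ssubZ SS).
apply: tau_nondeg => [|y Sy]; first exact: (subB SS).
rewrite mulrBr tauB; try exact: (ssubM SS).
apply/eqP; rewrite subr_eq0; apply/eqP.
rewrite {1}(expand_d Sy) mulr_suml mulr_sumr !tau_sum; last 2 first.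
- by move=> j; apply: (ssubM SS) => //; exact: (ssubZ SS).
- by move=> j; apply: (ssubM SS) => //; exact: (ssubZ SS).
apply: eq_bigr => j _; rewrite -mulrA tauZ; last exact: (ssubM SS).
rewrite [in RHS]mulrA -[y * sg _]sgC -[in RHS]mulrA [in RHS]tauZ; last exact: (ssubM SS).
exact: mulrC.
Qed.

(** The tensor [sum_i d i (x) dual i] does not depend on the basis, so multiplying by
[c] on the left or on the right has the same effect. Its product is 1 because
[tau], as a trace in the basis [d], is [y |-> sum_i tau (y * d i * dual i)]. *)
Lemma basis_casimir : exists b : 'I_n -> T, [/\ forall i, S (b i), \sum_i d i * b i = 1
  & forall c x, S c -> \sum_i (c * d i) * x * b i = \sum_i d i * x * (b i * c)].
Proof.
exists dual; split=> //.
  apply/eqP; rewrite -subr_eq0; apply/eqP.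
  have SR : S (\sum_i d i * dual i) by apply: (sub_sum SS) => i _; exact: (ssubM SS).
  apply: tau_nondeg => [|y Sy]; first exact: (subB SS).
  rewrite mulrBr mulr1 tauB //; last exact: (ssubM SS).
  apply/eqP; rewrite subr_eq0; apply/eqP.
  rewrite mulr_sumr tau_sum; last by move=> i; do 2?apply: (ssubM SS).
  rewrite {2}/tau /sandwich_tr /mxtrace; apply: eq_bigr => i _.
  by rewrite !mxE mulr1 mulrA tau_dual //; exact: (ssubM SS).
move=> c x Sc.
have eL i : c * d i = \sum_j sg (tau (c * d i * dual j)) * d j.
  by apply: expand_d; exact: (ssubM SS).
under eq_bigr => i _ do rewrite eL !mulr_suml.
rewrite exchange_big; apply: eq_bigr => j _ /=.
rewrite [in RHS](expand_dual (ssubM SS (dualS j) Sc)) mulr_sumr; apply: eq_bigr => i _.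
rewrite -!mulrA sgC -!mulrA -sgC; congr (d j * (x * (sg _ * _))).
rewrite tauC //; last by apply: (ssubM SS).
by rewrite mulrA.
Qed.

Lemma basis_trace : exists tau : T -> C,
  [/\ forall x y, S x -> S y -> tau (x + y) = tau x + tau y,
      forall c x, S x -> tau (sg c * x) = c * tau x,
      forall x y, S x -> S y -> tau (x * y) = tau (y * x)
    & forall x, S x -> 0 <= tau (st x * x) /\ (tau (st x * x) = 0 -> x = 0)].
Proof. by exists tau; split=> //; exact: tau_pos. Qed.

(** Let [a = P - u^* u] and [b = Q - u u^*] be the unused parts. If [x = b x0 a] is
nonzero for some [x0] in [S], an eigenprojection [y] of [x^* x] for an eigenvalue
[l > 0] gives the partial isometry [l^(-1/2) x y], which extends [u]. If there is no
such [x0], the trace hypothesis at [a] makes the rank of [y |-> a y a] nonpositive. *)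
Let comparison_step P Q u : S P -> S Q -> sproj st P -> sproj st Q ->
  (forall p, S p -> p * p = p -> sandwich_tr P p <= sandwich_tr Q p) ->
  [/\ S u, Q * u = u, u * P = u & u * st u * u = u] ->
  st u * u = P \/ exists2 w, [/\ S w, Q * w = w, w * P = w & w * st w * w = w]
    & (\rank (sandwich_mx (st u * u) 1) < \rank (sandwich_mx (st w * w) 1))%N.
Proof.
move=> SP SQ [PP Pst] [QQ Qst] trPQ [Su Qu uP uu].
pose e := st u * u; pose f := u * st u; pose a := P - e; pose b := Q - f.
have Se : S e by apply: (ssubM SS) => //; exact: (ssub_st SS).
have Sf : S f by apply: (ssubM SS) => //; exact: (ssub_st SS).
have Sa : S a by exact: (subB SS).
have Sb : S b by exact: (subB SS).
have uu' : st u * u * st u = st u by rewrite -[RHS](congr1 st uu) !stM stK mulrA.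
have ee : e * e = e by rewrite /e mulrA uu'.
have ff : f * f = f by rewrite /f mulrA uu.
have Pu : P * st u = st u by rewrite -[RHS](congr1 st uP) stM Pst.
have uQ : st u * Q = st u by rewrite -[RHS](congr1 st Qu) stM Qst.
have Pe : P * e = e by rewrite /e mulrA Pu.
have eP : e * P = e by rewrite /e -mulrA uP.
have Qf : Q * f = f by rewrite /f mulrA Qu.
have fQ : f * Q = f by rewrite /f -mulrA uQ.
have aa : a * a = a.
  have -> : a * a = P * P - P * e - e * P + e * e by rewrite /a; ncring.
  by rewrite PP Pe eP ee /a; ncring.
have est : st e = e by rewrite stM stK.
have fst : st f = f by rewrite stM stK.
have ast : st a = a by rewrite raddfB Pst est.
have bst : st b = b by rewrite raddfB Qst fst.
have bb : b * b = b.
  have -> : b * b = Q * Q - Q * f - f * Q + f * f by rewrite /b; ncring.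
  by rewrite QQ Qf fQ ff /b; ncring.
have [z|] := pselect (forall x, S x -> b * x * a = 0).
  left; suff a0 : a = 0 by rewrite -/e -[P](subrK e) -/a a0 add0r.
  have := trPQ a Sa aa.
  rewrite -[P](subrK e) -/a -[Q](subrK f) -/b (sandwich_trD Sa Se Sa) (sandwich_trD Sb Sf Sa).
  rewrite [sandwich_tr e a]sandwich_trC //; last exact: (ssub_st SS).
  rewrite -/f lerD2r.
  rewrite {2}/sandwich_tr sandwich_mx0 // mxtrace0.
  rewrite -/(sandwich_tr a a) sandwich_tr_rank // lern0 mxrank_eq0 => /eqP.
  by move/sandwich_mx_eq0 => /(_ Sa Sa 1 S1); rewrite mulr1 aa.
move=> /existsNP[x0 /not_implyP[Sx0 /eqP x00]]; right.
pose x := b * x0 * a.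
have Sx : S x by do ?apply: (ssubM SS).
have bx : b * x = x by rewrite /x !mulrA bb.
have xa : x * a = x by rewrite /x -!mulrA aa.
pose h := st x * x.
have Sh : S h by apply: (ssubM SS) => //; exact: (ssub_st SS).
have hh : st h = h by rewrite stM stK.
have h0 : h != 0 by apply: contra_neq x00 => h0; exact: pS Sx h0.
have ah : a * h = h.
  by rewrite /h mulrA -{1}ast -stM xa.
have [t [F [[ut rt SF] pF oF hF E]]] := spectral_decomposition ax SS fS Sh pS hh.
have [l lt l0] : exists2 l, l \in t & l != 0.
  apply: contrapT => nl; move/negP: h0; apply; apply/eqP.
  rewrite -[h]mulr1 E mulr_sumr big1_seq // => l /= lt.
  have [_ ->] := hF l lt; have [->|l0] := eqVneq l 0; first by rewrite rmorph0 mul0r.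
  by case: nl; exists l.
have [y0 hy] := hF l lt; have [yy yst] := pF l lt; have Sy := SF l.
set y := F l in y0 hy yy yst Sy.
have ay : a * y = y.
  have ye : y = sg l^-1 * (h * y) by rewrite hy mulrA -rmorphM mulVf // rmorph1 mul1r.
  by rewrite {1}ye mulrA -sgC -mulrA (mulrA a) ah -ye.
have ya : y * a = y by rewrite -{1}yst -{1}ast -stM ay yst.
have lpos : 0 < l.
  have sxy : st (x * y) * (x * y) = sg l * y.
    by rewrite stM yst -mulrA (mulrA (st x)) hy mulrA -sgC -mulrA yy.
  have [p1 p2] := tau_pos Sy; rewrite yst yy in p1 p2.
  have ty : 0 < tau y.
    by rewrite lt_neqAle p1 andbT; apply: contra_neq y0 => /esym/p2.
  have [] := tau_pos (ssubM SS Sx Sy); rewrite sxy tauZ // pmulr_lge0 // => le _.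
  by rewrite lt_neqAle eq_sym l0.
pose c := (sqrtC l)^-1.
have cc : c^* * c * l = 1.
  have c0 : 0 <= c by rewrite invr_ge0 sqrtC_ge0 ltW.
  by rewrite (geC0_conj c0) /c -expr2 exprVn sqrtCK mulVf.
pose v := sg c * (x * y).
have Sv : S v by apply: (ssubZ SS); exact: (ssubM SS).
have vv : st v * v = y.
  have -> : st v = sg c^* * (y * st x) by rewrite /v !stM stsg yst -sgC.
  have -> : sg c^* * (y * st x) * v = sg c^* * (y * st x * sg c) * (x * y) by rewrite /v; ncring.
  rewrite -sgC; have -> : sg c^* * (sg c * (y * st x)) * (x * y) = sg c^* * sg c * (y * (h * y)).
    by rewrite /h; ncring.
  by rewrite hy (mulrA y) -(sgC l y) -(mulrA (sg l) y y) yy mulrA -!rmorphM cc rmorph1 mul1r.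
have bv : b * v = v by rewrite /v mulrA -(sgC c b) -mulrA (mulrA b x) bx.
have vy : v * y = v by rewrite /v -(mulrA (sg c)) -(mulrA x y y) yy.
have Qb : Q * b = b by rewrite mulrBr QQ Qf.
have aP : a * P = a by rewrite mulrBl PP eP.
have ub : st u * b = 0 by rewrite mulrBr uQ /f mulrA uu' subrr.
have uv : st u * v = 0 by rewrite -bv mulrA ub mul0r.
have vu : st v * u = 0 by rewrite -[LHS]stK stM stK uv raddf0.
have ae : a * e = 0 by rewrite mulrBl Pe ee subrr.
have ua : u * a = 0 by rewrite mulrBr uP /e mulrA uu subrr.
have sw : st (u + v) * (u + v) = e + y.
  have -> : st (u + v) * (u + v) = st u * u + st u * v + st v * u + st v * v.
    by rewrite raddfD; ncring.
  by rewrite uv vu vv !addr0.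
exists (u + v).
  split; first exact: (ssubD SS).
  - by rewrite mulrDr Qu -bv mulrA Qb.
  - by rewrite mulrDl uP -vy -{1}ya -!mulrA aP ya.
  rewrite -mulrA sw.
  have -> : (u + v) * (e + y) = u * st u * u + v * y + u * y + v * e by rewrite /e; ncring.
  by rewrite uu vy -ay mulrA ua mul0r -vy -ya -!mulrA ae !mulr0 !addr0.
have ey : e * y = 0 by rewrite -ay mulrA mulrBr eP ee subrr mul0r.
have ye : y * e = 0 by rewrite -ya -mulrA ae mulr0.
have eyey : (e + y) * (e + y) = e + y.
  have -> : (e + y) * (e + y) = e * e + e * y + y * e + y * y by ncring.
  by rewrite ey ye ee yy !addr0.
have Sey : S (e + y) by exact: (ssubD SS).
rewrite sw -/e -(ltr_nat C) -!sandwich_tr_rank ?mulr1 //.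
rewrite sandwich_trD // ltrDl sandwich_tr_rank ?mulr1 // ltr0n lt0n mxrank_eq0.
apply: contra_neq y0 => /(sandwich_mx_eq0 Sy S1) /(_ 1 S1).
by rewrite !mulr1.
Qed.

(** Murray-von Neumann comparison. The hypothesis compares the multiplicities of [P]
and [Q] in every summand of [S] at once, since [p] may be any idempotent; a partial
isometry from [P] to [Q] of maximal rank is then defined on all of [P]. *)
Lemma basis_comparison P Q : S P -> S Q -> sproj st P -> sproj st Q ->
  (forall p, S p -> p * p = p -> sandwich_tr P p <= sandwich_tr Q p) ->
  exists u, [/\ S u, st u * u = P & Q * u = u].
Proof.
move=> SP SQ [PP Pst] [QQ Qst] trPQ.
pose good u := [/\ S u, Q * u = u, u * P = u & u * st u * u = u].
pose rk u := \rank (sandwich_mx (st u * u) 1).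
suff main m u : good u -> (n - rk u <= m)%N -> exists u, [/\ S u, st u * u = P & Q * u = u].
  apply: (main n 0); last by rewrite leq_subr.
  by split; rewrite ?mulr0 ?mul0r //; exact: (sub0 SS).
have step v : good v -> st v * v = P \/ exists2 w, good w & (rk v < rk w)%N.
  exact: comparison_step.
elim: m u => [|m IH] u gu hm.
  have [e|[w _ uw]] := step u gu; first by exists u; case: gu.
  by move: (leq_trans uw (rank_leq_row _)); rewrite ltnNge -subn_eq0 -leqn0 hm.
have [e|[w gw uw]] := step u gu; first by exists u; case: gu.
by apply: (IH w gw); rewrite -ltnS (leq_trans _ hm) // ltn_sub2l // (leq_trans uw) // rank_leq_row.
Qed.

End Operators.

(** * Trace, averaging and comparison in finite-dimensional star algebras *)

Section FiniteStarAlgebra.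
Variables (C : numClosedFieldType) (T : pzRingType).
Variables (sg : {rmorphism C -> T}) (st : {additive T -> T}) (S : T -> Prop).
Hypothesis ax : star_axioms sg st.
Hypothesis SS : star_subalg sg st S.
Hypothesis fS : finspan sg S.
Hypothesis pS : proper_star st S.

(** The trace of left multiplication. *)
Lemma faithful_trace : exists tau : T -> C,
  [/\ forall x y, S x -> S y -> tau (x + y) = tau x + tau y,
      forall c x, S x -> tau (sg c * x) = c * tau x,
      forall x y, S x -> S y -> tau (x * y) = tau (y * x)
    & forall x, S x -> 0 <= tau (st x * x) /\ (tau (st x * x) = 0 -> x = 0)].
Proof.
have [n [d [dS dspan dfree]]] := finspan_basis fS.
exact: (basis_trace ax SS dS dspan dfree pS).
Qed.

(** For the regular trace [tau], dual bases [a], [b] of the form [tau (x * y)]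
give a separability idempotent of [S]; it averages onto the commutant of [S]. *)
Lemma separability_idempotent : exists n (a b : 'I_n -> T),
  [/\ forall i, S (a i), forall i, S (b i), \sum_i a i * b i = 1
    & forall c x, S c -> \sum_i (c * a i) * x * b i = \sum_i a i * x * (b i * c)].
Proof.
have [n [d [dS dspan dfree]]] := finspan_basis fS.
have [b [bS ? ?]] := basis_casimir ax SS dS dspan dfree pS.
by exists n, d, b.
Qed.

(** Cancellation of [r]: an [x] from [p + r] to [q + r] that is injective on
[p + r] bounds the ranks of [p] by those of [q]. *)
Lemma finite_comparison p q r x : S p -> S q -> S r -> S x ->
  sproj st p -> sproj st q -> sproj st r -> p * r = 0 -> q * r = 0 ->
  (q + r) * x = x ->
  (forall y, S y -> (p + r) * y = y -> x * y = 0 -> y = 0) ->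
  exists u, [/\ S u, st u * u = p & q * u = u].
Proof.
move=> Sp Sq Sr Sx [pp pst] [qq qst] [rr rst] pr qr Qx inj.
have [n [d [dS dspan dfree]]] := finspan_basis fS.
refine (basis_comparison ax SS dS (dspan := dspan) dfree pS Sp Sq (conj pp pst) (conj qq qst) _) => e Se ee.
have rp : r * p = 0.
  by rewrite -[LHS](star_stK ax) (star_stM ax) pst rst pr raddf0.
have rq : r * q = 0.
  by rewrite -[LHS](star_stK ax) (star_stM ax) qst rst qr raddf0.
have PP : (p + r) * (p + r) = p + r.
  have -> : (p + r) * (p + r) = p * p + p * r + r * p + r * r by ncring.
  by rewrite pp pr rp rr !addr0.
have QQ : (q + r) * (q + r) = q + r.
  have -> : (q + r) * (q + r) = q * q + q * r + r * q + r * r by ncring.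
  by rewrite qq qr rq rr !addr0.
have SP : S (p + r) by exact: (ssubD SS).
have SQ : S (q + r) by exact: (ssubD SS).
have S1 := ssub1 SS.
suff : sandwich_tr dspan (p + r) e <= sandwich_tr dspan (q + r) e.
  by rewrite !(sandwich_trD ax SS dS dspan dfree) // lerD2r.
rewrite !(sandwich_tr_rank ax SS dS dspan dfree) // ler_nat.
set A := sandwich_mx _ (p + r) e; pose B := sandwich_mx dspan x 1.
have AB : A *m B = sandwich_mx dspan (x * (p + r)) 1 *m sandwich_mx dspan (q + r) e.
  rewrite !(sandwich_mxM ax SS dS dspan dfree) ?mulr1 ?mul1r //; last exact: (ssubM SS).
  by rewrite [_ * (x * _)]mulrA Qx.
rewrite -(mxrank_mul_ker A B) [X in (_ + X)%N](_ : _ = 0%N) ?addn0.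
  by rewrite AB mxrankM_maxr.
apply/eqP; rewrite mxrank_eq0; apply/rowV0P => v.
rewrite sub_capmx => /andP[/submxP[w wA] /sub_kermxP vB].
apply: dfree; rewrite -/(lincomb sg d v); apply: inj.
- exact: (lincombS SS dS).
- rewrite wA (sandwich_mxE ax SS dS dspan) // !mulrA PP //.
- by rewrite -[LHS]mulr1 -(sandwich_mxE ax SS dS dspan) // vB /lincomb big1 // => i _;
    rewrite mxE rmorph0 mul0r.
Qed.

End FiniteStarAlgebra.

(** * Norm bounds in a star algebra *)

Local Open Scope complex_scope.

Definition cabs (R : realType) (c : R[i]) : R := complex.Re `|c|.

(** A norm given by its upper bounds. For classes of sequences modulo null sequences
the norm is a limes superior, of which only the upper bounds matter. *)
Record bound_axioms (R : realType) (T : pzRingType) (sg : R[i] -> T) (st : T -> T)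
    (bnd : T -> R -> Prop) : Prop := BoundAxioms {
  bnd_ex : forall x, exists c, bnd x c ;
  bnd_ge0 : forall x c, bnd x c -> 0 <= c ;
  bnd_le : forall x c c', bnd x c -> c <= c' -> bnd x c' ;
  bnd_lim : forall x c, (forall d, 0 < d -> bnd x (c + d)) -> bnd x c ;
  bndD : forall x y a b, bnd x a -> bnd y b -> bnd (x + y) (a + b) ;
  bndM : forall x y a b, bnd x a -> bnd y b -> bnd (x * y) (a * b) ;
  bnd_sg : forall c, bnd (sg c) (cabs c) ;
  bnd_st : forall x c, bnd x c -> bnd (st x) c ;
  bnd_C : forall x c, 0 <= c -> bnd (st x * x) (c ^+ 2) -> bnd x c }.

Section Bounds.
Variables (R : realType) (T : pzRingType).
Variables (sg : {rmorphism R[i] -> T}) (st : {additive T -> T}) (bnd : T -> R -> Prop).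
Hypothesis ax : star_axioms sg st.
Hypothesis bx : bound_axioms sg st bnd.

Lemma bndN x c : bnd x c -> bnd (- x) c.
Proof.
move=> h; rewrite -mulN1r -(rmorphN1 sg) -[c]mul1r.
by apply: (bndM bx) => //; have := bnd_sg bx (-1); rewrite /cabs normrN1.
Qed.

Lemma bnd0 : bnd 0 0.
Proof. by have := bnd_sg bx 0; rewrite rmorph0 /cabs normr0. Qed.

Lemma bnd1 : bnd 1 1.
Proof. by have := bnd_sg bx 1; rewrite rmorph1 /cabs normr1. Qed.

Lemma bnd_sum (I : Type) (r : seq I) (F : I -> T) (c : I -> R) :
  (forall i, bnd (F i) (c i)) -> bnd (\sum_(i <- r) F i) (\sum_(i <- r) c i).
Proof.
by move=> h; elim/big_ind2: _ => //; [exact: bnd0|move=> *; exact: (bndD bx)].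
Qed.

Lemma bnd_exp x c n : bnd x c -> bnd (x ^+ n) (c ^+ n).
Proof.
move=> h; elim: n => [|n IH]; first by rewrite !expr0; exact: bnd1.
by rewrite !exprS; exact: (bndM bx).
Qed.

Let bernoulli (x : R) n : 0 <= x -> 1 + n%:R * x <= (1 + x) ^+ n.
Proof.
move=> x0; elim: n => [|n IH]; first by rewrite mul0r addr0 expr0.
rewrite exprSr; apply: (@le_trans _ _ ((1 + n%:R * x) * (1 + x))).
  by rewrite -natr1; have := @ler0n R n; nra.
by rewrite ler_wpM2r // addr_ge0.
Qed.

Let expr_dominates (M c d : R) : 0 <= c -> 0 < d ->
  exists n, M * c ^+ (2 ^ n) <= (c + d) ^+ (2 ^ n).
Proof.
move=> c0 d0; have [->|cn0] := eqVneq c 0.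
  exists 0%N; rewrite expn0 !expr1 mulr0 add0r ltW //.
have cp : 0 < c by rewrite lt_neqAle eq_sym cn0.
have xp : 0 < d / c by rewrite divr_gt0.
pose n := Num.bound `|M / (d / c)|.
exists n; have -> : c + d = c * (1 + d / c) by field.
rewrite exprMn mulrC ler_wpM2l ?exprn_ge0 //.
apply: le_trans (bernoulli _ (ltW xp)).
have h : M / (d / c) <= (2 ^ n)%:R.
  apply: (le_trans (ler_norm _)); apply: (@le_trans _ _ n%:R).
    by rewrite ltW //; apply: archi_boundP; exact: normr_ge0.
  by rewrite ler_nat ltnW // ltn_expl.
by move: h; rewrite ler_pdivrMr // => h; rewrite (le_trans h) // lerDr.
Qed.

(** For hermitian [x] the C*-identity gives [|x ^ (2 ^ n)| = |x| ^ (2 ^ n)], so that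
a constant factor disappears in the limit. *)
Lemma bnd_powers x M c : st x = x -> 0 <= c ->
  (forall n, bnd (x ^+ (2 ^ n)) (M * c ^+ (2 ^ n))) -> bnd x c.
Proof.
move=> xx c0 h; apply: (bnd_lim bx) => d d0.
have [n hn] := expr_dominates M c0 d0.
have stX m : st (x ^+ m) = x ^+ m.
  by elim: m => [|m IH]; [rewrite expr0 (star_st1 ax)|rewrite {1}exprS (star_stM ax) IH xx -exprSr].
have cd0 : 0 <= c + d by rewrite addr_ge0 // ltW.
have := bnd_le bx (h n) hn; elim: n {hn} => [|n IH]; first by rewrite expn0 !expr1.
rewrite expnS mulnC !exprM => /= h2; apply: IH; apply: (bnd_C bx); first by rewrite exprn_ge0.
by rewrite stX -expr2.
Qed.

(** The powers of [sum_i y i], with [y i = st (x i) * x i], are again orthogonal sums,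
bounded by [#|I|] times the powers of [c ^ 2]; [bnd_powers] removes the factor. *)
Lemma bnd_orthogonal_sum (I : finType) (x : I -> T) c : 0 <= c ->
  (forall i j, i != j -> st (x i) * x j = 0 /\ x i * st (x j) = 0) ->
  (forall i, bnd (x i) c) -> bnd (\sum_i x i) c.
Proof.
move=> c0 ox hx; apply: (bnd_C bx) => //.
pose y i := st (x i) * x i.
have yE : st (\sum_i x i) * (\sum_i x i) = \sum_i y i.
  rewrite raddf_sum mulr_suml; apply: eq_bigr => i _; rewrite mulr_sumr (bigD1 i) //=.
  by rewrite big1 ?addr0 // => j ji; rewrite (ox i j _).1 // eq_sym.
have yy i : st (y i) = y i by rewrite (star_stM ax) (star_stK ax).
have oy i j : i != j -> y i * y j = 0.
  by move=> ij; rewrite /y -mulrA (mulrA (x i)) (ox i j ij).2 mul0r mulr0.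
rewrite yE.
have yX n : (\sum_i y i) ^+ n.+1 = \sum_i y i ^+ n.+1.
  elim: n => [|n IH]; first by rewrite !expr1; apply: eq_bigr => i _; rewrite expr1.
  rewrite exprS IH mulr_suml; apply: eq_bigr => i _.
  rewrite mulr_sumr (bigD1 i) //= -exprS big1 ?addr0 // => j ji.
  by rewrite exprS mulrA oy ?mul0r // eq_sym.
apply: (bnd_powers (M := #|I|%:R)).
- by rewrite raddf_sum; apply: eq_bigr.
- by rewrite exprn_ge0.
move=> n; have: (0 < 2 ^ n)%N by rewrite expn_gt0.
case: (2 ^ n)%N => // m _; rewrite yX.
rewrite -[#|I|%:R * _]/(_) mulr_natl -sumr_const; apply: bnd_sum => i.
by apply: bnd_exp; rewrite expr2; apply: (bndM bx) => //; exact: (bnd_st bx).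
Qed.

Lemma bnd_sproj p : sproj st p -> bnd p 1.
Proof.
move=> [pp ps]; have [M hM] := bnd_ex bx p.
have pX n : p ^+ n.+1 = p by elim: n => [|n IH]; rewrite ?expr1 // exprS IH.
apply: (bnd_powers (M := M)) => // n; rewrite expr1n mulr1.
have: (0 < 2 ^ n)%N by rewrite expn_gt0.
by case: (2 ^ n)%N => // m _; rewrite pX.
Qed.

End Bounds.

(** * C*-algebras as star algebras *)

Section CStarInstance.
Variables (R : realType) (A : cstarAlgType R).
Local Notation C := R[i].

Definition scal (c : C) : A := c *: (1 : A).

Lemma scalE c (x : A) : c *: x = scal c * x.
Proof. by rewrite /scal -scaleAl mul1r. Qed.

Lemma scal_comm c (x : A) : scal c * x = x * scal c.
Proof. by rewrite /scal -scaleAl mul1r -scaleAr mulr1. Qed.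

Lemma scal_zmod_morphism : zmod_morphism scal.
Proof. by move=> a b; rewrite /scal scalerBl. Qed.

Lemma scal_monoid_morphism : monoid_morphism scal.
Proof. by split=> [|a b]; rewrite /scal ?scale1r // -scaleAl mul1r scalerA. Qed.

HB.instance Definition _ := GRing.isZmodMorphism.Build C A scal scal_zmod_morphism.
HB.instance Definition _ := GRing.isMonoidMorphism.Build C A scal scal_monoid_morphism.

Lemma star_zmod_morphism : zmod_morphism (@star R A).
Proof.
by move=> x y; rewrite -[in RHS](subrK y x) [in RHS]starD addrK.
Qed.
HB.instance Definition _ := GRing.isZmodMorphism.Build A A (@star R A) star_zmod_morphism.

Lemma cstar_axioms : star_axioms scal (@star R A).
Proof.
split; [exact: scal_comm|exact: starM|exact: starK|].
by move=> c; rewrite /scal starZ star1.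
Qed.

(** Norms take their values in [R[i]], where they are real. *)
Definition nrm (x : A) : R := complex.Re `|x|.

Lemma normE (x : A) : `|x| = (nrm x)%:C.
Proof. by rewrite /nrm RRe_real // normr_real. Qed.

Lemma cnormE (c : C) : `|c| = (cabs c)%:C.
Proof. by rewrite /cabs RRe_real // normr_real. Qed.

Lemma ler_C (a b : R) : (a%:C <= b%:C) = (a <= b).
Proof. by rewrite lecR. Qed.

Lemma nrm_ge0 x : 0 <= nrm x.
Proof. by rewrite -ler_C -normE normr_ge0. Qed.

Lemma nrm0 : nrm 0 = 0.
Proof. by rewrite /nrm normr0. Qed.

Lemma nrm_eq0 x : nrm x = 0 -> x = 0.
Proof. by move=> h; apply/eqP; rewrite -normr_eq0 normE h. Qed.

Lemma nrmD x y : nrm (x + y) <= nrm x + nrm y.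
Proof. by have := ler_normD x y; rewrite !normE -rmorphD ler_C. Qed.

Lemma nrmN x : nrm (- x) = nrm x.
Proof. by rewrite /nrm normrN. Qed.

Lemma nrmB x y : nrm (x - y) <= nrm x + nrm y.
Proof. by rewrite -(nrmN y) nrmD. Qed.

Lemma nrmM x y : nrm (x * y) <= nrm x * nrm y.
Proof. by have := normM x y; rewrite !normE -rmorphM ler_C. Qed.

Lemma nrmZ c x : nrm (c *: x) = cabs c * nrm x.
Proof. by have := normrZ c x; rewrite !normE cnormE -rmorphM => /complexI. Qed.

Lemma nrm_starM x : nrm (star x * x) = nrm x ^+ 2.
Proof. by have := norm_star x; rewrite !normE -rmorphXn => /complexI. Qed.

Lemma nrm_star x : nrm (star x) = nrm x.
Proof.
suff le y : nrm y <= nrm (star y) by apply/eqP; rewrite eq_le le -{2}(starK x) le.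
have [y0|y0] := eqVneq (nrm y) 0; first by rewrite y0 nrm_ge0.
rewrite -(ler_pM2r (x := nrm y)) ?lt_neqAle 1?eq_sym ?y0 ?nrm_ge0 //.
by rewrite -expr2 -nrm_starM nrmM.
Qed.

Lemma nrm1_le : nrm 1 <= 1.
Proof.
have := nrm_starM 1; rewrite star1 mulr1.
by have := nrm_ge0 1; nra.
Qed.

Lemma cabs_ge0 (c : C) : 0 <= cabs c.
Proof. by rewrite -ler_C -cnormE normr_ge0. Qed.

Lemma nrm_scal c : nrm (scal c) <= cabs c.
Proof. by rewrite nrmZ -[leRHS]mulr1 ler_wpM2l ?cabs_ge0 // nrm1_le. Qed.

Lemma nrm_sum (I : Type) (r : seq I) (P : pred I) (F : I -> A) :
  nrm (\sum_(i <- r | P i) F i) <= \sum_(i <- r | P i) nrm (F i).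
Proof.
elim/big_ind2: _ => //; first by rewrite nrm0.
by move=> x a y b xa yb; rewrite (le_trans (nrmD _ _)) // lerD.
Qed.

Lemma nrm_bound_axioms : bound_axioms scal (@star R A) (fun x c => nrm x <= c).
Proof.
split.
- by move=> x; exists (nrm x).
- by move=> x c; apply: le_trans; exact: nrm_ge0.
- by move=> x c c'; exact: le_trans.
- by move=> x c h; apply/ler_addgt0Pr.
- by move=> x y a b xa yb; rewrite (le_trans (nrmD _ _)) // lerD.
- by move=> x y a b xa yb; rewrite (le_trans (nrmM _ _)) // ler_pM // nrm_ge0.
- exact: nrm_scal.
- by move=> x c; rewrite nrm_star.
- by move=> x c c0; rewrite nrm_starM ler_sqr ?nnegrE // nrm_ge0.
Qed.

Lemma nrm_proper (S : A -> Prop) : proper_star (@star R A) S.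
Proof.
move=> x _ h; apply: nrm_eq0; apply/eqP; rewrite -sqrf_eq0 -nrm_starM h.
by rewrite nrm0.
Qed.

End CStarInstance.

(** * Norms in finite-dimensional subalgebras *)

Section FiniteSubalgebras.
Variables (R : realType) (A : cstarAlgType R).
Local Notation C := R[i].
Local Notation scal := (@scal R A).
Local Notation star := (@star R A).
Let ax := cstar_axioms A.

Section Norms.
Variable S : A -> Prop.
Hypothesis SS : star_subalg scal star S.
Hypothesis fS : finspan scal S.

(** [h] is an orthogonal sum of multiples of projections. *)
Lemma nrm_le_eigenvalues h c : S h -> star h = h -> 0 <= c ->
  (forall l p, l^* = l -> S p -> sproj star p -> p != 0 -> h * p = scal l * p ->
     cabs l <= c) ->
  nrm h <= c.
Proof.
move=> Sh hh c0 eig.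
have [t [F [[ut rt SF] pF oF hF E]]] :=
  spectral_decomposition ax SS fS Sh (@nrm_proper _ _ S) hh.
have -> : h = \sum_(i < size t) scal (tnth (in_tuple t) i) * F (tnth (in_tuple t) i).
  rewrite -[LHS]mulr1 E mulr_sumr big_tnth; apply: eq_bigr => i _.
  by case: (hF _ (mem_tnth i (in_tuple t))).
have mt i : tnth (in_tuple t) i \in t by exact: mem_tnth.
apply: (bnd_orthogonal_sum ax (nrm_bound_axioms A)) => // [i j ij|i].
  have tij : tnth (in_tuple t) i != tnth (in_tuple t) j.
    by apply: contra_neq ij; exact: (elimT (tuple_uniqP (in_tuple t)) ut).
  have z : F (tnth (in_tuple t) i) * F (tnth (in_tuple t) j) = 0 by exact: oF.
  have sF k : star (F (tnth (in_tuple t) k)) = F (tnth (in_tuple t) k) by case: (pF _ (mt k)).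
  have key (a b : C) (x y : A) : x * y = 0 -> (scal a * x) * (scal b * y) = 0.
    by move=> xy; rewrite -mulrA (mulrA x) -(scal_comm b x) -(mulrA (scal b)) xy !mulr0.
  have sx (l : C) k : star (scal l * F (tnth (in_tuple t) k)) = scal l^* * F (tnth (in_tuple t) k).
    by rewrite starM sF (star_sg ax) scal_comm.
  by rewrite /= !sx; split; exact: key.
have [F0 hFi] := hF _ (mt i); have bF := bnd_sproj ax (nrm_bound_axioms A) (pF _ (mt i)).
rewrite -[c]mulr1 (le_trans (nrmM _ _)) // ler_pM ?nrm_ge0 //.
rewrite (le_trans (nrm_scal _ _)) //; apply: (eig _ (F (tnth (in_tuple t) i))) => //.
- exact: rt.
- exact: pF.
Qed.

(** Let [a i^* a i] have the eigenvalue [l] on the projection [p]. Compressing the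
equation to [p] and applying a faithful trace [tau] gives [l tau(p) <= c^2 tau(p)]. *)
Lemma nrm_le_sum_squares (I : finType) (a : I -> A) (c : R) : 0 <= c ->
  (forall i, S (a i)) -> \sum_i star (a i) * a i = scal (c ^+ 2)%:C ->
  forall i, nrm (a i) <= c.
Proof.
move=> c0 Sa sa i.
have Ssq x : S x -> S (star x * x) by move=> Sx; apply: (ssubM SS) => //; exact: (ssub_st SS).
have [tau [tD tZ tC tP0]] := faithful_trace ax SS fS (@nrm_proper _ _ S).
have tP x : S x -> 0 <= tau (star x * x) /\ (tau (star x * x) = 0 -> x = 0) by exact: tP0.
rewrite -(@ler_sqr R) ?nnegrE ?nrm_ge0 // -nrm_starM.
apply: nrm_le_eigenvalues; rewrite ?exprn_ge0 ?starM ?starK //; first exact: Ssq.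
move=> l p _ Sp [pp ps] p0 hp.
have sq j : star (a j * p) * (a j * p) = p * (star (a j) * a j) * p.
  by rewrite starM ps !mulrA.
have tpos : 0 < tau p.
  have [t0 t1] := tP p Sp; rewrite ps pp in t0 t1.
  by rewrite lt_neqAle t0 andbT; apply: contra_neq p0 => /esym/t1.
have Sap j : S (a j * p) by exact: (ssubM SS).
have sumE : tau (scal (c ^+ 2)%:C * p) = \sum_j tau (star (a j * p) * (a j * p)).
  have -> : scal (c ^+ 2)%:C * p = \sum_j star (a j * p) * (a j * p).
    under eq_bigr => j _ do rewrite sq.
    by rewrite -mulr_suml -mulr_sumr sa -scal_comm -mulrA pp.
  have t0 : tau 0 = 0 by rewrite -[0 in LHS](mul0r p) -(rmorph0 scal) tZ // mul0r.
  elim: (index_enum _) => [|j r IH]; first by rewrite !big_nil.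
  rewrite !big_cons tD ?IH //; first exact: Ssq.
  by apply: (sub_sum SS) => k _; exact: Ssq.
have lE : tau (star (a i * p) * (a i * p)) = l * tau p.
  by rewrite sq -mulrA hp mulrA -scal_comm -mulrA pp tZ.
have l0 : 0 <= l by have [+ _] := tP _ (Sap i); rewrite lE pmulr_lge0.
have lc : l <= (c ^+ 2)%:C.
  rewrite -(ler_pM2r tpos) -lE -tZ // sumE (bigD1 i) //= lerDl.
  by apply: sumr_ge0 => j _; have [] := tP _ (Sap j).
by rewrite -ler_C -cnormE ger0_norm.
Qed.

End Norms.

(** The subalgebras that exhaust an AF algebra need not contain its unit. *)
Definition unitization (B : csubalg A) : A -> Prop :=
  fun x => exists2 b, csub_set B b & exists c, x = b + scal c.

Lemma unitization_sub B : csub_set B `<=` unitization B.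
Proof. by move=> b Bb; exists b => //; exists 0; rewrite rmorph0 addr0. Qed.

Lemma unitization_subalg B : star_subalg scal star (unitization B).
Proof.
split.
- by exists 0; [exact: csub0|exists 1; rewrite rmorph1 add0r].
- move=> x y [b Bb [c ->]] [b' Bb' [c' ->]]; exists (b + b'); first exact: csubD.
  by exists (c + c'); rewrite rmorphD addrACA.
- move=> k x [b Bb [c ->]]; exists (k *: b); first exact: csubZ.
  by exists (k * c); rewrite mulrDr rmorphM scalE.
- move=> x y [b Bb [c ->]] [b' Bb' [c' ->]].
  exists (b * b' + c' *: b + c *: b').
    by do 2?[apply: csubD]; [exact: csubM|exact: csubZ|exact: csubZ].
  by exists (c * c'); rewrite rmorphM !scalE (scal_comm c' b); ncring.
- move=> x [b Bb [c ->]]; exists (star b); first exact: csub_star.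
  by exists c^*; rewrite starD (star_sg ax).
Qed.

Lemma unitization_finspan B : fin_dim B -> finspan scal (unitization B).
Proof.
case=> n [b [Bb span]]; exists 'I_n.+1, (fun o => oapp b 1 (unlift ord0 o)).
split=> [i|x [y /span[k ->] [c ->]]].
  case: unliftP => [j _|_] /=; first exact: unitization_sub.
  exact: (ssub1 (unitization_subalg B)).
exists (fun o => oapp k c (unlift ord0 o)).
rewrite big_ord_recl unlift_none /= mulr1 addrC; congr (_ + _).
by apply: eq_bigr => i _; rewrite liftK /= scalE.
Qed.

End FiniteSubalgebras.

(** * Matrices over a C*-algebra *)

Section MatrixAlgebra.
Variables (R : realType) (A : cstarAlgType R) (K : nat).
Local Notation C := R[i].
Local Notation scal := (@scal R A).
Local Notation star := (@star R A).
Let ax := cstar_axioms A.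

Definition scalmx (c : C) : 'M[A]_K := (scal c)%:M.

Lemma scalmx_zmod_morphism : zmod_morphism scalmx.
Proof. by move=> a b; rewrite /scalmx !raddfB. Qed.

Lemma scalmx_monoid_morphism : monoid_morphism scalmx.
Proof.
split=> [|a b]; first by rewrite /scalmx rmorph1.
by rewrite /scalmx rmorphM scalar_mxM.
Qed.

HB.instance Definition _ := GRing.isZmodMorphism.Build C 'M[A]_K scalmx scalmx_zmod_morphism.
HB.instance Definition _ := GRing.isMonoidMorphism.Build C 'M[A]_K scalmx scalmx_monoid_morphism.

Definition adj (M : 'M[A]_K) : 'M[A]_K := adjmx M.

Lemma adj_zmod_morphism : zmod_morphism adj.
Proof. by move=> a b; apply/matrixP => i j; rewrite !mxE raddfB. Qed.
HB.instance Definition _ := GRing.isZmodMorphism.Build 'M[A]_K 'M[A]_K adj adj_zmod_morphism.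

Lemma mxmulE (M N : 'M[A]_K) i j : (M * N) i j = \sum_k M i k * N k j.
Proof. by rewrite -mulmxE mxE. Qed.

Lemma scalmxE c (M : 'M[A]_K) i j : (scalmx c * M) i j = scal c * M i j.
Proof. by rewrite -mulmxE mul_scalar_mx mxE. Qed.

Lemma adj_axioms : star_axioms scalmx adj.
Proof.
split.
- move=> c x; apply/matrixP => i j; rewrite scalmxE scal_comm mxmulE (bigD1 j) //= big1.
    by rewrite addr0 mxE eqxx.
  by move=> k kj; rewrite mxE (negPf kj) mulr0n mulr0.
- exact: adjmxM.
- exact: adjmxK.
- move=> c; apply/matrixP => i j; rewrite !mxE eq_sym.
  by case: eqP => _; rewrite ?mulr1n ?mulr0n ?raddf0 // (star_sg ax).
Qed.

(** This is not a C*-norm, but it is submultiplicative and invariant under the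
adjoint, and it describes entrywise convergence. *)
Definition mxnrm (M : 'M[A]_K) : R := \sum_i \sum_j nrm (M i j).

Lemma nrm_le_mxnrm (M : 'M[A]_K) i j : nrm (M i j) <= mxnrm M.
Proof.
rewrite /mxnrm (bigD1 i) //= (bigD1 j) //= -addrA lerDl addr_ge0 // sumr_ge0 // => k _.
  exact: nrm_ge0.
by apply: sumr_ge0 => l _; exact: nrm_ge0.
Qed.

Lemma mxnrm_ge0 M : 0 <= mxnrm M.
Proof. by apply: sumr_ge0 => i _; apply: sumr_ge0 => j _; exact: nrm_ge0. Qed.

Lemma mxnrmD M N : mxnrm (M + N) <= mxnrm M + mxnrm N.
Proof.
rewrite -big_split; apply: ler_sum => i _; rewrite -big_split; apply: ler_sum => j _.
by rewrite mxE nrmD.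
Qed.

Lemma mxnrmN M : mxnrm (- M) = mxnrm M.
Proof. by apply: eq_bigr => i _; apply: eq_bigr => j _; rewrite mxE nrmN. Qed.

Lemma mxnrmM M N : mxnrm (M * N) <= mxnrm M * mxnrm N.
Proof.
rewrite /mxnrm mulr_suml; apply: ler_sum => i _.
apply: (@le_trans _ _ (\sum_j \sum_k nrm (M i k) * nrm (N k j))).
  apply: ler_sum => j _; rewrite mxmulE (le_trans (nrm_sum _ _ _)) //.
  by apply: ler_sum => k _; exact: nrmM.
rewrite exchange_big /= mulr_suml; apply: ler_sum => k _.
rewrite -mulr_sumr ler_wpM2l ?nrm_ge0 //.
rewrite [leRHS](bigD1 k) //= lerDl sumr_ge0 // => l _.
by apply: sumr_ge0 => j _; exact: nrm_ge0.
Qed.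

Lemma mxnrm_adj M : mxnrm (adj M) = mxnrm M.
Proof.
rewrite /mxnrm exchange_big; apply: eq_bigr => j _; apply: eq_bigr => i _.
by rewrite !mxE nrm_star.
Qed.

Lemma mxnrm_eq0 M : mxnrm M = 0 -> M = 0.
Proof.
move=> h; apply/matrixP => i j; rewrite mxE; apply: nrm_eq0; apply/eqP.
by rewrite eq_le nrm_ge0 andbT -h nrm_le_mxnrm.
Qed.

Lemma mxnrm_le (M : 'M[A]_K) c : (forall i j, nrm (M i j) <= c) -> mxnrm M <= c * (K * K)%:R.
Proof.
move=> h; apply: (@le_trans _ _ (\sum_(i < K) \sum_(j < K) c)).
  by apply: ler_sum => i _; apply: ler_sum.
by rewrite !sumr_const !card_ord -mulrnA mulr_natr.
Qed.

Section Entries.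
Variable D : A -> Prop.
Hypothesis SD : star_subalg scal star D.
Hypothesis fD : finspan scal D.

Definition mx_over : 'M[A]_K -> Prop := fun M => forall i j, D (M i j).

Lemma mx_over_subalg : star_subalg scalmx adj mx_over.
Proof.
split.
- move=> i j; rewrite mxE; case: eqP => _; rewrite ?mulr1n ?mulr0n.
    exact: (ssub1 SD).
  exact: (sub0 SD).
- by move=> x y hx hy i j; rewrite mxE; exact: (ssubD SD).
- by move=> c x hx i j; rewrite scalmxE; exact: (ssubZ SD).
- by move=> x y hx hy i j; rewrite mxmulE; apply: (sub_sum SD) => k _; exact: (ssubM SD).
- by move=> x hx i j; rewrite !mxE; exact: (ssub_st SD).
Qed.

Lemma mx_over_finspan : finspan scalmx mx_over.
Proof.
case: fD => I [d [dD span]].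
exists ('I_K * 'I_K * I)%type, (fun t => \matrix_(i, j) (if (i, j) == t.1 then d t.2 else 0)).
split=> [t i j|M hM].
  by rewrite mxE; case: eqP => _ //; exact: (sub0 SD).
have /choice[c cE] : forall t : 'I_K * 'I_K, exists c : I -> C, M t.1 t.2 = \sum_i scal (c i) * d i.
  by move=> t; exact/span/hM.
exists (fun t => c t.1 t.2); apply/matrixP => i j; rewrite summxE.
under eq_bigr => t _ do rewrite scalmxE mxE.
rewrite -(pair_bigA _ (fun s k => scal (c s k) * (if (i, j) == s then d k else 0))) /=.
rewrite (bigD1 (i, j)) //= [X in _ + X]big1 ?addr0 => [|s sij].
  by have /= -> := cE (i, j); apply: eq_bigr => k _; rewrite eqxx.
by apply: big1 => k _; rewrite eq_sym (negPf sij) mulr0.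
Qed.

(** A diagonal entry of [M^* M] is a sum of elements [x^* x], and a faithful trace
separates them from 0. *)
Lemma mx_over_proper : proper_star adj mx_over.
Proof.
have [tau [tD tZ _ tP0]] := faithful_trace ax SD fD (@nrm_proper _ _ D).
have tP x : D x -> 0 <= tau (star x * x) /\ (tau (star x * x) = 0 -> x = 0) by exact: tP0.
have t0 : tau 0 = 0 by rewrite -[0 in LHS](mul0r 1) -(rmorph0 scal) tZ ?mul0r //; exact: (ssub1 SD).
have Dsq x : D x -> D (star x * x) by move=> Sx; apply: (ssubM SD) => //; exact: (ssub_st SD).
move=> M hM MM; apply/matrixP => i j; rewrite [RHS]mxE; apply: (tP _ (hM i j)).2.
have : \sum_k tau (star (M k j) * M k j) = 0.
  have tS (r : seq 'I_K) : tau (\sum_(k <- r) star (M k j) * M k j) = \sum_(k <- r) tau (star (M k j) * M k j).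
    elim: r => [|k r IH]; first by rewrite !big_nil.
    by rewrite !big_cons tD ?IH //; [exact: Dsq|apply: (sub_sum SD) => l _; exact: Dsq].
  rewrite -tS -[RHS]t0; congr tau; have /matrixP/(_ j j) := MM; rewrite mxmulE [RHS]mxE => h.
  by apply: etrans h; apply: eq_bigr => k _; rewrite !mxE.
move/eqP; rewrite psumr_eq0 => [/allP/(_ i (mem_index_enum _))/eqP|] //.
by move=> k _; exact: (tP _ (hM k j)).1.
Qed.

Lemma mxnrm_le_sum_squares (M N : 'M[A]_K) (c : R) : 0 <= c -> mx_over M -> mx_over N ->
  adj M * M + adj N * N = scalmx (c ^+ 2)%:C -> mxnrm M <= c * (K * K)%:R.
Proof.
move=> c0 hM hN h; apply: mxnrm_le => i j.
pose a (s : 'I_K + 'I_K) := match s with inl k => M k j | inr k => N k j end.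
apply: (@nrm_le_sum_squares _ _ D SD fD _ a _ c0 _ _ (inl i)); first by case=> k /=.
rewrite big_sumType /=; have /matrixP/(_ j j) := h.
rewrite !(mxE, mxmulE) eqxx mulr1n => <-.
by congr (_ + _); apply: eq_bigr => k _; rewrite !mxE.
Qed.

End Entries.
End MatrixAlgebra.

(** * Finite-dimensional approximation inside a commutant *)

Section Approximation.
Variables (R : realType) (A : cstarAlgType R).
Local Notation C := R[i].
Local Notation scal := (@scal R A).
Local Notation star := (@star R A).
Let ax := cstar_axioms A.

(** [E x = sum_i a i * x * b i] for a separability idempotent of the unitization of
[B]. It is linear and bounded, maps onto the commutant, and stays inside every
subalgebra that contains [B]. *)
Lemma commutant_average (B : csubalg A) : fin_dim B ->
  exists (E : A -> A) (c : R),
  [/\ forall x y, E (x + y) = E x + E y, forall a x, E (scal a * x) = scal a * E x,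
      forall x, nrm (E x) <= c * nrm x,
      forall x, commutant_set B (E x) /\ (commutant_set B x -> E x = x)
    & forall S : A -> Prop, star_subalg scal star S -> csub_set B `<=` S ->
      forall x, S x -> S (E x)].
Proof.
move=> fB.
have [n [a [b [aB bB ab cas]]]] :=
  separability_idempotent ax (unitization_subalg B) (unitization_finspan fB) (@nrm_proper _ _ _).
exists (fun x => \sum_i a i * x * b i), (\sum_i nrm (a i) * nrm (b i)); split.
- by move=> x y; rewrite -big_split; apply: eq_bigr => i _; rewrite mulrDr mulrDl.
- move=> c x; rewrite mulr_sumr; apply: eq_bigr => i _.
  by rewrite !mulrA scal_comm.
- move=> x; rewrite (le_trans (nrm_sum _ _ _)) // mulr_suml; apply: ler_sum => i _.
  rewrite (le_trans (nrmM _ _)) // mulrAC ler_wpM2r ?nrm_ge0 //.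
  by rewrite (le_trans (nrmM _ _)).
- move=> x; split=> [y /unitization_sub By|cx].
    rewrite mulr_sumr mulr_suml.
    transitivity (\sum_i a i * x * (b i * y)).
      by apply: eq_bigr => i _; rewrite !mulrA.
    by rewrite -cas //; apply: eq_bigr => i _; rewrite !mulrA.
  rewrite -[RHS]mulr1 -ab mulr_sumr; apply: eq_bigr => i _; rewrite mulrA; congr (_ * _).
  have [y By [c ->]] := aB i.
  by rewrite mulrDl mulrDr cx // scal_comm.
- move=> S SS BS x Sx; apply: (sub_sum SS) => i _.
  have US y : unitization B y -> S y.
    by case=> z /BS Sz [c ->]; apply: (ssubD SS) => //; exact: (sub_sg SS).
  by do 2?apply: (ssubM SS) => //; exact: US.
Qed.

Variable Bs : nat -> csubalg A.
Hypothesis fBs : forall n, fin_dim (Bs n).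
Hypothesis incBs : forall n, Bs n `<=` Bs n.+1.
Hypothesis denseBs : dense (\bigcup_n Bs n).

Lemma le_subalgebras m n : (m <= n)%N -> Bs m `<=` Bs n.
Proof.
move=> mn; rewrite -(subnKC mn); elim: (n - m)%N => [|k IH]; first by rewrite addn0.
by rewrite addnS; apply: subset_trans IH _; exact: incBs.
Qed.

Lemma dense_approx (x : A) (e : R) : 0 < e -> exists n y, csub_set (Bs n) y /\ nrm (x - y) < e.
Proof.
move=> e0; have e0C : 0 < e%:C by rewrite ltcR.
have [|y [xy [n _ By]]] := denseBs (O := ball x e%:C) _ (ball_open x _).
  by exists x; exact: ballxx.
exists n, y; split=> //.
by move: xy; rewrite -ball_normE /= normE ltcR.
Qed.

Lemma dense_approx_fin (J : finType) (x : J -> A) (e : R) : 0 < e ->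
  exists n (y : J -> A), forall j, csub_set (Bs n) (y j) /\ nrm (x j - y j) < e.
Proof.
move=> e0; have /choice[n nP] := fun j => dense_approx (x j) e0.
have /choice[y yP] := nP.
exists (\max_j n j), y => j; have [By xy] := yP j; split=> //.
by apply: le_subalgebras By; exact: leq_bigmax.
Qed.

(** The commutant of [Bs n0] is again locally finite-dimensional: averaging over
[Bs n0] maps each unitization of [Bs N], [N >= n0], into itself. *)
Lemma commutant_approx n0 (J : finType) (x : J -> A) (e : R) : 0 < e ->
  (forall j, commutant_set (Bs n0) (x j)) ->
  exists (D : A -> Prop) (y : J -> A),
  [/\ star_subalg scal star D, finspan scal D, D `<=` commutant_set (Bs n0),
      forall j, D (y j) & forall j, nrm (x j - y j) <= e].
Proof.
move=> e0 xc.
have [E [c [ED EZ En Ec ES]]] := commutant_average (fBs n0).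
have c0 : 0 < `|c| + 1 by rewrite ltr_wpDl.
have [n [y yP]] := dense_approx_fin x (divr_gt0 e0 c0).
pose N := maxn n0 n.
have SU := unitization_subalg (Bs N).
have BU : csub_set (Bs n0) `<=` unitization (Bs N).
  by apply: subset_trans (@unitization_sub _ _ _); apply: le_subalgebras; exact: leq_maxl.
pose D : A -> Prop := fun x => unitization (Bs N) x /\ commutant_set (Bs n0) x.
have yU j : unitization (Bs N) (y j).
  apply: unitization_sub; apply: (le_subalgebras (leq_maxr n0 n)).
  by case: (yP j).
exists D, (fun j => E (y j)); split.
- split.
  + by split; [exact: (ssub1 SU)|exact: commutant1].
  + by move=> u v [u1 u2] [v1 v2]; split; [exact: (ssubD SU)|exact: commutantD].
  + by move=> k u [u1 u2]; split; [exact: (ssubZ SU)|rewrite -scalE; exact: commutantZ].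
  + by move=> u v [u1 u2] [v1 v2]; split; [exact: (ssubM SU)|exact: commutantM].
  + by move=> u [u1 u2]; split; [exact: (ssub_st SU)|exact: commutant_star].
- have [I [d [dU span]]] := unitization_finspan (fBs N).
  exists I, (fun i => E (d i)); split=> [i|u [/span[k ku] /(Ec u).2 Eu]].
    by split; [exact: (ES _ SU BU)|exact: (Ec _).1].
  exists k; rewrite -Eu ku.
  have E0 : E 0 = 0 by have := EZ 0 0; rewrite rmorph0 !mul0r.
  elim: (index_enum _) => [|i r IH]; first by rewrite !big_nil.
  by rewrite !big_cons ED EZ IH.
- by move=> u [].
- by move=> j; split; [exact: (ES _ SU BU)|exact: (Ec _).1].
- move=> j; rewrite -((Ec (x j)).2 (xc j)).
  have EB u v : E (u - v) = E u - E v.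
    by rewrite -[in RHS](subrK v u) [in RHS]ED addrK.
  rewrite -EB (le_trans (En _)) // (le_trans (y := (`|c| + 1) * nrm (x j - y j))) //.
    by rewrite ler_wpM2r ?nrm_ge0 // (le_trans (ler_norm _)) // lerDl.
  by have [_ /ltW] := yP j; rewrite ler_pdivlMr // mulrC.
Qed.

End Approximation.

Section MatrixLimits.
Variables (R : realType) (A : cstarAlgType R) (K : nat).
Implicit Types (X Y : nat -> 'M[A]_K) (x y : 'M[A]_K).

Definition mxlim X x := forall e : R, 0 < e -> exists N, forall n, (N <= n)%N -> mxnrm (X n - x) <= e.

Lemma mxlim_cst x : mxlim (fun=> x) x.
Proof.
move=> e e0; exists 0%N => n _; rewrite subrr (le_trans _ (ltW e0)) //.
by rewrite /mxnrm big1 // => i _; rewrite big1 // => j _; rewrite mxE nrm0.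
Qed.

Lemma mxlimD X Y x y : mxlim X x -> mxlim Y y -> mxlim (fun n => X n + Y n) (x + y).
Proof.
move=> hX hY e e0; have e2 : 0 < e / 2 by rewrite divr_gt0.
have [N hN] := hX _ e2; have [M hM] := hY _ e2; exists (maxn N M) => n.
rewrite geq_max => /andP[/hN h1 /hM h2]; rewrite opprD addrACA (splitr e).
by rewrite (le_trans (mxnrmD _ _)) // lerD.
Qed.

Lemma mxlimN X x : mxlim X x -> mxlim (fun n => - X n) (- x).
Proof. by move=> hX e /hX[N hN]; exists N => n /hN; rewrite -opprD mxnrmN. Qed.

Lemma mxlimB X Y x y : mxlim X x -> mxlim Y y -> mxlim (fun n => X n - Y n) (x - y).
Proof. by move=> hX hY; apply: mxlimD => //; exact: mxlimN. Qed.

Lemma mxlim_adj X x : mxlim X x -> mxlim (fun n => adj (X n)) (adj x).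
Proof. by move=> hX e /hX[N hN]; exists N => n /hN; rewrite -raddfB mxnrm_adj. Qed.

Lemma mxlim_bounded0 X Y c : mxlim X 0 -> (forall n, mxnrm (Y n) <= c) ->
  mxlim (fun n => X n * Y n) 0.
Proof.
move=> hX hY e e0; have c0 : 0 < `|c| + 1 by rewrite ltr_wpDl.
have [N hN] := hX _ (divr_gt0 e0 c0); exists N => n /hN; rewrite !subr0 => h.
rewrite (le_trans (mxnrmM _ _)) // (le_trans (y := e / (`|c| + 1) * (`|c| + 1))) //.
  rewrite ler_pM ?mxnrm_ge0 // (le_trans (hY n)) // (le_trans (ler_norm _)) // lerDl //.
by rewrite divfK // gt_eqF.
Qed.

Lemma mxlimM X Y x y : mxlim X x -> mxlim Y y -> mxlim (fun n => X n * Y n) (x * y).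
Proof.
move=> hX hY e e0.
pose c := mxnrm x + mxnrm y + 1.
have c0 : 0 < c by rewrite ltr_wpDl // addr_ge0 // mxnrm_ge0.
have d0 : 0 < Num.min 1 (e / (2 * c)) by rewrite lt_min ltr01 divr_gt0 // mulr_gt0.
have [N hN] := hX _ d0; have [M hM] := hY _ d0; exists (maxn N M) => n.
rewrite geq_max => /andP[/hN h1 /hM h2].
have E (T : pzRingType) (a b a' b' : T) :
  a * b - a' * b' = (a - a') * (b - b') + (a - a') * b' + a' * (b - b') by ncring.
rewrite E.
rewrite !le_min in h1 h2; have /andP[h11 h12] := h1; have /andP[_ h22] := h2.
have z1 := mxnrm_ge0 (X n - x); have z2 := mxnrm_ge0 (Y n - y).
have zx := mxnrm_ge0 x; have zy := mxnrm_ge0 y.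
have b : mxnrm ((X n - x) * (Y n - y) + (X n - x) * y + x * (Y n - y)) <=
  mxnrm (X n - x) * mxnrm (Y n - y) + mxnrm (X n - x) * mxnrm y + mxnrm x * mxnrm (Y n - y).
  by rewrite (le_trans (mxnrmD _ _)) // lerD ?mxnrmM // (le_trans (mxnrmD _ _)) // lerD ?mxnrmM.
apply: (le_trans b).
rewrite ler_pdivlMr ?mulr_gt0 // in h12; rewrite ler_pdivlMr ?mulr_gt0 // in h22.
rewrite /c in h12 h22; nra.
Qed.

(** Approximate projections, straightened by [near_projection], still converge. *)
Lemma mxlim_projection X P k x c : mxlim X x -> x * x = x ->
  (forall n, X n - P n = (X n * X n - X n) * k n) -> (forall n, mxnrm (k n) <= c) ->
  mxlim P x.
Proof.
move=> hX xx hP hk.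
have h0 : mxlim (fun n => X n * X n - X n) 0.
  by rewrite -(subrr x) -{1}xx; apply: mxlimB => //; exact: mxlimM.
have h1 := mxlim_bounded0 h0 hk.
have := mxlimB hX h1; rewrite subr0.
by under eq_fun => n do rewrite -hP subKr.
Qed.

End MatrixLimits.

(** * Comparison of projections over a commutant *)

Section CommutantComparison.
Variables (R : realType) (A : cstarAlgType R).
Local Notation C := R[i].
Local Notation scal := (@scal R A).
Local Notation star := (@star R A).
Let ax := cstar_axioms A.
Variable Bs : nat -> csubalg A.
Hypothesis fBs : forall n, fin_dim (Bs n).
Hypothesis incBs : forall n, Bs n `<=` Bs n.+1.
Hypothesis denseBs : dense (\bigcup_n Bs n).
Variables (n0 K : nat).

Let cmx (M : 'M[A]_K) := forall i j, commutant_set (Bs n0) (M i j).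

Lemma commutant_mx_approx (m : nat) (X : 'I_m -> 'M[A]_K) :
  (forall i, cmx (X i)) ->
  exists (D : nat -> A -> Prop) (Y : 'I_m -> nat -> 'M[A]_K),
  [/\ forall n, star_subalg scal star (D n), forall n, finspan scal (D n),
      forall n, D n `<=` commutant_set (Bs n0),
      forall i n, mx_over (D n) (Y i n) & forall i, mxlim (Y i) (X i)].
Proof.
move=> cX.
pose x (t : 'I_m * ('I_K * 'I_K)) := X t.1 t.2.1 t.2.2.
have e0 n : 0 < n.+1%:R^-1 :> R by rewrite invr_gt0 ltr0n.
have /choice[D /choice[y yP]] := fun n =>
  commutant_approx fBs incBs denseBs (e0 n) (fun t => cX t.1 t.2.1 t.2.2 : commutant_set (Bs n0) (x t)).
exists D, (fun i n => \matrix_(a, b) y n (i, (a, b))); split.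
- by move=> n; have [] := yP n.
- by move=> n; have [] := yP n.
- by move=> n; have [] := yP n.
- by move=> i n a b; rewrite mxE; have [_ _ _ h _] := yP n.
move=> i e ep; have kp : 0 < (K * K).+1%:R :> R by rewrite ltr0n.
pose N := Num.bound `|(K * K).+1%:R / e|.
exists N => n Nn; rewrite (le_trans (y := n.+1%:R^-1 * (K * K)%:R)) //.
  by apply: mxnrm_le => a b; rewrite !mxE -nrmN opprB; have [_ _ _ _ /(_ (i, (a, b)))] := yP n.
have hN : (K * K).+1%:R / e < n.+1%:R.
  rewrite (le_lt_trans (ler_norm _)) // (lt_le_trans (archi_boundP (normr_ge0 _))) //.
  by rewrite ler_nat ltnW.
rewrite ler_pdivrMl ?ltr0n // -ler_pdivrMr // (le_trans _ (ltW hN)) //.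
by rewrite ler_pM2r ?invr_gt0 // ler_nat leqnSn.
Qed.

(** Cancellation of [r] over the commutant of a finite-dimensional algebra, up to
[e]. The four matrices are approximated by matrices over finite-dimensional
subalgebras of the commutant; the approximations are straightened into projections
with the same orthogonality relations, and the approximation of [V] is still
injective on [p + r]. There [finite_comparison] applies. *)
Lemma commutant_comparison (p q r V : 'M[A]_K) e : 0 < e ->
  cmx p -> cmx q -> cmx r -> cmx V ->
  sproj (@adj R A K) p -> sproj (@adj R A K) q -> sproj (@adj R A K) r ->
  p * r = 0 -> q * r = 0 -> adj V * V = p + r -> (q + r) * V = V ->
  exists u, [/\ cmx u, q * u = u & mxnrm (adj u * u - p) <= e].
Proof.
move=> e0 cp cq cr cV [pp pst] [qq qst] [rr rst] pr qr VV QV.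
pose X (i : 'I_4) := nth p [:: p; q; r; V] i.
have cX i : cmx (X i).
  by case: i => [[|[|[|[|i]]]] hi] //.
have [D [Y [SD fD DB YD Ylim]]] := commutant_mx_approx cX.
pose S n := mx_over (K := K) (D n).
have axK := adj_axioms A K.
have SS n : star_subalg (@scalmx R A K) (@adj R A K) (S n) by exact: mx_over_subalg.
have fS n : finspan (@scalmx R A K) (S n) by exact: mx_over_finspan.
have pS n : proper_star (@adj R A K) (S n) by exact: (mx_over_proper (SD n) (fD n)).
have adjM (x y : 'M[A]_K) : adj (x * y) = adj y * adj x by exact: (star_stM axK).
have adjK (x : 'M[A]_K) : adj (adj x) = x by exact: (star_stK axK).
have adj1 : adj (1 : 'M[A]_K) = 1 by exact: (star_st1 axK).
have straighten (h : nat -> 'M[A]_K) x : (forall n, S n (h n)) ->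
    (forall n, adj (h n) = h n) -> x * x = x -> mxlim h x ->
    exists P, (forall n, [/\ S n (P n), sproj (@adj R A K) (P n) & exists l, P n = h n * l])
      /\ mxlim P x.
  move=> Sh hh xx hx.
  have /choice[P /choice[k kP]] : forall n, exists P k,
      [/\ S n P, sproj (@adj R A K) P, exists l, P = h n * l,
          h n - P = (h n * h n - h n) * k & mxnrm k <= 2 * (K * K)%:R].
    move=> n; have [P [k [l [b [[SP Sk Sl Sb] sP hP Pl kb]]]]] :=
      near_projection axK (SS n) (fS n) (@pS n) (Sh n) (hh n).
    exists P, k; split=> //; first by exists l.
    apply: (mxnrm_le_sum_squares (SD n) (fD n) (N := b)) => //.
    rewrite -[LHS]/(adj k * k + adj b * b) kb; congr scalmx.
    by rewrite -natrX rmorph_nat.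
  exists P; split=> [n|]; first by have [] := kP n.
  by apply: (mxlim_projection hx xx (k := k) (c := 2 * (K * K)%:R)) => n; have [] := kP n.
have Ysub i n : S n (Y i n) by exact: YD.
have lp : mxlim (Y 0) p by exact: (Ylim 0).
have lq : mxlim (Y 1) q by exact: (Ylim 1).
have lr : mxlim (Y 2) r by exact: (Ylim 2).
have lV : mxlim (Y 3) V by exact: (Ylim 3).
pose hermitian (M : 'M[A]_K) := @scalmx R A K 2^-1 * (M + adj M).
have herm_st M : adj (hermitian M) = hermitian M.
  rewrite adjM (star_sg axK) -(star_sgC axK) raddfD /= adjK addrC.
  by rewrite fmorphV rmorph_nat.
have herm_lim Z z : adj z = z -> mxlim Z z -> mxlim (fun n => hermitian (Z n)) z.
  move=> zz lz; have -> : z = hermitian z.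
    have E (T : pzRingType) (a b : T) : a * (b + b) = a * (1 + 1) * b by ncring.
    rewrite /hermitian zz E -(rmorph1 (@scalmx R A K)) -rmorphD -rmorphM.
    by rewrite -[1 + 1]/(2%:R) mulVf ?pnatr_eq0 // rmorph1 mul1r.
  by apply: mxlimM; [exact: mxlim_cst|apply: mxlimD => //; exact: mxlim_adj].
have hermS n M : S n M -> S n (hermitian M).
  by move=> SM; apply: (ssubZ (SS n)); apply: (ssubD (SS n)) => //; exact: (ssub_st (SS n)).
have [r' [r'P lr']] := straighten _ r (fun n => hermS n _ (Ysub 2 n))
  (fun n => herm_st _) rr (herm_lim _ _ rst lr).
(* Cutting by [1 - r'] makes the straightened projections exactly orthogonal to [r']. *)
pose cut (Z : nat -> 'M[A]_K) n := (1 - r' n) * hermitian (Z n) * (1 - r' n).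
have cutS (Z : nat -> 'M[A]_K) : (forall n, S n (Z n)) -> forall n, S n (cut Z n).
  move=> SZ n; have [Sr _ _] := r'P n.
  have S1r : S n (1 - r' n) by apply: (subB (SS n)) => //; exact: (ssub1 (SS n)).
  by do 2?apply: (ssubM (SS n)) => //; exact: hermS.
have cut_st Z n : adj (cut Z n) = cut Z n.
  by have [_ [_ rs] _] := r'P n; rewrite adjM (adjM (1 - r' n)) herm_st !raddfB /= adj1 rs mulrA.
have cut_lim Z z : adj z = z -> z * r = 0 -> mxlim Z z -> mxlim (cut Z) z.
  move=> zz zr lz; have rz : r * z = 0.
    by rewrite -[LHS]adjK adjM zz rst zr raddf0.
  have -> : z = (1 - r) * z * (1 - r).
    by rewrite mulrBl mul1r rz subr0 mulrBr mulr1 zr subr0.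
  have l1 : mxlim (fun n => 1 - r' n) (1 - r) by apply: mxlimB => //; exact: mxlim_cst.
  by apply: mxlimM => //; apply: mxlimM => //; exact: herm_lim.
have rcut Z n : r' n * cut Z n = 0.
  have [_ [ri _] _] := r'P n; rewrite /cut mulrA (mulrA (r' n)).
  by rewrite (mulrBr (r' n)) mulr1 ri subrr !mul0r.
have [p' [p'P lp']] := straighten _ p (cutS _ (Ysub 0)) (cut_st _) pp (cut_lim _ _ pst pr lp).
have [q' [q'P lq']] := straighten _ q (cutS _ (Ysub 1)) (cut_st _) qq (cut_lim _ _ qst qr lq).
have orth z n (l : 'M[A]_K) Z : adj z = z -> z = cut Z n * l -> z * r' n = 0.
  move=> zz zE; have [_ [_ rs] _] := r'P n.
  by rewrite -[LHS]adjK adjM zz rs zE mulrA rcut mul0r raddf0.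
pose x n := (q' n + r' n) * Y 3 n * (p' n + r' n).
have rp : r * p = 0 by rewrite -[LHS]adjK adjM pst rst pr raddf0.
have PP : (p + r) * (p + r) = p + r.
  have E (T : pzRingType) (a b : T) : (a + b) * (a + b) = a * a + a * b + b * a + b * b by ncring.
  by rewrite E pp pr rp rr !addr0.
have lP : mxlim (fun n => p' n + r' n) (p + r) by exact: mxlimD.
have lx : mxlim x (V * (p + r)).
  by rewrite -{1}QV; apply: mxlimM => //; apply: mxlimM => //; exact: mxlimD.
have lxx : mxlim (fun n => p' n + r' n - adj (x n) * x n) 0.
  rewrite -(subrr (p + r)); apply: mxlimB => //.
  have -> : p + r = adj (V * (p + r)) * (V * (p + r)).
    by rewrite adjM raddfD /= pst rst mulrA -(mulrA (p + r)) VV !PP.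
  by apply: mxlimM => //; exact: mxlim_adj.
have half0 : 0 < 2^-1 :> R by rewrite invr_gt0.
pose c : R := 1 * (K * K)%:R.
have c0 : 0 <= c by rewrite mulr_ge0.
have k1 : 0 < c ^+ 2 + 1 by rewrite ltr_wpDl // exprn_ge0.
have e2 : 0 < e / 2 by rewrite divr_gt0.
have [N1 hN1] := lxx _ half0; have [N2 hN2] := lp' _ e2.
have [N3 hN3] := lq' _ (divr_gt0 e2 k1).
pose n := maxn N1 (maxn N2 N3).
have {}hN1 := hN1 n (leq_maxl _ _).
have {}hN2 : mxnrm (p' n - p) <= e / 2 by apply: hN2; rewrite !leq_max leqnn orbT.
have {}hN3 : mxnrm (q' n - q) <= e / 2 / (c ^+ 2 + 1) by apply: hN3; rewrite !leq_max leqnn !orbT.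
have [Sp' sp' [lp0 lp0E]] := p'P n; have [Sq' sq' [lq0 lq0E]] := q'P n.
have [Sr' sr' _] := r'P n.
have r'q' : q' n * r' n = 0 by apply: orth lq0E; case: sq'.
have r'p' : p' n * r' n = 0 by apply: orth lp0E; case: sp'.
have Sx : S n (x n).
  by do 2?apply: (ssubM (SS n)) => //; exact: (ssubD (SS n)).
have Qx : (q' n + r' n) * x n = x n.
  rewrite /x !mulrA.
  have E (T : pzRingType) (a b : T) : (a + b) * (a + b) = a * a + a * b + b * a + b * b by ncring.
  have rq' : r' n * q' n = 0.
    by rewrite -[LHS]adjK adjM; case: sq' => _ ->; case: sr' => _ ->; rewrite r'q' raddf0.
  by rewrite E; case: sq' => -> _; case: sr' => -> _; rewrite r'q' rq' !addr0.
(* [adj (x n) * x n] is within 1/2 of the unit of the corner of [p' n + r' n]. *)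
have inj y : S n y -> (p' n + r' n) * y = y -> x n * y = 0 -> y = 0.
  move=> _ Py xy; apply: mxnrm_eq0; apply/eqP; rewrite eq_le mxnrm_ge0 andbT.
  have yE : y = (p' n + r' n - adj (x n) * x n - 0) * y.
    by rewrite subr0 mulrBl Py -mulrA xy mulr0 subr0.
  have := mxnrmM (p' n + r' n - adj (x n) * x n - 0) y.
  rewrite -yE => h; have := ler_wpM2r (mxnrm_ge0 y) hN1 => h'.
  have := le_trans h h'; have := mxnrm_ge0 y; lra.
have [u [Su uu qu]] :=
  finite_comparison axK (SS n) (fS n) (@pS n) Sp' Sq' Sr' Sx sp' sq' sr' r'p' r'q' Qx inj.
have unrm : mxnrm u <= c.
  apply: (mxnrm_le_sum_squares (SD n) (fD n) (N := 1 - p' n)) => //.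
    by apply: (subB (SS n)) => //; exact: (ssub1 (SS n)).
  case: sp' => pi ps; rewrite expr1n rmorph1 [adj u * u]uu raddfB /= adj1 ps.
  by rewrite mulrBr mulr1 mulrBl mul1r pi subrr subr0 addrC subrK.
exists (q * u); split.
- have cu : cmx u by move=> i j; apply: DB; exact: Su.
  by move=> i j; exact: (mx_inM (D := commutant (Bs n0)) cq cu).
- by rewrite mulrA qq.
(* [q' n] is traded for [q] at small cost, since the bound [c] on [u] is independent of [n]. *)
have -> : adj (q * u) * (q * u) - p = (p' n - p) - adj u * ((q' n - q) * u).
  rewrite adjM qst mulrA -(mulrA (adj u)) qq -[p' n]uu mulrBl qu -mulrA mulrBr.
  have E (T : pzRingType) (a b d : T) : b - d = a - d - (a - b) by ncring.
  exact: E.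
rewrite (le_trans (mxnrmD _ _)) // mxnrmN (splitr e) lerD //.
rewrite (le_trans (mxnrmM _ _)) // mxnrm_adj.
rewrite (le_trans (y := c * (e / 2 / (c ^+ 2 + 1) * c))) //.
  by rewrite ler_pM ?mxnrm_ge0 // (le_trans (mxnrmM _ _)) // ler_pM ?mxnrm_ge0.
rewrite (_ : c * _ = e / 2 * (c ^+ 2 / (c ^+ 2 + 1))); last by field; rewrite gt_eqF.
by rewrite ger_pMr // ler_pdivrMr // mul1r lerDl.
Qed.

End CommutantComparison.

(** * From inequalities in K_0 to partial isometries *)

Section K0Comparison.
Variables (R : realType) (A : cstarAlgType R).
Local Notation star := (@star R A).
Variable Bs : nat -> csubalg A.
Hypothesis fBs : forall n, fin_dim (Bs n).
Hypothesis incBs : forall n, Bs n `<=` Bs n.+1.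
Hypothesis denseBs : dense (\bigcup_n Bs n).
Variable n0 : nat.
Local Notation D := (commutant (Bs n0)).
Implicit Types p q : mxproj D.

(** The rectangular partial isometry of a stable equivalence becomes a square matrix
[V] when [p], [q] and [r] are put into three diagonal blocks of one matrix algebra.
The part of the equivalence on [s] is cut off. *)
Lemma mvn_comparison p q s r e : 0 < e -> mvn (dsum (dsum p s) r) (dsum q r) ->
  exists u : 'M[A]_(mxproj_dim q, mxproj_dim p),
    [/\ mx_in D u, mxproj_mx q *m u = u &
      forall i j, nrm ((adjmx u *m u - mxproj_mx p) i j) <= e].
Proof.
move=> e0 /asboolP[v [vD vv vq]].
pose a := mxproj_dim p; pose b := mxproj_dim q; pose c := mxproj_dim r.
(* [I] and [J] place the blocks of [w] in the large matrix; [J] drops the summand [s]. *)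
pose J : 'M[A]_(a + mxproj_dim s + c, a + (b + c)) :=
  block_mx (col_mx (p : 'M[A]_a) 0) 0 0 (row_mx 0 (r : 'M[A]_c)).
pose I : 'M[A]_(a + (b + c), b + c) := col_mx 0 1%:M.
pose p1 : 'M[A]_(a + (b + c)) := block_mx (p : 'M[A]_a) 0 0 0.
pose q1 : 'M[A]_(a + (b + c)) := block_mx 0 0 0 (block_mx (q : 'M[A]_b) 0 0 0).
pose r1 : 'M[A]_(a + (b + c)) := block_mx 0 0 0 (block_mx 0 0 0 (r : 'M[A]_c)).
pose w := dsum_mx q r *m v.
have pi := mxproj_idem p; have qi := mxproj_idem q; have ri := mxproj_idem r.
have pa := mxproj_adj p; have qa := mxproj_adj q; have ra := mxproj_adj r.
have ww : adjmx w *m w = dsum_mx (dsum p s) r.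
  have di := dsum_idem q r; have da := dsum_adj q r; have pi' := dsum_idem (dsum p s) r.
  have vq' : v *m adjmx v = dsum_mx q r := vq.
  have vv' : adjmx v *m v = dsum_mx (dsum p s) r := vv.
  rewrite /w adjmxM da -mulmxA (mulmxA (dsum_mx q r)) di -vq'.
  by rewrite !mulmxA vv' -mulmxA vv' pi'.
have wQ : dsum_mx q r *m w = w by rewrite /w mulmxA (dsum_idem q r).
have wD : mx_in D w by apply: mx_inM => //; exact: dsum_in.
clearbody w.
pose V := I *m w *m J.
have in0 m n : mx_in D (0 : 'M[A]_(m, n)) := @mx_in0 _ _ D m n.
have simp := (mulmx0, mul0mx, addr0, add0r).
have adjcol m1 m2 n (x : 'M[A]_(m1, n)) (y : 'M[A]_(m2, n)) :
    adjmx (col_mx x y) = row_mx (adjmx x) (adjmx y).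
  by rewrite /adjmx map_col_mx tr_col_mx.
have adj1 n : adjmx (1%:M : 'M[A]_n) = 1%:M.
  apply/matrixP => i j; rewrite !mxE eq_sym; case: eqP => _; rewrite ?mulr1n ?mulr0n.
    exact: star1.
  exact: star0.
have in1 n : mx_in D (1%:M : 'M[A]_n).
  move=> i j; rewrite mxE; case: eqP => _; rewrite ?mulr1n ?mulr0n.
    exact: commutant1.
  exact: commutant0.
have incol m1 m2 n (x : 'M[A]_(m1, n)) (y : 'M[A]_(m2, n)) :
    mx_in D x -> mx_in D y -> mx_in D (col_mx x y).
  by move=> hx hy i j; rewrite mxE; case: (fintype.split i).
have p1D : mx_in D p1 by apply: mx_in_block => //; exact: mxproj_in.
have q1D : mx_in D q1 by do 2?[apply: mx_in_block => //]; exact: mxproj_in.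
have r1D : mx_in D r1 by do 2?[apply: mx_in_block => //]; exact: mxproj_in.
have VD : mx_in D V.
  apply: mx_inM; first by apply: mx_inM => //; exact: incol.
  apply: mx_in_block => //; first by apply: incol => //; exact: mxproj_in.
  by apply: mx_in_row => //; exact: mxproj_in.
have sp1 : sproj (@adj R A _) p1.
  split; last by rewrite /adj adjmx_block !adjmx0 pa.
  by rewrite -mulmxE mulmx_block !simp pi.
have sq1 : sproj (@adj R A _) q1.
  split; last by rewrite /adj !adjmx_block !adjmx0 qa.
  by rewrite -mulmxE !mulmx_block !simp qi.
have sr1 : sproj (@adj R A _) r1.
  split; last by rewrite /adj !adjmx_block !adjmx0 ra.
  by rewrite -mulmxE !mulmx_block !simp ri.
have pr : p1 * r1 = 0 by rewrite -mulmxE mulmx_block !simp block_mx0.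
have qr : q1 * r1 = 0 by rewrite -mulmxE !mulmx_block !simp !block_mx0.
have II : adjmx I *m I = 1%:M by rewrite adjcol adjmx0 adj1 mul_row_col !simp mulmx1.
have adjJ : adjmx J = block_mx (row_mx (p : 'M[A]_a) 0) 0 0 (col_mx 0 (r : 'M[A]_c)).
  by rewrite adjmx_block adjcol adjmx_row !adjmx0 pa ra.
have VV : adj V * V = p1 + r1.
  rewrite -mulmxE /adj /V !adjmxM -!mulmxA (mulmxA (adjmx I)) II mul1mx (mulmxA (adjmx w)) ww.
  rewrite adjJ /= /dsum_mx /= /dsum_mx mulmx_block !simp mulmx_block !simp.
  rewrite mul_block_col !simp mul_row_col !simp mul_mx_row mul_col_row !simp !pi !ri.
  by rewrite /p1 /r1 add_block_mx !simp.
have QI : (q1 + r1) *m I = I *m dsum_mx q r.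
  rewrite /q1 /r1 add_block_mx !simp add_block_mx !simp mul_block_col !simp mulmx1.
  by rewrite mul_col_mx mul0mx mul1mx.
have QV : (q1 + r1) * V = V.
  by rewrite -mulmxE /V !mulmxA QI -!mulmxA (mulmxA (dsum_mx q r)) wQ.
have [u [uD qu up]] := commutant_comparison fBs incBs denseBs e0 p1D q1D r1D VD sp1 sq1 sr1 pr qr VV QV.
pose x := usubmx (dlsubmx u).
have qu' : q1 *m u = u by exact: qu.
have [u0 xE dl0] : [/\ ulsubmx u = 0, mxproj_mx q *m x = x & dsubmx (dlsubmx u) = 0].
  have := qu'; rewrite -{1 2}[u]submxK /q1 mulmx_block !simp.
  case/eq_block_mx => u0 _ dlE _; move: dlE.
  have yE : dlsubmx u = col_mx x (dsubmx (dlsubmx u)) by rewrite vsubmxK.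
  by rewrite {1}yE mul_block_col !simp {1}yE => /eq_col_mx[xE y0]; split; rewrite // -y0.
have uE : u = block_mx 0 (ursubmx u) (col_mx x 0) (drsubmx u).
  by rewrite -{1}[u]submxK u0 -{1}[dlsubmx u]vsubmxK dl0.
exists x; split=> //; first by move=> i j; rewrite !mxE; exact: uD.
move=> i j; apply: le_trans up.
rewrite (le_trans _ (nrm_le_mxnrm _ (lshift _ i) (lshift _ j))) //.
rewrite le_eqVlt; apply/orP; left; apply/eqP; congr nrm.
have -> : adj u * u = adjmx u *m u by [].
rewrite {1 2}uE adjmx_block adjmx0 adjcol adjmx0 mulmx_block mul_row_col !simp.
rewrite /p1 opp_block_mx add_block_mx [in RHS]block_mxEul //.
Qed.

Lemma K0_class_add p q : K0_class p + K0_class q = K0_class (dsum p q).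
Proof. by rewrite /K0_class [LHS]groth_addE /= addr0 [X in (X, _)]VaddE. Qed.

Lemma K0_class_eq p q : K0_class p = K0_class q -> exists r, mvn (dsum p r) (dsum q r).
Proof.
case/groth_pairE => x /=; rewrite !addr0 -[x]Vclass_repr => h; exists (repr x).
by apply/VclassP; rewrite -!VaddE.
Qed.

Lemma proj_mx1E (f : projection D) : proj_mx1 f = (f : A)%:M.
Proof. by apply/matrixP => i j; rewrite !mxE (ord1 i) (ord1 j) eqxx mulr1n. Qed.

Lemma K0_le_copies (e f : projection D) d : 0 < d -> K0_le (K0_proj f *+ 3) (K0_proj e) ->
  exists z : 'I_3 -> A, [/\ forall i, commutant_set (Bs n0) (z i),
    forall i, (e : A) * z i = z i &
    forall i j, nrm (star (z i) * z j - (if i == j then (f : A) else 0)) <= d].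
Proof.
move=> d0 [s /eqP]; rewrite subr_eq addrC mulrSr mulrSr mulr1n !K0_class_add => /eqP.
move/esym/K0_class_eq => [r h].
have [u [uD eu uu]] := mvn_comparison d0 h.
rewrite /= /dsum_mx /= /dsum_mx /= !proj_mx1E -!scalar_mx_block in u uD eu uu *.
exists (fun i : 'I_3 => (u : 'M[A]_(1, 3)) ord0 i); split.
- by move=> i; exact: uD.
- move=> i; have /matrixP/(_ ord0 i) := eu.
  by rewrite mxE big_ord1 /= mxE.
move=> i j; have := uu i j.
by rewrite mxE mxE big_ord1 !mxE mulrb.
Qed.

Lemma K0_eq_copy (e f : projection D) d : 0 < d -> K0_proj f = K0_proj e ->
  exists z : A, [/\ commutant_set (Bs n0) z, (e : A) * z = z & nrm (star z * z - (f : A)) <= d].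
Proof.
move=> d0 /K0_class_eq[r]; set F := MxProj _ _ _ => h.
have h0 : mvn (dsum (dsum F (mxproj0 D)) r) (dsum F r).
  by apply: mvn_dsum (mvn_refl r); apply: mvn_trans (mvn_dsumC _ _) (mvn_dsum0 F).
have [u [uD eu uu]] := mvn_comparison d0 (mvn_trans h0 h).
rewrite /= !proj_mx1E in u uD eu uu *.
exists ((u : 'M[A]_1) ord0 ord0); split.
- exact: uD.
- have /matrixP/(_ ord0 ord0) := eu.
  by rewrite mxE big_ord1 /= mxE.
by have := uu ord0 ord0; rewrite mxE mxE big_ord1 !mxE mulr1n.
Qed.

End K0Comparison.

(** * Automorphisms of AF algebras are isometric *)

Section Isometry.
Variables (R : realType) (A : cstarAlgType R).
Local Notation C := R[i].
Local Notation scal := (@scal R A).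
Local Notation star := (@star R A).
Let ax := cstar_axioms A.

Lemma nrmX (x : A) n : nrm (x ^+ n) <= nrm x ^+ n.
Proof.
elim: n => [|n IH]; first by rewrite !expr0 nrm1_le.
by rewrite !exprS (le_trans (nrmM _ _)) // ler_wpM2l ?nrm_ge0.
Qed.

(** The Neumann series. *)
Lemma left_inverse_near1 (x : A) : nrm x < 1 -> exists y, y * (1 - x) = 1.
Proof.
move=> x1; set r := nrm x in x1.
have r0 : 0 <= r := nrm_ge0 x.
have r1 : 0 < 1 - r by rewrite subr_gt0.
pose u := fun k => (x ^+ k : cstar_space A).
have smallX e : 0 < e -> exists N, forall n, (N <= n)%N -> r ^+ n < e.
  move=> e0; have : (fun n => r ^+ n) @ \oo --> (0 : R).
    by apply: cvg_expr; rewrite ger0_norm.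
  move/cvgrPdist_lt => /(_ e e0) [N _ hN]; exists N => n Nn.
  by have := hN n Nn; rewrite /= sub0r normrN ger0_norm ?exprn_ge0.
have tail m n : nrm (\sum_(m <= k < n) u k : A) * (1 - r) <= r ^+ m.
  have [nm|mn] := leqP n m; first by rewrite big_geq // nrm0 mul0r exprn_ge0.
  have h : nrm (\sum_(m <= k < n) u k : A) <= \sum_(m <= k < n) r ^+ k.
    by rewrite (le_trans (nrm_sum _ _ _)) //; apply: ler_sum => k _; exact: nrmX.
  rewrite (le_trans (ler_wpM2r (ltW r1) h)) //.
  have -> : (\sum_(m <= k < n) r ^+ k) * (1 - r) = r ^+ m - r ^+ n.
    elim: n mn {h} => // n IH; rewrite ltnS leq_eqVlt => /orP[/eqP <-|mn].
      by rewrite big_nat1 exprSr; ring.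
    by rewrite (big_nat_recr _ _ _ (ltnW mn)) /= mulrDl (IH mn) exprSr; ring.
  by rewrite gerBl exprn_ge0.
have /cauchy_cvg : cauchy (series u @ \oo).
  apply/cauchy_seriesP => e e0.
  have eE : e = (complex.Re e)%:C by rewrite RRe_real // gtr0_real.
  have e1 : 0 < complex.Re e by rewrite -ltcR -eE.
  have [N hN] := smallX _ (mulr_gt0 e1 r1).
  exists ([set n | (N <= n)%N], setT); first by split=> //; exists N.
  move=> [m n] [/= Nm _]; rewrite eE -[X in `|X|]/(\sum_(m <= k < n) u k : A) normE ltcR.
  by rewrite -(ltr_pM2r r1) (le_lt_trans (tail _ _)) // hN.
move=> /cvg_ex[y yP]; exists (y : A).
apply/eqP; rewrite -subr_eq0; apply/eqP/nrm_eq0/eqP.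
rewrite eq_le nrm_ge0 andbT; apply/ler_addgt0Pr => e e0; rewrite add0r.
pose c := nrm (1 - x) + 1.
have c0 : 0 < c by rewrite ltr_wpDl // nrm_ge0.
have e2 : 0 < e / 2 by rewrite divr_gt0.
have ec : 0 < (e / 2 / c)%:C by rewrite ltcR divr_gt0.
have /cvgrPdist_lt/(_ _ ec)[N1 _ hN1] := yP.
have [N2 hN2] := smallX _ e2.
pose n := maxn N1 N2.
have := hN1 n (leq_maxl _ _); rewrite /= -[`|_|]/(`|(y : A) - series u n|) normE ltcR => h1.
have h2 := hN2 n (leq_maxr _ _).
have yn : (series u n : A) * (1 - x) = 1 - x ^+ n.
  rewrite /series /=; elim: (n) => [|k IH]; first by rewrite big_geq // mul0r expr0 subrr.
  by rewrite big_nat_recr //= [X in X * _]/(_ + _) mulrDl IH exprSr /u; ncring.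
have -> : (y : A) * (1 - x) - 1 = ((y : A) - series u n) * (1 - x) - x ^+ n.
  have E (T : pzRingType) (a b : T) : a - 1 = a - (1 - b) - b by ncring.
  by rewrite mulrBl yn; exact: E.
rewrite (splitr e) (le_trans (nrmB _ _)) // lerD //; last first.
  by rewrite (le_trans (nrmX _ _)) // ltW.
rewrite (le_trans (nrmM _ _)) // (le_trans (y := e / 2 / c * c)) //.
  by rewrite ler_pM ?nrm_ge0 //; [exact: ltW|rewrite lerDl].
by rewrite divfK // gt_eqF.
Qed.

Lemma cabs_real (x : R) : cabs x%:C = `|x|.
Proof.
by apply: (@complexI R); rewrite -cnormE normc_def /= expr0n /= addr0 sqrtr_sqr.
Qed.

Lemma real_of_conj (l : C) : l^* = l -> exists2 x : R, l = x%:C & cabs l = `|x|.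
Proof.
move=> ll; have e : l = (complex.Re l)%:C by rewrite RRe_real //; apply/CrealP.
by exists (complex.Re l) => //; rewrite {1}e cabs_real.
Qed.

Variable Bs : nat -> csubalg A.
Hypothesis fBs : forall n, fin_dim (Bs n).
Hypothesis denseBs : dense (\bigcup_n Bs n).

Lemma aut_inverse (alpha : automorphism A) : exists beta : automorphism A,
  cancel alpha beta /\ cancel beta alpha.
Proof.
have [g ag ga] := aut_bij alpha; have inj := can_inj ag.
unshelve eexists (@Automorphism R A g _ _ _ _ _) => //.
- by move=> x y; apply: inj; rewrite autD !ga.
- by move=> c x; apply: inj; rewrite autZ !ga.
- by move=> x y; apply: inj; rewrite autM !ga.
- by move=> x; apply: inj; rewrite aut_star !ga.
- by exists alpha.
Qed.

Section Automorphism.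
Variable alpha : automorphism A.

Lemma autB x y : alpha (x - y) = alpha x - alpha y.
Proof. by rewrite -[in RHS](subrK y x) [in RHS]autD addrK. Qed.

Lemma aut1 : alpha 1 = 1.
Proof.
have [beta [_ ba]] := aut_inverse alpha.
by rewrite -[LHS]mulr1 -{2}[1](ba 1) -autM mul1r ba.
Qed.

Lemma aut_scal c : alpha (scal c) = scal c.
Proof. by rewrite /scal autZ aut1. Qed.

(** The spectral radius of a hermitian [h] is attained: eigenvalues of hermitian
elements of the dense subalgebras come close to [|h|] or [-|h|]. So [x - h] is not
invertible for one of these values [x], whereas [x - alpha h] would be if
[|alpha h| < |x|]. Both facts are made quantitative: the inverses of [1 - h / x]
are bounded by [M], and [p] is an approximate eigenvector of [h] for [x]. *)
Lemma aut_nrm_ge_herm h : star h = h -> nrm h <= nrm (alpha h).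
Proof.
move=> hh; rewrite leNgt; apply/negP => lt; set rho := nrm h in lt.
have rho0 : 0 < rho by exact: le_lt_trans (nrm_ge0 _) lt.
have [beta [ab ba]] := aut_inverse alpha.
have inv (x : R) : `|x| = rho -> exists G, G * (1 - scal (x^-1)%:C * h) = 1.
  move=> xr; have [|y yE] := @left_inverse_near1 (scal (x^-1)%:C * alpha h).
    rewrite -scalE nrmZ.
    have -> : cabs (x^-1)%:C = rho^-1 by rewrite cabs_real normfV xr.
    by rewrite mulrC ltr_pdivrMr // mul1r.
  exists (beta y); apply: (can_inj ab).
  by rewrite autM ba autB aut1 autM aut_scal.
have rr : `|rho| = rho by rewrite gtr0_norm.
have rN : `|- rho| = rho by rewrite normrN.
have [G1 hG1] := inv _ rr; have [G2 hG2] := inv _ rN.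
pose M := nrm G1 + nrm G2 + 1.
have M0 : 0 < M by rewrite ltr_wpDl // addr_ge0 // nrm_ge0.
(* With errors [2 eta] and [eta] below, [p] would satisfy [|p| <= |p| / 2]. *)
pose eta := rho / (6 * M).
have eta0 : 0 < eta by rewrite divr_gt0 // mulr_gt0.
have [n [k [Bk hk]]] := dense_approx denseBs h eta0.
pose h' := scal (2^-1) * (k + star k).
have conj2 : (2^-1 : C)^*%R = 2^-1 by rewrite fmorphV rmorph_nat.
have h'h' : star h' = h'.
  by rewrite starM (star_sg ax) -scal_comm conj2 starD starK addrC.
have hE : h = scal (2^-1) * (h + star h).
  rewrite hh; have E (T : pzRingType) (a b : T) : a * (b + b) = a * (1 + 1) * b by ncring.
  rewrite E -(rmorph1 scal) -rmorphD -rmorphM -[1 + 1]/(2%:R) mulVf ?pnatr_eq0 //.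
  by rewrite rmorph1 mul1r.
have hh' : nrm (h - h') <= eta.
  have -> : h - h' = scal 2^-1 * ((h - k) + star (h - k)).
    by rewrite {1}hE raddfB /= /h' -mulrBr; congr (_ * _); rewrite opprD addrACA.
  rewrite -scalE nrmZ (le_trans (ler_wpM2l (cabs_ge0 _) (nrmD _ _))) // nrm_star.
  have -> : cabs (2^-1 : C) = 2^-1.
    have -> : 2^-1 = (2^-1)%:C :> C by rewrite fmorphV rmorph_nat.
    by rewrite cabs_real ger0_norm // invr_ge0.
  by move: hk; lra.
have Sh' : unitization (Bs n) h'.
  have SU := unitization_subalg (Bs n).
  have Uk : unitization (Bs n) k by exact: unitization_sub.
  by apply: (ssubZ SU); apply: (ssubD SU) => //; exact: (ssub_st SU).
have nh' : rho - eta <= nrm h'.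
  have := nrmD (h - h') h'; rewrite subrK -/rho => h1; lra.
have [l [p [lr p0 hp lgt]]] : exists l p, [/\ l^*%R = l, p != 0, h' * p = scal l * p
    & rho - 2 * eta < cabs l].
  apply: contrapT => no.
  have ge0 : 0 <= rho - 2 * eta.
    rewrite /eta subr_ge0 mulrA ler_pdivrMr ?mulr_gt0 //.
    have : 1 <= M by rewrite /M lerDr addr_ge0 // nrm_ge0.
    by have := rho0; nra.
  suff : nrm h' <= rho - 2 * eta by have := eta0; lra.
  apply: (nrm_le_eigenvalues (unitization_subalg (Bs n)) (unitization_finspan (fBs n)) Sh' h'h' ge0).
  move=> l p lr _ _ p0 hp.
  by rewrite leNgt; apply/negP => lgt; apply: no; exists l, p.
have [x lE lx] := real_of_conj lr.
have np : 0 < nrm p.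
  by rewrite lt_neqAle nrm_ge0 andbT; apply: contra_neq p0 => /esym; exact: nrm_eq0.
have xle : `|x| <= rho + eta.
  rewrite -(ler_pM2r np) -lx -nrmZ scalE -hp (le_trans (nrmM _ _)) // ler_wpM2r ?nrm_ge0 //.
  have := nrmB h (h - h'); rewrite opprB addrC subrK -/rho => h1; lra.
have xgt : rho - 2 * eta < `|x| by rewrite -lx.
have [y [yr yx [G [hG GM]]]] : exists y, [/\ `|y| = rho, `|y - x| <= 2 * eta
    & exists G, G * (1 - scal (y^-1)%:C * h) = 1 /\ nrm G <= M].
  have n1 := nrm_ge0 G1; have n2 := nrm_ge0 G2.
  have [x0|x0] := leP 0 x.
    exists rho; split=> //; last by exists G1; split=> //; rewrite /M; lra.
    by rewrite ger0_norm // in xgt xle; rewrite ler_norml; apply/andP; split; lra.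
  exists (- rho); split=> //; last by exists G2; split=> //; rewrite /M; lra.
  by rewrite ltr0_norm // in xgt xle; rewrite ler_norml; apply/andP; split; lra.
have y0 : y != 0 by rewrite -normr_gt0 yr.
have cy : cabs (y^-1)%:C = rho^-1 by rewrite cabs_real normfV yr.
have pE : p = G * (scal (y^-1)%:C * (scal (y - x)%:C * p - (h - h') * p)).
  rewrite -{1}[p]mul1r -hG -!mulrA; congr (_ * _).
  have E (T : pzRingType) (a b c d e : T) : a * b = 1 -> c - a * d = a * ((b * c - e) - (d - e)).
    by move=> ab1; rewrite -{1}[c]mul1r -ab1; ncring.
  rewrite mulrBl mul1r -mulrA [in RHS]mulrBl [in RHS]hp lE.
  rewrite -[scal (y - x)%:C]/(scal _) rmorphB (rmorphB scal) (mulrBl p); apply: E.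
  by rewrite -rmorphM -rmorphM mulVf // !rmorph1.
have : nrm p <= M * (rho^-1 * (3 * eta * nrm p)).
  rewrite {1}pE (le_trans (nrmM _ _)) // ler_pM ?nrm_ge0 //.
  have rhoV : 0 <= rho^-1 by rewrite invr_ge0 ltW.
  rewrite -scalE nrmZ cy ler_wpM2l //.
  have -> : 3 * eta * nrm p = 2 * eta * nrm p + eta * nrm p by ring.
  rewrite (le_trans (nrmB _ _)) // lerD //.
    by rewrite -scalE nrmZ ler_wpM2r ?nrm_ge0 // cabs_real.
  by rewrite (le_trans (nrmM _ _)) // ler_wpM2r ?nrm_ge0.
have -> : M * (rho^-1 * (3 * eta * nrm p)) = nrm p / 2.
  by rewrite /eta; field; rewrite !gt_eqF.
lra.
Qed.

Lemma aut_nrm_ge x : nrm x <= nrm (alpha x).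
Proof.
rewrite -(ler_sqr (nrm_ge0 _) (nrm_ge0 _)) -!nrm_starM -aut_star -autM.
by apply: aut_nrm_ge_herm; rewrite starM starK.
Qed.

End Automorphism.

Lemma aut_nrm (alpha : automorphism A) x : nrm (alpha x) = nrm x.
Proof.
have [beta [ab ba]] := aut_inverse alpha.
by apply/eqP; rewrite eq_le aut_nrm_ge -{2}(ab x) aut_nrm_ge.
Qed.

End Isometry.

(** * Bounded sequences modulo null sequences *)

Section SequenceAlgebra.
Local Open Scope quotient_scope.
Variables (R : realType) (A : cstarAlgType R).
Local Notation C := R[i].
Local Notation scal := (@scal R A).
Local Notation star := (@star R A).
Let ax := cstar_axioms A.

Record bseq := BSeq { bseq_fun :> nat -> A ; bseqP : exists M, forall n, nrm (bseq_fun n) <= M }.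
HB.instance Definition _ := gen_eqMixin bseq.
HB.instance Definition _ := gen_choiceMixin bseq.

Definition eventually (P : nat -> Prop) := exists N, forall n, (N <= n)%N -> P n.

Lemma eventually2 (P Q S : nat -> Prop) : (forall n, P n -> Q n -> S n) ->
  eventually P -> eventually Q -> eventually S.
Proof.
move=> h [N hN] [M hM]; exists (maxn N M) => n.
by rewrite geq_max => /andP[/hN ? /hM ?]; exact: h.
Qed.

Lemma eventually1 (P Q : nat -> Prop) : (forall n, P n -> Q n) -> eventually P -> eventually Q.
Proof. by move=> h [N hN]; exists N => n /hN; exact: h. Qed.

Definition null_seq (x : nat -> A) := forall e : R, 0 < e -> eventually (fun n => nrm (x n) <= e).

Lemma null_seqD x y : null_seq x -> null_seq y -> null_seq (fun n => x n + y n).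
Proof.
move=> hx hy e e0; have e2 : 0 < e / 2 by rewrite divr_gt0.
apply: eventually2 (hx _ e2) (hy _ e2) => n h1 h2.
by rewrite (le_trans (nrmD _ _)) // (splitr e) lerD.
Qed.

Lemma null_seqN x : null_seq x -> null_seq (fun n => - x n).
Proof. by move=> hx e /hx; apply: eventually1 => n; rewrite nrmN. Qed.

Lemma null_seq_ext x y : (forall n, x n = y n) -> null_seq x -> null_seq y.
Proof. by move=> xy hx e /hx; apply: eventually1 => n; rewrite xy. Qed.

Lemma null_seq_le x y M : (forall n, nrm (y n) <= M * nrm (x n)) -> null_seq x -> null_seq y.
Proof.
move=> yx hx e e0; have M0 : 0 < `|M| + 1 by rewrite ltr_wpDl.
apply: eventually1 (hx _ (divr_gt0 e0 M0)) => n h; rewrite (le_trans (yx n)) //.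
rewrite (le_trans (y := (`|M| + 1) * nrm (x n))) //.
  by rewrite ler_wpM2r ?nrm_ge0 // (le_trans (ler_norm _)) // lerDl.
by move: h; rewrite ler_pdivlMr // mulrC.
Qed.

Definition bseq_eq (x y : bseq) : bool := `[< null_seq (fun n => x n - y n) >].

Lemma bseq_eq_refl : reflexive bseq_eq.
Proof. by move=> x; apply/asboolP => e e0; exists 0%N => n _; rewrite subrr nrm0 ltW. Qed.

Lemma bseq_eq_sym : symmetric bseq_eq.
Proof.
suff S x y : bseq_eq x y -> bseq_eq y x by move=> x y; apply/idP/idP; exact: S.
by move=> /asboolP h; apply/asboolP; apply: null_seq_ext (null_seqN h) => n; rewrite opprB.
Qed.

Lemma bseq_eq_trans : transitive bseq_eq.
Proof.
move=> y x z /asboolP h /asboolP k; apply/asboolP; apply: null_seq_ext (null_seqD h k) => n.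
by rewrite addrA subrK.
Qed.

Canonical bseq_equiv := EquivRel bseq_eq bseq_eq_refl bseq_eq_sym bseq_eq_trans.

Definition seqalg : Type := {eq_quot bseq_eq}.
HB.instance Definition _ := EqQuotient.on seqalg.
HB.instance Definition _ := Choice.on seqalg.

Definition class (x : bseq) : seqalg := \pi_seqalg x.

Lemma classP x y : class x = class y <-> null_seq (fun n => x n - y n).
Proof.
split=> [/eqP|h]; first by rewrite /class eqmodE => /asboolP.
by apply/eqP; rewrite /class eqmodE; apply/asboolP.
Qed.

Lemma class_repr (x : seqalg) : class (repr x) = x. Proof. exact: reprK. Qed.

Implicit Types x y z : bseq.

Lemma class_ext x y : (forall n, x n = y n) -> class x = class y.
Proof.
by move=> xy; apply/classP => e e0; exists 0%N => n _; rewrite xy subrr nrm0 ltW.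
Qed.

Lemma repr_class x : null_seq (fun n => repr (class x) n - x n).
Proof. by apply/classP; rewrite class_repr. Qed.

Lemma bseq_cst_proof (a : A) : exists M, forall n : nat, nrm a <= M.
Proof. by exists (nrm a). Qed.
Definition bseq_cst a := @BSeq (fun=> a) (bseq_cst_proof a).

Lemma bseq_add_proof (x y : bseq) : exists M, forall n, nrm (x n + y n) <= M.
Proof.
have [M hM] := bseqP x; have [N hN] := bseqP y; exists (M + N) => n.
by rewrite (le_trans (nrmD _ _)) // lerD.
Qed.
Definition bseq_add x y := BSeq (bseq_add_proof x y).

Lemma bseq_opp_proof (x : bseq) : exists M, forall n, nrm (- x n) <= M.
Proof. by have [M hM] := bseqP x; exists M => n; rewrite nrmN. Qed.
Definition bseq_opp x := BSeq (bseq_opp_proof x).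

Lemma bseq_mul_proof (x y : bseq) : exists M, forall n, nrm (x n * y n) <= M.
Proof.
have [M hM] := bseqP x; have [N hN] := bseqP y; exists (M * N) => n.
by rewrite (le_trans (nrmM _ _)) // ler_pM // nrm_ge0.
Qed.
Definition bseq_mul x y := BSeq (bseq_mul_proof x y).

Lemma bseq_star_proof (x : bseq) : exists M, forall n, nrm (star (x n)) <= M.
Proof. by have [M hM] := bseqP x; exists M => n; rewrite nrm_star. Qed.
Definition bseq_star x := BSeq (bseq_star_proof x).

Definition seqalg_add (x y : seqalg) := class (bseq_add (repr x) (repr y)).
Definition seqalg_opp (x : seqalg) := class (bseq_opp (repr x)).
Definition seqalg_mul (x y : seqalg) := class (bseq_mul (repr x) (repr y)).
Definition seqalg_star (x : seqalg) := class (bseq_star (repr x)).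

Lemma seqalg_addE x y : seqalg_add (class x) (class y) = class (bseq_add x y).
Proof.
apply/classP; apply: null_seq_ext (null_seqD (repr_class x) (repr_class y)) => n /=.
by ncring.
Qed.

Lemma seqalg_oppE x : seqalg_opp (class x) = class (bseq_opp x).
Proof.
apply/classP; apply: null_seq_ext (null_seqN (repr_class x)) => n /=.
by ncring.
Qed.

Lemma seqalg_mulE x y : seqalg_mul (class x) (class y) = class (bseq_mul x y).
Proof.
have [M hM] := bseqP (repr (class x)); have [N hN] := bseqP y.
have h1 : null_seq (fun n => (repr (class x) n - x n) * y n).
  apply: null_seq_le (repr_class x) => n; rewrite (le_trans (nrmM _ _)) // mulrC.
  by rewrite ler_wpM2r ?nrm_ge0 //; exact: hN.
have h2 : null_seq (fun n => repr (class x) n * (repr (class y) n - y n)).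
  apply: null_seq_le (repr_class y) => n; rewrite (le_trans (nrmM _ _)) //.
  by rewrite ler_wpM2r ?nrm_ge0 //; exact: hM.
apply/classP; apply: null_seq_ext (null_seqD h2 h1) => n /=.
by ncring.
Qed.

Lemma seqalg_starE x : seqalg_star (class x) = class (bseq_star x).
Proof.
apply/classP; apply: (null_seq_le (M := 1)) (repr_class x) => n /=.
by rewrite -raddfB nrm_star mul1r.
Qed.

Lemma seqalg_addA : associative seqalg_add.
Proof.
move=> x y z; rewrite -[x]class_repr -[y]class_repr -[z]class_repr !seqalg_addE.
by apply: class_ext => n /=; rewrite addrA.
Qed.

Lemma seqalg_addC : commutative seqalg_add.
Proof.
by move=> x y; rewrite -[x]class_repr -[y]class_repr !seqalg_addE; apply: class_ext => n /=; rewrite addrC.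
Qed.

Lemma seqalg_add0 : left_id (class (bseq_cst 0)) seqalg_add.
Proof.
by move=> x; rewrite -[x]class_repr !seqalg_addE; apply: class_ext => n /=; rewrite add0r.
Qed.

Lemma seqalg_addN : left_inverse (class (bseq_cst 0)) seqalg_opp seqalg_add.
Proof.
move=> x; rewrite -[x]class_repr seqalg_oppE !seqalg_addE.
by apply: class_ext => n /=; rewrite addNr.
Qed.

HB.instance Definition _ := GRing.isZmodule.Build seqalg
  seqalg_addA seqalg_addC seqalg_add0 seqalg_addN.

Lemma seqalg_mulA : associative seqalg_mul.
Proof.
move=> x y z; rewrite -[x]class_repr -[y]class_repr -[z]class_repr !seqalg_mulE.
by apply: class_ext => n /=; rewrite mulrA.
Qed.

Lemma seqalg_mul1x : left_id (class (bseq_cst 1)) seqalg_mul.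
Proof.
by move=> x; rewrite -[x]class_repr !seqalg_mulE; apply: class_ext => n /=; rewrite mul1r.
Qed.

Lemma seqalg_mulx1 : right_id (class (bseq_cst 1)) seqalg_mul.
Proof.
by move=> x; rewrite -[x]class_repr !seqalg_mulE; apply: class_ext => n /=; rewrite mulr1.
Qed.

Lemma seqalg_mulDl : left_distributive seqalg_mul +%R.
Proof.
move=> x y z; rewrite -[x]class_repr -[y]class_repr -[z]class_repr /+%R /= !(seqalg_addE, seqalg_mulE).
by apply: class_ext => n /=; rewrite mulrDl.
Qed.

Lemma seqalg_mulDr : right_distributive seqalg_mul +%R.
Proof.
move=> x y z; rewrite -[x]class_repr -[y]class_repr -[z]class_repr /+%R /= !(seqalg_addE, seqalg_mulE).
by apply: class_ext => n /=; rewrite mulrDr.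
Qed.

HB.instance Definition _ := GRing.Zmodule_isPzRing.Build seqalg
  seqalg_mulA seqalg_mul1x seqalg_mulx1 seqalg_mulDl seqalg_mulDr.

Lemma classD x y : class x + class y = class (bseq_add x y). Proof. exact: seqalg_addE. Qed.
Lemma classN x : - class x = class (bseq_opp x). Proof. exact: seqalg_oppE. Qed.
Lemma classM x y : class x * class y = class (bseq_mul x y). Proof. exact: seqalg_mulE. Qed.
Lemma class_star x : seqalg_star (class x) = class (bseq_star x). Proof. exact: seqalg_starE. Qed.

Lemma seqalg_star_zmod_morphism : zmod_morphism seqalg_star.
Proof.
move=> x y; rewrite -[x]class_repr -[y]class_repr classN classD !class_star classN classD.
by apply: class_ext => n /=; rewrite raddfB.
Qed.
HB.instance Definition _ := GRing.isZmodMorphism.Build seqalg seqalg seqalg_star seqalg_star_zmod_morphism.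

Definition cst_seq (a : A) : seqalg := class (bseq_cst a).

Definition seqscal (c : C) : seqalg := cst_seq (scal c).

Lemma seqscal_zmod_morphism : zmod_morphism seqscal.
Proof. by move=> a b; rewrite /seqscal /cst_seq classN classD; apply: class_ext => n /=; rewrite rmorphB. Qed.

Lemma seqscal_monoid_morphism : monoid_morphism seqscal.
Proof.
split=> [|a b]; rewrite /seqscal /cst_seq; first by rewrite rmorph1.
by rewrite classM; apply: class_ext => n /=; rewrite rmorphM.
Qed.
HB.instance Definition _ := GRing.isZmodMorphism.Build C seqalg seqscal seqscal_zmod_morphism.
HB.instance Definition _ := GRing.isMonoidMorphism.Build C seqalg seqscal seqscal_monoid_morphism.

Lemma seqalg_axioms : star_axioms seqscal seqalg_star.
Proof.
split.
- move=> c x; rewrite -[x]class_repr /seqscal /cst_seq !classM.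
  by apply: class_ext => n /=; rewrite scal_comm.
- move=> x y; rewrite -[x]class_repr -[y]class_repr classM !class_star classM.
  by apply: class_ext => n /=; rewrite starM.
- by move=> x; rewrite -[x]class_repr !class_star; apply: class_ext => n /=; rewrite starK.
- by move=> c; rewrite class_star; apply: class_ext => n /=; rewrite (star_sg ax).
Qed.

(** The norm of a class is the limes superior of the norms of a representative. *)
Definition seqbnd (x : seqalg) (c : R) :=
  forall d, 0 < d -> eventually (fun n => nrm (repr x n) <= c + d).

Lemma seqbnd_class (x : bseq) c :
  (forall d, 0 < d -> eventually (fun n => nrm (x n) <= c + d)) <-> seqbnd (class x) c.
Proof.
split=> h d d0; have d2 : 0 < d / 2 by rewrite divr_gt0.
  apply: eventually2 (h _ d2) (repr_class x d2) => n h1 h2.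
  have := nrmD (repr (class x) n - x n) (x n); rewrite subrK => h3; lra.
apply: eventually2 (h _ d2) (repr_class x d2) => n h1 h2.
have := nrmB (repr (class x) n) (repr (class x) n - x n); rewrite opprB addrC subrK => h3; lra.
Qed.

Lemma seqbnd_axioms : bound_axioms seqscal seqalg_star seqbnd.
Proof.
have dd d : 0 < d -> 0 < d / 2 :> R by move=> d0; rewrite divr_gt0.
split.
- move=> x; have [M hM] := bseqP (repr x); exists M => d d0; exists 0%N => n _.
  by rewrite (le_trans (hM n)) // lerDl ltW.
- move=> x c h; rewrite leNgt; apply/negP => c0.
  have [|N hN] := h (- c / 2); first by rewrite divr_gt0 // oppr_gt0.
  have := hN N (leqnn _); have := nrm_ge0 (repr x N); lra.
- move=> x c c' h cc d d0; apply: eventually1 (h d d0) => n h1.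
  by rewrite (le_trans h1) // lerD2r.
- move=> x c h d d0; have := h _ (dd d d0) _ (dd d d0); apply: eventually1 => n.
  by rewrite -addrA -splitr.
- move=> x y a b hx hy; rewrite -[x + y]/(class (bseq_add (repr x) (repr y))).
  apply: (seqbnd_class (bseq_add (repr x) (repr y)) _).1 => d d0.
  apply: eventually2 (hx _ (dd d d0)) (hy _ (dd d d0)) => n h1 h2 /=.
  by rewrite (le_trans (nrmD _ _)) // (splitr d) addrACA lerD.
- move=> x y a b hx hy; rewrite -[x * y]/(class (bseq_mul (repr x) (repr y))).
  apply: (seqbnd_class (bseq_mul (repr x) (repr y)) _).1 => d d0.
  have a0 : 0 <= `|a| by []. have b0 : 0 <= `|b| by [].
  pose k := Num.min 1 (d / (`|a| + `|b| + 1)).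
  have k0 : 0 < k by rewrite lt_min ltr01 divr_gt0 // ltr_wpDl // addr_ge0.
  apply: eventually2 (hx _ k0) (hy _ k0) => n h1 h2 /=.
  rewrite (le_trans (nrmM _ _)) // (le_trans (y := (a + k) * (b + k))) //.
    by rewrite ler_pM ?nrm_ge0.
  have k1 : k <= 1 by rewrite ge_min lexx.
  have kd : k * (`|a| + `|b| + 1) <= d.
    by rewrite -ler_pdivlMr ?ge_min ?lexx ?orbT // ltr_wpDl // addr_ge0.
  have := ler_norm a; have := ler_norm b; nra.
- move=> c; apply: (seqbnd_class (bseq_cst (scal c)) _).1 => d d0; exists 0%N => n _.
  by rewrite (le_trans (nrm_scal _ _)) // lerDl ltW.
- move=> x c h; rewrite -[seqalg_star x]/(class (bseq_star (repr x))).
  apply: (seqbnd_class (bseq_star (repr x)) _).1 => d /h; apply: eventually1 => n /=.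
  by rewrite nrm_star.
- move=> x c c0; rewrite -[x]class_repr class_star classM => h; apply: (seqbnd_class (repr x) _).1 => d d0.
  have d2 : 0 < d ^+ 2 by rewrite exprn_gt0.
  apply: eventually1 ((seqbnd_class _ _).2 h _ d2) => n /=; rewrite nrm_starM => h1.
  have cd : 0 <= c + d by rewrite addr_ge0 // ltW.
  rewrite -(ler_sqr (nrm_ge0 _) cd) (le_trans h1) //.
  have cd2 : 0 <= c * d by rewrite mulr_ge0 // ltW.
  nra.
Qed.

Section InducedMap.
Variable alpha : automorphism A.
Hypothesis alpha_nrm : forall x : A, nrm (alpha x) = nrm x.

Lemma bseq_map_proof (x : bseq) : exists M, forall n, nrm (alpha (x n)) <= M.
Proof. by have [M hM] := bseqP x; exists M => n; rewrite alpha_nrm. Qed.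
Definition bseq_map x := BSeq (bseq_map_proof x).

Definition seqmap (x : seqalg) : seqalg := class (bseq_map (repr x)).

Lemma seqmap_class x : seqmap (class x) = class (bseq_map x).
Proof.
apply/classP; apply: (null_seq_le (M := 1)) (repr_class x) => n /=.
by rewrite -autB alpha_nrm mul1r.
Qed.

Lemma seqmap_zmod_morphism : zmod_morphism seqmap.
Proof.
move=> x y; rewrite -[x]class_repr -[y]class_repr classN classD !seqmap_class classN classD.
by apply: class_ext => n /=; exact: autB.
Qed.
HB.instance Definition _ := GRing.isZmodMorphism.Build seqalg seqalg seqmap seqmap_zmod_morphism.

Lemma seqmapM : {morph seqmap : x y / x * y}.
Proof.
move=> x y; rewrite -[x]class_repr -[y]class_repr classM !seqmap_class classM.
by apply: class_ext => n /=; rewrite autM.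
Qed.

Lemma seqmap_star (x : seqalg) : seqmap (seqalg_star x) = seqalg_star (seqmap x).
Proof.
rewrite -[x]class_repr class_star !seqmap_class class_star.
by apply: class_ext => n /=; rewrite aut_star.
Qed.

Lemma seqmap_scal c : seqmap (seqscal c) = seqscal c.
Proof. by rewrite seqmap_class; apply: class_ext => n /=; rewrite aut_scal. Qed.

Lemma seqmap_bnd (x : seqalg) c : seqbnd x c -> seqbnd (seqmap x) c.
Proof.
move=> h; apply: (seqbnd_class (bseq_map (repr x)) _).1 => d /h.
by apply: eventually1 => n /=; rewrite alpha_nrm.
Qed.

End InducedMap.

Lemma seqmapK (alpha beta : automorphism A)
    (ha : forall x : A, nrm (alpha x) = nrm x) (hb : forall x : A, nrm (beta x) = nrm x) :
  cancel alpha beta -> cancel (seqmap ha) (seqmap hb).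
Proof.
move=> ab x; rewrite -[x in LHS]class_repr !seqmap_class -[RHS]class_repr.
by apply: class_ext => n /=; rewrite ab.
Qed.

End SequenceAlgebra.

(** * Roots of unity and the discrete Fourier transform *)

Section RootsOfUnity.
Variable R : realType.
Local Notation C := R[i].

Lemma conj_real (x : R) : (x%:C)^*%R = x%:C.
Proof. exact: conjc_real. Qed.

Definition cis (x : R) : C := Complex (cos x) (sin x).

Lemma cisD x y : cis (x + y) = cis x * cis y.
Proof.
apply/eqP; rewrite eq_complex /= cosD sinD eqxx /=; apply/eqP; ring.
Qed.

Lemma cis0 : cis 0 = 1.
Proof. by rewrite /cis cos0 sin0. Qed.

Lemma conj_cis x : (cis x)^*%R * cis x = 1.
Proof.
apply/eqP; rewrite eq_complex /=; apply/andP; split; apply/eqP; last by ring.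
by rewrite -[RHS](cos2Dsin2 x); ring.
Qed.

Let lip_le (x y : R) : x <= y -> `|cos y - cos x| <= `|y - x| /\ `|sin y - sin x| <= `|y - x|.
Proof.
move=> xy.
have dc z : z \in `]x, y[ -> is_derive z 1 cos (- sin z) by move=> _; exact: is_derive_cos.
have ds z : z \in `]x, y[ -> is_derive z 1 sin (cos z) by move=> _; exact: is_derive_sin.
have cc : {within `[x, y], continuous (@cos R)}.
  by apply: continuous_subspaceT; exact: continuous_cos.
have cs : {within `[x, y], continuous (@sin R)}.
  by apply: continuous_subspaceT; exact: continuous_sin.
have [c _ ->] := MVT_segment xy dc cc; have [d _ ->] := MVT_segment xy ds cs.
by rewrite !normrM normrN !ler_piMl // ?sin_max ?cos_max.
Qed.

Lemma cis_lipschitz x y : cabs (cis x - cis y) <= 2 * `|x - y|.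
Proof.
have h : `|cos x - cos y| <= `|x - y| /\ `|sin x - sin y| <= `|x - y|.
  have [/lip_le[h1 h2]|/ltW/lip_le[h1 h2]] := leP y x; first by [].
  by rewrite (distrC (cos x)) (distrC (sin x)) (distrC x).
have [h1 h2] := h.
have := @ler_normD _ C (cos x - cos y)%:C ('i * (sin x - sin y)%:C).
rewrite normrM normCi mul1r !cnormE !cabs_real.
rewrite (_ : _ + 'i * _ = cis x - cis y); last first.
  by apply/eqP; rewrite eq_complex /=; apply/andP; split; apply/eqP; ring.
rewrite -rmorphD lecR => h3; lra.
Qed.

Definition zeta n : C := cis (pi *+ 2 / n%:R).

Lemma zetaX n a : zeta n ^+ a = cis (pi *+ 2 / n%:R * a%:R).
Proof.
elim: a => [|a IH]; first by rewrite expr0 mulr0 cis0.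
by rewrite exprSr IH -cisD -natr1 mulrDr mulr1.
Qed.

Lemma zeta_order n : (0 < n)%N -> zeta n ^+ n = 1.
Proof.
move=> n0; rewrite zetaX divfK ?pnatr_eq0 -?lt0n //.
by rewrite /cis cos2pi sin2pi.
Qed.

Lemma zeta_neq1 n l : (0 < l < n)%N -> zeta n ^+ l != 1.
Proof.
move=> /andP[l0 ln]; rewrite zetaX; apply/negP => /eqP h.
have n0 : (0 < n)%N by exact: ltn_trans ln.
pose t : R := pi / n%:R * l%:R.
have tE : pi *+ 2 / n%:R * l%:R = t *+ 2 by rewrite /t -!mulrnAl.
have t0 : 0 < t < pi.
  rewrite /t mulr_gt0 ?divr_gt0 ?pi_gt0 ?ltr0n //=.
  by rewrite mulrAC ltr_pdivrMr ?ltr0n // ltr_pM2l ?pi_gt0 // ltr_nat.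
have := sin_gt0_pi t0.
move: h; rewrite tE /cis cos_mulr2n => -[h _].
by have := cos2Dsin2 t; nra.
Qed.

Lemma zeta_conj n l : (zeta n ^+ l)^*%R * zeta n ^+ l = 1.
Proof. by rewrite zetaX conj_cis. Qed.

Lemma zeta_sum n d : (0 < d < n)%N -> \sum_(l < n) zeta n ^+ (d * l) = 0.
Proof.
move=> dn; have n0 : (0 < n)%N by case/andP: dn => _; exact: leq_ltn_trans.
under eq_bigr => l _ do rewrite exprM.
apply: (@mulfI _ (zeta n ^+ d - 1)); first by rewrite subr_eq0 zeta_neq1.
by rewrite mulr0 -subrX1 -exprM mulnC exprM zeta_order // expr1n subrr.
Qed.

Lemma zeta_orthogonality n (j k : 'I_n) :
  \sum_(l < n) (zeta n ^+ (j * l))^*%R * zeta n ^+ (k * l) = (j == k)%:R * n%:R.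
Proof.
wlog jk : j k / (j <= k)%N => [h|].
  have [/h //|/ltnW/h kj] := leqP j k.
  rewrite eq_sym -[LHS]conjCK rmorph_sum /=.
  under eq_bigr => l _ do rewrite rmorphM /= conjCK mulrC.
  by rewrite kj rmorphM !rmorph_nat.
have [->|jk0] := eqVneq j k.
  under eq_bigr => l _ do rewrite zeta_conj.
  by rewrite sumr_const card_ord mul1r.
have d0 : (0 < k - j < n)%N.
  by rewrite subn_gt0 ltn_neqAle jk0 jk (leq_ltn_trans (leq_subr _ _)).
rewrite mul0r -[RHS](zeta_sum d0); apply: eq_bigr => l _.
by rewrite -{1}(subnKC jk) mulnDl exprD mulrA zeta_conj mul1r.
Qed.

(** The two arguments differ by [2 pi a / (n (n + 1))], at most [2 pi / (n + 1)]
because [a <= n]. *)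
Lemma zeta_close n a : (0 < n)%N -> (a <= n)%N ->
  cabs (zeta n ^+ a - zeta n.+1 ^+ a) <= 4 * pi / n.+1%:R.
Proof.
move=> n0 an; rewrite !zetaX (le_trans (cis_lipschitz _ _)) //.
have n0' : n%:R != 0 :> R by rewrite pnatr_eq0 -lt0n.
have -> : pi *+ 2 / n%:R * a%:R - pi *+ 2 / n.+1%:R * a%:R = 2 * pi / n.+1%:R * (a%:R / n%:R) :> R.
  by rewrite -natr1; field; rewrite n0' natr1 pnatr_eq0.
have p0 : 0 <= 2 * pi / n.+1%:R :> R by rewrite divr_ge0 // mulr_ge0 // pi_ge0.
have q0 : 0 <= a%:R / n%:R :> R by rewrite divr_ge0.
have q1 : a%:R / n%:R <= 1 :> R by rewrite ler_pdivrMr ?ltr0n // mul1r ler_nat.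
rewrite ger0_norm; last by rewrite mulr_ge0.
rewrite (_ : 4 * pi / n.+1%:R = 2 * (2 * pi / n.+1%:R)); last by ring.
by rewrite ler_wpM2l // ler_piMr.
Qed.

End RootsOfUnity.

Section FourierTransform.
Variables (R : realType) (T : pzRingType).
Variables (sg : {rmorphism R[i] -> T}) (st : {additive T -> T}).
Hypothesis ax : star_axioms sg st.

(** The columns [X i] of an isometry from a direct sum of copies of [f]. *)
Definition isometries (I : finType) (f : T) (X : I -> T) :=
  (forall i j, st (X i) * X j = if i == j then f else 0) /\ forall i, X i * f = X i.

Definition fourier n (X : 'I_n -> T) (j : nat) : T :=
  sg (Num.sqrt n%:R)^-1%:C * \sum_(i < n) sg (zeta R n ^+ (j * i)) * X i.

Let sgC := star_sgC ax.
Let stM := star_stM ax.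

Let fourier_mul n (X Y : 'I_n -> T) (s : R[i]) (c d : 'I_n -> R[i]) :
  (sg s * \sum_i sg (c i) * X i) * (sg s * \sum_l sg (d l) * Y l) =
  sg (s * s) * \sum_i \sum_l sg (c i * d l) * (X i * Y l).
Proof.
rewrite -mulrA (mulrA _ (sg s)) -(sgC s) -mulrA mulrA -rmorphM; congr (_ * _).
rewrite mulr_suml; apply: eq_bigr => i _; rewrite mulr_sumr; apply: eq_bigr => l _.
by rewrite rmorphM -!mulrA (mulrA (X i)) -(sgC (d l)) -!mulrA.
Qed.

Let st_fourier n (X : 'I_n -> T) j : st (fourier X j) =
  sg (Num.sqrt n%:R)^-1%:C * \sum_(i < n) sg (zeta R n ^+ (j * i))^*%R * st (X i).
Proof.
rewrite /fourier stM (star_sg ax) raddf_sum /= conj_real -sgC; congr (_ * _).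
by apply: eq_bigr => i _; rewrite stM (star_sg ax) -sgC.
Qed.

Let sqrtn n : (0 < n)%N -> (Num.sqrt n%:R)^-1%:C * (Num.sqrt n%:R)^-1%:C * n%:R = 1 :> R[i].
Proof.
move=> n0; rewrite -rmorphM -(rmorph_nat (real_complex R)) -rmorphM -expr2 exprVn sqr_sqrtr //.
by rewrite mulVf ?pnatr_eq0 -?lt0n // rmorph1.
Qed.

Lemma fourier_isometries n (X : 'I_n -> T) f :
  isometries f X -> isometries f (fun j : 'I_n => fourier X j).
Proof.
move=> [XX Xf]; split=> [j k|j]; last first.
  by rewrite /fourier -mulrA mulr_suml; under eq_bigr => i _ do rewrite -mulrA Xf.
rewrite st_fourier fourier_mul.
have n0 : (0 < n)%N by exact: leq_ltn_trans (ltn_ord j).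
transitivity (sg ((Num.sqrt n%:R)^-1%:C * (Num.sqrt n%:R)^-1%:C *
    \sum_(i < n) (zeta R n ^+ (j * i))^*%R * zeta R n ^+ (k * i)) * f).
  rewrite [in RHS]rmorphM -[in RHS]mulrA rmorph_sum mulr_suml; congr (_ * _); apply: eq_bigr => i _.
  rewrite (bigD1 i) //= big1 ?addr0 => [|l li]; rewrite XX ?eqxx //.
  by rewrite eq_sym (negPf li) mulr0.
rewrite zeta_orthogonality; have [jk|jk] := eqVneq j k.
  by rewrite mul1r sqrtn // rmorph1 mul1r.
by rewrite mul0r mulr0 rmorph0 mul0r.
Qed.

(** The Fourier transform is unitary, so the transformed isometries have the same
total range. *)
Lemma fourier_range n (X : 'I_n -> T) :
  \sum_(j < n) fourier X j * st (fourier X j) = \sum_(i < n) X i * st (X i).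
Proof.
under eq_bigr => j _ do rewrite st_fourier fourier_mul.
rewrite -mulr_sumr exchange_big mulr_sumr; apply: eq_bigr => i _ /=.
have n0 : (0 < n)%N by exact: leq_ltn_trans (ltn_ord i).
rewrite exchange_big (bigD1 i) //= [X in _ + X]big1 ?addr0 => [|l li].
  rewrite -mulr_suml -rmorph_sum mulrA -rmorphM.
  under eq_bigr => j _ do rewrite mulrC (mulnC j).
  by rewrite zeta_orthogonality eqxx mul1r sqrtn // rmorph1 mul1r.
rewrite -mulr_suml -rmorph_sum.
under eq_bigr => j _ do rewrite mulrC (mulnC j i) (mulnC j l).
by rewrite zeta_orthogonality (negPf li) mul0r rmorph0 mul0r.
Qed.

End FourierTransform.

(** * Slow paths of isometries *)

Section Paths.
Variables (R : realType) (T : pzRingType).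
Variables (sg : {rmorphism R[i] -> T}) (st : {additive T -> T}) (bnd : T -> R -> Prop).
Hypothesis ax : star_axioms sg st.
Hypothesis bx : bound_axioms sg st bnd.
Let sgC := star_sgC ax.
Let stM := star_stM ax.
Let stK := star_stK ax.

(** Paths parametrized by all of [nat], constant after [K] steps, so that they can be
cut off at any later time. *)
Definition discrete_path (P : T -> Prop) (d : R) (x y : T) (K : nat) :=
  exists Y : nat -> T, [/\ Y 0%N = x, forall i, (K <= i)%N -> Y i = y,
    forall i, P (Y i) & forall i, bnd (Y i.+1 - Y i) d].

Lemma discrete_path_trans P d x y w K L :
  discrete_path P d x y K -> discrete_path P d y w L -> discrete_path P d x w (K + L).
Proof.
move=> [Y [Y0 YK PY dY]] [Z [Z0 ZL PZ dZ]].
exists (fun i => if (i < K)%N then Y i else Z (i - K)%N); split.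
- case: ltnP => // K0; rewrite sub0n Z0 -Y0 YK //.
- by move=> i hi; rewrite ltnNge (leq_trans (leq_addr _ _) hi) /= ZL // leq_subRL // (leq_trans (leq_addr _ _) hi).
- by move=> i; case: ifP.
move=> i; case: (ltngtP i.+1 K) => [//|hi|hi].
- by rewrite subSn // -ltnS.
- by rewrite hi subnn Z0 -(YK i.+1) ?hi //; rewrite -hi.
Qed.

(* The rational parametrization of the unit circle; it is Lipschitz on [0, 1]. *)
Let cosr (t : R) := (1 - t ^+ 2) / (1 + t ^+ 2).
Let sinr (t : R) := 2 * t / (1 + t ^+ 2).

Let den0 (t : R) : 0 < 1 + t ^+ 2.
Proof. by rewrite ltr_pwDl // sqr_ge0. Qed.

Let cosr2 t : cosr t * cosr t + sinr t * sinr t = 1.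
Proof. by rewrite /cosr /sinr; field; rewrite gt_eqF. Qed.

Let lip (t u : R) : 0 <= t <= 1 -> 0 <= u <= 1 ->
  `|cosr t - cosr u| <= 2 * `|t - u| /\ `|sinr t - sinr u| <= 2 * `|t - u|.
Proof.
move=> /andP[t0 t1] /andP[u0 u1]; have dt := den0 t; have du := den0 u.
have d2 : 0 < (1 + t ^+ 2) * (1 + u ^+ 2) by rewrite mulr_gt0.
have d2' := ltW d2.
have e1 : cosr t - cosr u = 2 * (u - t) * ((t + u) / ((1 + t ^+ 2) * (1 + u ^+ 2))).
  by rewrite /cosr; field; rewrite !gt_eqF.
have e2 : sinr t - sinr u = 2 * (t - u) * ((1 - t * u) / ((1 + t ^+ 2) * (1 + u ^+ 2))).
  by rewrite /sinr; field; rewrite !gt_eqF.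
have tu1 : t * u <= 1 by rewrite mulr_ile1.
have tu0 : 0 <= t * u by rewrite mulr_ge0.
have nD : `|((1 + t ^+ 2) * (1 + u ^+ 2))^-1| = ((1 + t ^+ 2) * (1 + u ^+ 2))^-1.
  by rewrite ger0_norm // invr_ge0.
have p2 : `|2| = 2 :> R by rewrite ger0_norm.
rewrite e1 e2 !normrM nD p2 (distrC u); split.
  rewrite ler_piMr ?mulr_ge0 // ger0_norm ?addr_ge0 // ler_pdivrMr // mul1r.
  have := sqr_ge0 (t - 1); have := sqr_ge0 (u - 1); have := sqr_ge0 (t * u); nra.
rewrite ler_piMr ?mulr_ge0 // ger0_norm ?subr_ge0 // ler_pdivrMr // mul1r.
have := sqr_ge0 t; have := sqr_ge0 u; have := sqr_ge0 (t * u); nra.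
Qed.

(** Turning [x1] into [x2] inside a sum of isometries with orthogonal ranges. *)
Lemma rotation_path (L : T -> Prop) (f g x0 x1 x2 : T) N :
  (forall x y, L x -> L y -> L (x + y)) -> (forall c x, L x -> L (sg c * x)) ->
  L x0 -> L x1 -> L x2 -> bnd g 1 ->
  st x0 * x1 = 0 -> st x0 * x2 = 0 -> st x1 * x2 = 0 ->
  st x1 * x1 = g -> st x2 * x2 = g -> st x0 * x0 + g = f -> (0 < N)%N ->
  discrete_path (fun x => L x /\ st x * x = f) (4 / N%:R) (x0 + x1) (x0 + x2) N.
Proof.
move=> LD LZ L0 L1 L2 bg o01 o02 o12 g1 g2 gf N0.
have NR : 0 < N%:R :> R by rewrite ltr0n.
pose t i : R := (minn i N)%:R / N%:R.
have t01 i : 0 <= t i <= 1.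
  by rewrite divr_ge0 //= ler_pdivrMr // mul1r ler_nat geq_minr.
have st0 x y : st x * y = 0 -> st y * x = 0.
  by move=> h; rewrite -[LHS]stK stM stK h raddf0.
have o10 := st0 _ _ o01; have o20 := st0 _ _ o02; have o21 := st0 _ _ o12.
exists (fun i => x0 + sg (cosr (t i))%:C * x1 + sg (sinr (t i))%:C * x2); split.
- rewrite /t min0n mul0r /cosr /sinr expr0n /= subr0 addr0 mulr0 mul0r divr1.
  by rewrite (rmorph1 sg) (rmorph0 sg) mul1r mul0r addr0.
- move=> i Ni; have -> : t i = 1 by rewrite /t (minn_idPr Ni) divff // gt_eqF.
  rewrite /cosr /sinr expr1n subrr mul0r mulr1 divff ?pnatr_eq0 //.
  by rewrite (rmorph1 sg) (rmorph0 sg) mul1r mul0r addr0.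
- move=> i; split; first exact: (LD _ _ (LD _ _ L0 (LZ _ _ L1)) (LZ _ _ L2)).
  set c := sg (cosr (t i))%:C; set s := sg (sinr (t i))%:C.
  have [cs ss] : st c = c /\ st s = s by rewrite !(star_sg ax) !conj_real.
  have -> : st (x0 + c * x1 + s * x2) = st x0 + c * st x1 + s * st x2.
    by rewrite !raddfD /= !stM cs ss /c /s -!sgC.
  have -> : (st x0 + c * st x1 + s * st x2) * (x0 + c * x1 + s * x2) =
    st x0 * x0 + (st x0 * c) * x1 + (st x0 * s) * x2 +
    (c * (st x1 * x0) + c * ((st x1 * c) * x1) + c * ((st x1 * s) * x2)) +
    (s * (st x2 * x0) + s * ((st x2 * c) * x1) + s * ((st x2 * s) * x2)) by ncring.
  rewrite /c /s -!sgC -/c -/s -!mulrA o01 o02 o10 o12 o20 o21 g1 g2 !mulr0 !addr0 !add0r.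
  rewrite -gf -addrA; congr (_ + _).
  by rewrite !mulrA -mulrDl -!rmorphM -!rmorphD cosr2 !rmorph1 mul1r.
move=> i.
have tt : `|t i.+1 - t i| <= N%:R^-1.
  rewrite -mulrBl normrM ger0_norm ?subr_ge0 ?ler_nat; last by rewrite leq_min geq_minr andbT (leq_trans (geq_minl _ _)).
  rewrite (ger0_norm (x := N%:R^-1)) ?invr_ge0 // ler_piMl ?invr_ge0 // lerBlDr nat1r ler_nat.
  lia.
have [l1 l2] := lip (t01 i.+1) (t01 i).
have b1 x : st x * x = g -> bnd x 1 by move=> xg; apply: (bnd_C bx) => //; rewrite xg expr1n.
have -> : x0 + sg (cosr (t i.+1))%:C * x1 + sg (sinr (t i.+1))%:C * x2 -
    (x0 + sg (cosr (t i))%:C * x1 + sg (sinr (t i))%:C * x2) =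
    sg (cosr (t i.+1) - cosr (t i))%:C * x1 + sg (sinr (t i.+1) - sinr (t i))%:C * x2.
  by rewrite !(rmorphB (real_complex R)) !(rmorphB sg); ncring.
have dN u : `|u| <= 2 * `|t i.+1 - t i| -> cabs u%:C <= 2 / N%:R.
  by move=> h; rewrite cabs_real (le_trans h) // ler_wpM2l.
rewrite (_ : 4 / N%:R = 2 / N%:R * 1 + 2 / N%:R * 1); last by ring.
by apply: (bndD bx); apply: (bndM bx); try exact: b1; apply: (bnd_le bx) (bnd_sg bx _) _; exact: dN.
Qed.

End Paths.

Section Layers.
Variables (R : realType) (T : pzRingType).
Variables (sg : {rmorphism R[i] -> T}) (st : {additive T -> T}) (bnd : T -> R -> Prop).
Hypothesis ax : star_axioms sg st.
Hypothesis bx : bound_axioms sg st bnd.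
Let sgC := star_sgC ax.
Let stM := star_stM ax.
Let stK := star_stK ax.

Variable Z : T -> Prop.
Hypothesis SZ : star_subalg sg st Z.
Variables (e f : T) (z z' : 'I_3 -> T) (q0 q1 q2 a b c : T).

Definition isometry_into x := [/\ Z x, e * x = x & x * f = x].
Definition commutes_with w x := w * x = x * w /\ w * st x = st x * w.

Hypothesis zz : forall i j, st (z i) * z j = if i == j then f else 0.
Hypothesis zz' : forall i j, st (z' i) * z' j = if i == j then f else 0.
Hypothesis ez : forall i, isometry_into (z i).
Hypothesis ez' : forall i, isometry_into (z' i).
Hypothesis fp : sproj st f.
Hypothesis q0p : sproj st q0.
Hypothesis q1p : sproj st q1.
Hypothesis q2p : sproj st q2.
Hypothesis q01 : q0 * q1 = 0.
Hypothesis q02 : q0 * q2 = 0.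
Hypothesis q12 : q1 * q2 = 0.
Hypothesis qsum : q0 + q1 + q2 = 1.
Hypothesis aa : [/\ st a * a = q1, q0 * a = a & a * q1 = a].
Hypothesis bb : [/\ st b * b = q2, q0 * b = b & b * q2 = b].
Hypothesis cc : [/\ st c * c = q0, q1 * c = c & c * q0 = c].

(** The [w] that behave like the second factor of a tensor product in which the [z i]
and the [z' i] live in the first: a term [w * z i * q] is a copy of [z i] on the
piece [q], carried along [w]. *)
Definition layer_symbol w :=
  [/\ Z w, e * w = w * e, forall i, commutes_with w (z i) & forall i, commutes_with w (z' i)].
Hypothesis Lq0 : layer_symbol q0.
Hypothesis Lq1 : layer_symbol q1.
Hypothesis Lq2 : layer_symbol q2.
Hypothesis La : layer_symbol a.
Hypothesis Lb : layer_symbol b.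
Hypothesis Lc : layer_symbol c.

Let Lmul v w : layer_symbol v -> layer_symbol w -> layer_symbol (v * w).
Proof.
move=> [Zv ev vz vz'] [Zw ew wz wz']; split.
- exact: (ssubM SZ).
- by rewrite mulrA ev -mulrA ew mulrA.
- move=> i; have [v1 v2] := vz i; have [w1 w2] := wz i.
  by split; rewrite -mulrA ?w1 ?w2 mulrA ?v1 ?v2 -mulrA.
- move=> i; have [v1 v2] := vz' i; have [w1 w2] := wz' i.
  by split; rewrite -mulrA ?w1 ?w2 mulrA ?v1 ?v2 -mulrA.
Qed.

Let L1 : layer_symbol 1.
Proof. by split; rewrite ?mul1r ?mulr1 //; [exact: (ssub1 SZ)|move=> i; split..]; rewrite mul1r mulr1. Qed.

Let Cst w x : commutes_with w x -> commutes_with (st w) x.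
Proof.
move=> [h1 h2]; split; first by rewrite -{1}[x]stK -stM -h2 stM stK.
by rewrite -stM -h1 stM.
Qed.

Let cross w w' q q' x y : commutes_with q x -> commutes_with w y -> commutes_with w' y ->
  commutes_with q y -> st (w * x * q) * (w' * y * q') = st x * y * (st q * (st w * w') * q').
Proof.
move=> qx /Cst[wy _] [w'y _] /Cst[qy _]; have [_ qx'] := Cst qx.
rewrite !stM !mulrA; congr (_ * _).
rewrite -!mulrA w'y (mulrA (st w)) wy !mulrA -[_ * y * st q]mulrA -qy !mulrA qx'.
by [].
Qed.

Let into_D x y : isometry_into x -> isometry_into y -> isometry_into (x + y).
Proof.
move=> [Zx ex xf] [Zy ey yf]; split; [exact: (ssubD SZ)|by rewrite mulrDr ex ey|].
by rewrite mulrDl xf yf.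
Qed.

Let into_Z k x : isometry_into x -> isometry_into (sg k * x).
Proof.
move=> [Zx ex xf]; split; first exact: (ssubZ SZ).
  by rewrite mulrA -sgC -mulrA ex.
by rewrite -mulrA xf.
Qed.

Let into_term w x q : layer_symbol w -> layer_symbol q -> q * f = f * q ->
  isometry_into x -> isometry_into (w * x * q).
Proof.
move=> [Zw ew _ _] [Zq eq _ _] qf [Zx ex xf]; split.
- by do 2?apply: (ssubM SZ).
- by rewrite !mulrA ew -(mulrA w) ex.
- by rewrite -mulrA qf mulrA -(mulrA w) xf.
Qed.

Let comm_f q : layer_symbol q -> q * f = f * q.
Proof.
move=> [_ _ /(_ ord0) [h1 h2] _]; have := zz ord0 ord0; rewrite eqxx => <-.
by rewrite mulrA h2 -mulrA h1 mulrA.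
Qed.

(** Between [z 0] and [z' 0] no rotation is possible at once, because their ranges
need not be orthogonal. The projections [q0], [q1], [q2], which commute with
everything, give room: first everything is moved under [q0], in place of [z] by
means of three orthogonal copies; the part under [q1] is then free to receive
everything, arranged as for [z']; finally the pieces are put in their place. *)
Lemma layered_path N : (0 < N)%N ->
  discrete_path bnd (fun x => isometry_into x /\ st x * x = f) (4 / N%:R)
    (z 0) (z' 0) (N + (N + N)).
Proof.
move=> N0; have [a1 a2 a3] := aa; have [b1 b2 b3] := bb; have [c1 c2 c3] := cc.
have Lcb := Lmul Lc Lb.
have Cz w i : layer_symbol w -> commutes_with w (z i) by case.
have Cz' w i : layer_symbol w -> commutes_with w (z' i) by case.
have X w w' q q' i j : layer_symbol w -> layer_symbol w' -> layer_symbol q ->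
    st (w * z i * q) * (w' * z j * q') = (if i == j then f else 0) * (st q * (st w * w') * q').
  by move=> Lw Lw' Lq; rewrite -zz; apply: cross; exact: Cz.
have X' w w' q q' i j : layer_symbol w -> layer_symbol w' -> layer_symbol q ->
    st (w * z' i * q) * (w' * z' j * q') = (if i == j then f else 0) * (st q * (st w * w') * q').
  by move=> Lw Lw' Lq; rewrite -zz'; apply: cross; exact: Cz'.
have [q00 q0s] := q0p; have [q11 q1s] := q1p; have [q22 q2s] := q2p.
have adj0 x y : st x = x -> st y = y -> x * y = 0 -> y * x = 0.
  by move=> xs ys xy; rewrite -[LHS]stK stM xs ys xy raddf0.
have q10 := adj0 _ _ q0s q1s q01; have q20 := adj0 _ _ q0s q2s q02.
have q21 := adj0 _ _ q1s q2s q12.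
have st1 : st 1 = 1 := star_st1 ax.
have term w i q : layer_symbol w -> layer_symbol q -> isometry_into (w * z i * q).
  by move=> Lw Lq; apply: into_term => //; exact: comm_f.
have term' w i q : layer_symbol w -> layer_symbol q -> isometry_into (w * z' i * q).
  by move=> Lw Lq; apply: into_term => //; exact: comm_f.
have bf : bnd f 1 by exact: (bnd_sproj ax bx).
have bfq q : sproj st q -> bnd (f * q) 1.
  by move=> sq; rewrite -[1]mulr1; apply: (bndM bx) => //; exact: (bnd_sproj ax bx).
have s12 : sproj st (q1 + q2).
  split; last by rewrite raddfD /= q1s q2s.
  by rewrite mulrDl !mulrDr q11 q12 q21 q22 addr0 add0r.
have s02 : sproj st (q0 + q2).
  split; last by rewrite raddfD /= q0s q2s.
  by rewrite mulrDl !mulrDr q00 q02 q20 q22 addr0 add0r.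
(* In [Y1] the pieces of [z 0] on [q0], [q1], [q2] are all carried below [q0], kept
orthogonal by the use of different copies; in [Y2] those of [z' 0] lie below [q1]. *)
pose Y1 := 1 * z 0 * q0 + (a * z 1 * q1 + b * z 2 * q2).
pose Y2 := 1 * z' 0 * q1 + (c * z' 1 * q0 + c * b * z' 2 * q2).
have ba : st b * b = q2 := b1.
have cbcb : st (c * b) * (c * b) = q2.
  by rewrite stM mulrA -(mulrA (st b)) c1 -mulrA b2 b1.
have path1 : discrete_path bnd (fun x => isometry_into x /\ st x * x = f) (4 / N%:R) (z 0) Y1 N.
  have -> : z 0 = 1 * z 0 * q0 + (1 * z 0 * q1 + 1 * z 0 * q2).
    by rewrite !mul1r -!mulrDr addrA qsum mulr1.
  apply: (rotation_path ax bx into_D into_Z (g := f * (q1 + q2))) => //.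
  - exact: term.
  - by apply: into_D; exact: term.
  - by apply: into_D; exact: term.
  - exact: bfq.
  - by rewrite mulrDr !X // q0s st1 mul1r !mulr1 q01 q02 !mulr0 addr0.
  - by rewrite mulrDr !X // !mul0r addr0.
  - by rewrite raddfD /= mulrDl !mulrDr !X // !mul0r !addr0.
  - by rewrite raddfD /= mulrDl !mulrDr !X // q1s q2s st1 mul1r !mulr1 q11 q12 q21 q22 !mulr0 addr0 add0r.
  - rewrite raddfD /= mulrDl !mulrDr !X // !mul0r addr0 add0r q1s q2s a1 b1.
    by rewrite !q11 !q22.
  - by rewrite X // q0s st1 mul1r mulr1 q00 -!mulrDr addrA qsum mulr1.
have i0 : isometry_into 0.
  by split; rewrite ?mulr0 ?mul0r //; exact: (sub0 SZ).
have iY1 : isometry_into Y1.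
  by apply: into_D; [exact: term|apply: into_D; exact: term].
have iY2 : isometry_into Y2.
  by apply: into_D; [exact: term'|apply: into_D; exact: term'].
have path2 : discrete_path bnd (fun x => isometry_into x /\ st x * x = f) (4 / N%:R) Y1 Y2 N.
  rewrite -[Y1]add0r -[Y2]add0r.
  apply: (rotation_path ax bx into_D into_Z (g := f)) => //; rewrite ?raddf0 ?mul0r ?mulr0 ?add0r //.
  - have e1 : q0 * Y1 = Y1.
      rewrite /Y1 !mulrDr !mulrA mulr1 a2 b2 mul1r; congr (_ + _).
      by have [_ _ /(_ 0) [-> _] _] := Lq0; rewrite -mulrA q00.
    have e2 : q1 * Y2 = Y2.
      rewrite /Y2 !mulrDr !mulrA mulr1 c2 mul1r; congr (_ + _).
      by have [_ _ _ /(_ 0) [-> _]] := Lq1; rewrite -mulrA q11.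
    by rewrite -e1 -e2 stM q0s mulrA -(mulrA (st Y1)) q01 mulr0 mul0r.
  - rewrite /Y1 !raddfD /= !mulrDl !mulrDr !X // !mul0r !addr0 !add0r q0s q1s q2s st1 mul1r mulr1 a1 b1.
    by rewrite q00 q11 q11 q22 q22 -!mulrDr addrA qsum mulr1.
  - rewrite /Y2 !raddfD /= !mulrDl !mulrDr !X' // !mul0r !addr0 !add0r q0s q1s q2s st1 mul1r mulr1 c1 cbcb.
    by rewrite q00 q00 q11 q22 q22 -!mulrDr addrA (addrC q1) qsum mulr1.
have path3 : discrete_path bnd (fun x => isometry_into x /\ st x * x = f) (4 / N%:R) Y2 (z' 0) N.
  have -> : z' 0 = 1 * z' 0 * q1 + (1 * z' 0 * q0 + 1 * z' 0 * q2).
    by rewrite !mul1r -!mulrDr addrA (addrC q1) qsum mulr1.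
  apply: (rotation_path ax bx into_D into_Z (g := f * (q0 + q2))) => //.
  - exact: term'.
  - by apply: into_D; exact: term'.
  - by apply: into_D; exact: term'.
  - exact: bfq.
  - by rewrite mulrDr !X' // !mul0r addr0.
  - by rewrite mulrDr !X' // q1s st1 mul1r !mulr1 q10 q12 !mulr0 addr0.
  - by rewrite raddfD /= mulrDl !mulrDr !X' // !mul0r !addr0.
  - rewrite raddfD /= mulrDl !mulrDr !X' // !mul0r addr0 add0r q0s q2s c1 cbcb.
    by rewrite !q00 !q22.
  - by rewrite raddfD /= mulrDl !mulrDr !X' // q0s q2s st1 mul1r !mulr1 q00 q02 q20 q22 !mulr0 addr0 add0r.
  - by rewrite X' // q1s st1 mul1r mulr1 q11 -!mulrDr addrA (addrC q1) qsum mulr1.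
exact: discrete_path_trans path1 (discrete_path_trans path2 path3).
Qed.

End Layers.

(** * Sums over residue classes *)

Section ResidueSums.
Variables (R : realType) (T : pzRingType).
Variables (sg : {rmorphism R[i] -> T}) (st : {additive T -> T}) (bnd : T -> R -> Prop).
Hypothesis ax : star_axioms sg st.
Hypothesis bx : bound_axioms sg st bnd.
Let sgC := star_sgC ax.
Let stM := star_stM ax.
Let stK := star_stK ax.

Definition orthogonal_projections (n : nat) (p : nat -> T) :=
  (forall i, (i < n)%N -> sproj st (p i)) /\
  (forall i j, (i < n)%N -> (j < n)%N -> i != j -> p i * p j = 0).

Definition residue_sum n k (p : nat -> T) r := \sum_(i < n | (i %% k == r %% k)%N) p i.

Section Orthogonal.
Variables (n k : nat) (p : nat -> T).
Hypothesis op : orthogonal_projections n p.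

Lemma residue_sumM (r s : nat) : residue_sum n k p r * residue_sum n k p s =
  if (r %% k == s %% k)%N then residue_sum n k p r else 0.
Proof.
have [pp po] := op; rewrite /residue_sum mulr_suml.
have E (i : 'I_n) : p i * residue_sum n k p s = if (i %% k == s %% k)%N then p i else 0.
  rewrite /residue_sum mulr_sumr big_mkcond (bigD1 i) //= big1 ?addr0 => [|j ji].
    by case: ifP => //; case: (pp i).
  by case: ifP => // _; rewrite po // eq_sym.
under eq_bigr => i _ do rewrite E.
case: ifP => rs; first by apply: eq_bigr => i /eqP ->; rewrite rs.
by apply: big1 => i /eqP ->; rewrite rs.
Qed.

Lemma residue_sum_sproj r : sproj st (residue_sum n k p r).
Proof.
split; first by rewrite residue_sumM eqxx.
by rewrite raddf_sum; apply: eq_bigr => i _; case: (op.1 i).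
Qed.

Lemma residue_sum_total : (0 < k)%N -> \sum_(r < k) residue_sum n k p r = \sum_(i < n) p i.
Proof.
move=> k0; pose h (i : 'I_n) : 'I_k := Ordinal (ltn_pmod i k0).
rewrite [RHS](partition_big h predT) //=; apply: eq_bigr => r _.
by apply: eq_bigl => i; rewrite -val_eqE /= (modn_small (ltn_ord r)).
Qed.

End Orthogonal.

Lemma residue_sum_mod n k p r : residue_sum n k p (r %% k) = residue_sum n k p r.
Proof. by rewrite /residue_sum modn_mod. Qed.

(** Here the cyclic order is used: [k] divides [n] and [p n = p 0], so the shift by
one permutes the residue classes also across the end. *)
Lemma residue_sum_shift n k p r : (k %| n)%N -> p n = p 0%N ->
  \sum_(i < n | (i %% k == r %% k)%N) p i.+1 = residue_sum n k p r.+1.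
Proof.
move=> kn pn; rewrite /residue_sum [LHS]big_mkcond [RHS]big_mkcond /=.
pose F i := if (i %% k == r.+1 %% k)%N then p i else 0.
have FS i : (if (i %% k == r %% k)%N then p i.+1 else 0) = F i.+1.
  by rewrite /F -[i.+1]addn1 -[r.+1]addn1 eqn_modDr.
under eq_bigr => i _ do rewrite FS.
have Fn : F n = F 0%N by rewrite /F pn (eqP kn) mod0n.
case: n kn pn Fn => [|n] kn pn Fn; first by rewrite !big_ord0.
by rewrite big_ord_recr /= Fn [RHS]big_ord_recl addrC.
Qed.

Lemma isometries_projections n f (X : nat -> T) :
  isometries st f (fun i : 'I_n => X i) -> orthogonal_projections n (fun i => X i * st (X i)).
Proof.
move=> [XX Xf]; split=> [i hi|i j hi hj ij].
  have := XX (Ordinal hi) (Ordinal hi); rewrite eqxx /= => h.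
  split; last by rewrite stM stK.
  by rewrite mulrA -(mulrA (X i)) h (Xf (Ordinal hi)).
have := XX (Ordinal hi) (Ordinal hj); rewrite -val_eqE /= (negPf ij) => h.
by rewrite mulrA -(mulrA (X i)) h mulr0 mul0r.
Qed.

Variable beta : {additive T -> T}.
Hypothesis betaM : {morph beta : x y / x * y}.
Hypothesis beta_st : forall x, beta (st x) = st (beta x).

Lemma sproj_morph p : sproj st p -> sproj st (beta p).
Proof. by move=> [pp ps]; split; rewrite -?betaM ?pp // -beta_st ps. Qed.

Lemma conjugation_close u x d : bnd (u - 1) d -> bnd x 1 -> bnd (u * x * st u - x) (2 * d + d ^+ 2).
Proof.
move=> hu hx; have hs : bnd (st (u - 1)) d by exact: (bnd_st bx).
have -> : u * x * st u - x = (u - 1) * x + x * st (u - 1) + (u - 1) * x * st (u - 1).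
  by rewrite raddfB /= (star_st1 ax); ncring.
rewrite (_ : 2 * d + d ^+ 2 = d * 1 + 1 * d + d * 1 * d); last by ring.
by do ?[apply: (bndD bx)|apply: (bndM bx)].
Qed.

(** [beta], corrected by a [u] close to 1, shifts the isometries [X i] cyclically. *)
Lemma cyclic_residue_sum n k f (X : nat -> T) u d r : (k %| n)%N ->
  isometries st f (fun i : 'I_n => X i) -> X n = X 0%N ->
  (forall i, (i < n)%N -> u * beta (X i) = X i.+1) -> bnd (u - 1) d ->
  bnd (beta (residue_sum n k (fun i => X i * st (X i)) r) -
       residue_sum n k (fun i => X i * st (X i)) r.+1) (2 * d + d ^+ 2).
Proof.
move=> kn iX Xn uX bu; rewrite -opprB; apply: (bndN bx).
set y := residue_sum _ _ _ r; have sy : sproj st y.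
  by apply: residue_sum_sproj; exact: isometries_projections iX.
suff -> : residue_sum n k (fun i => X i * st (X i)) r.+1 = u * beta y * st u.
  by apply: conjugation_close bu _; apply: (bnd_sproj ax bx); exact: sproj_morph.
rewrite -residue_sum_shift ?Xn // raddf_sum mulr_sumr mulr_suml /=.
apply: eq_bigr => i _; rewrite betaM beta_st mulrA -(mulrA (u * _)) -stM.
by rewrite uX.
Qed.

End ResidueSums.

(** * Two cyclic towers out of one stack *)

Section Towers.
Variables (R : realType) (T : pzRingType).
Variables (sg : {rmorphism R[i] -> T}) (st : {additive T -> T}) (bnd : T -> R -> Prop).
Hypothesis ax : star_axioms sg st.
Hypothesis bx : bound_axioms sg st bnd.
Let sgC := star_sgC ax.
Let stM := star_stM ax.
Let stK := star_stK ax.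

Variable beta : {additive T -> T}.
Hypothesis betaM : {morph beta : x y / x * y}.
Hypothesis beta_st : forall x, beta (st x) = st (beta x).
Hypothesis beta_sg : forall c, beta (sg c) = sg c.
Hypothesis beta_bnd : forall x c, bnd x c -> bnd (beta x) c.
Variable Z : T -> Prop.
Hypothesis SZ : star_subalg sg st Z.
Hypothesis Zbeta : forall x, Z x -> Z (beta x).

Variables (m : nat) (e : T).
Hypothesis m0 : (0 < m)%N.
Hypothesis Ze : Z e.
Hypothesis pe : sproj st e.
Let E i := iter i beta e.
Hypothesis Em : E m = e.
Hypothesis Eo : forall i j, (i < m)%N -> (j < m)%N -> i != j -> E i * E j = 0.
Let f := 1 - \sum_(i < m) E i.

Variables (Y : nat -> T) (d : R).
Hypothesis iY : forall i, isometry_into Z e f (Y i) /\ st (Y i) * Y i = f.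
Hypothesis dY : forall i, bnd (Y i.+1 - Y i) d.
Hypothesis Ym : iter m beta (Y m) = Y 0%N.

Let iterM i x y : iter i beta (x * y) = iter i beta x * iter i beta y.
Proof. by elim: i => //= i ->; rewrite betaM. Qed.
Let iterB i x y : iter i beta (x - y) = iter i beta x - iter i beta y.
Proof. by elim: i => //= i ->; rewrite raddfB. Qed.
Let iter_st i x : iter i beta (st x) = st (iter i beta x).
Proof. by elim: i => //= i ->; rewrite beta_st. Qed.
Let iter_bnd i x c : bnd x c -> bnd (iter i beta x) c.
Proof. by move=> h; elim: i => //= i; exact: beta_bnd. Qed.
Let iterZ i x : Z x -> Z (iter i beta x).
Proof. by move=> h; elim: i => //= i; exact: Zbeta. Qed.
Let beta1 : beta 1 = 1.
Proof. by rewrite -(rmorph1 sg) beta_sg. Qed.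

Let sum_shift (F : nat -> T) : F m = F 0%N -> \sum_(i < m) F i.+1 = \sum_(i < m) F i.
Proof.
case: m => [|n] Fn; first by rewrite !big_ord0.
by rewrite big_ord_recr /= Fn [RHS]big_ord_recl addrC.
Qed.

Let pE i : sproj st (E i).
Proof. by elim: i => [//|i IH]; exact: sproj_morph. Qed.

Let beta_f : beta f = f.
Proof. by rewrite raddfB raddf_sum /= beta1 (sum_shift (F := E)). Qed.

Let iter_f i : iter i beta f = f.
Proof. by elim: i => //= i ->; exact: beta_f. Qed.

Let Ef i : (i < m)%N -> E i * f = 0.
Proof.
move=> im; rewrite mulrBr mulr1 mulr_sumr (bigD1 (Ordinal im)) //= big1 ?addr0.
  by case: (pE i) => -> _; rewrite subrr.
by move=> j ji; rewrite Eo // eq_sym.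
Qed.

Let st_f : st f = f.
Proof.
rewrite raddfB (star_st1 ax) raddf_sum; congr (_ - _).
by apply: eq_bigr => i _; case: (pE i).
Qed.

Let pf : sproj st f.
Proof.
split=> //; rewrite {1}/f mulrBl mul1r mulr_suml big1 ?subr0 // => i _.
exact: Ef.
Qed.

Let fE i : (i < m)%N -> f * E i = 0.
Proof.
by move=> im; rewrite -[LHS]stK stM st_f; case: (pE i) => _ ->; rewrite Ef // raddf0.
Qed.

Let V i := iter i beta (Y i).

Let Vm : V m = V 0%N. Proof. exact: Ym. Qed.
Let VV i : st (V i) * V i = f.
Proof. by rewrite -iter_st -iterM (iY i).2 iter_f. Qed.
Let EV i : E i * V i = V i.
Proof. by rewrite -iterM; case: (iY i) => [[_ -> _] _]. Qed.
Let Vf i : V i * f = V i.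
Proof. by rewrite -{1}(iter_f i) -iterM; case: (iY i) => [[_ _ ->] _]. Qed.
Let VE i : st (V i) * E i = st (V i).
Proof. by have := congr1 st (EV i); rewrite stM; case: (pE i) => _ ->. Qed.
Let VVo i j : (i < m)%N -> (j < m)%N -> i != j -> st (V i) * V j = 0.
Proof. by move=> im jm ij; rewrite -VE -(EV j) mulrA -(mulrA _ (E i)) Eo // mulr0 mul0r. Qed.
Let fV i : (i < m)%N -> f * V i = 0.
Proof. by move=> im; rewrite -EV mulrA fE // mul0r. Qed.
Let stVf i : (i < m)%N -> st (V i) * f = 0.
Proof. by move=> im; rewrite -[LHS]stK stM stK st_f fV // raddf0. Qed.
Let ZV i : Z (V i).
Proof. by apply: iterZ; case: (iY i) => [[]]. Qed.

Let iV : isometries st f (fun i : 'I_m => V i).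
Proof.
split=> [i j|i]; last exact: Vf.
case: eqP => [->|/eqP ij]; first exact: VV.
by apply: VVo; rewrite // -val_eqE.
Qed.

(** [U * beta] carries each [V i] exactly to [V i.+1]; [D i] is the defect of [beta]
alone. *)
Let D i := V i.+1 - beta (V i).
Let G := \sum_(i < m) D i * st (beta (V i)).
Let U := 1 + G.

Let bnd_V i : bnd (V i) 1.
Proof. by apply: (bnd_C bx) => //; rewrite VV expr1n; exact: (bnd_sproj ax bx). Qed.

Let ED i : E i.+1 * D i = D i.
Proof. by rewrite mulrBr EV /E iterS -betaM EV. Qed.

Let DE i : st (D i) * E i.+1 = st (D i).
Proof. by rewrite -{2}(ED i) stM; case: (pE i.+1) => _ ->. Qed.

(** The terms of [G] live under the orthogonal projections [E i.+1]; hence [G] is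
as small as one step of the path [Y], independently of [m]. *)
Let bnd_G : bnd G d.
Proof.
have d0 : 0 <= d by exact: (bnd_ge0 bx (dY 0)).
have EE (i j : 'I_m) : i != j -> E i.+1 * E j.+1 = 0.
  by move=> ij; rewrite /E !iterS -betaM -/(E i) -/(E j) Eo ?raddf0.
apply: (bnd_orthogonal_sum ax bx) => // [i j ij|i]; last first.
  rewrite -[d]mulr1; apply: (bndM bx).
    by rewrite /D /V -iterS -iterB; exact: iter_bnd.
  by apply: (bnd_st bx); apply: beta_bnd; exact: bnd_V.
split.
  have DD : st (D i) * D j = 0.
    by rewrite -(DE i) -(ED j) mulrA -(mulrA _ (E i.+1)) EE // mulr0 mul0r.
  by rewrite stM stK -mulrA (mulrA (st (D i))) DD mul0r mulr0.
rewrite stM stK -mulrA (mulrA (st _)) -beta_st -betaM VVo ?raddf0 ?mul0r ?mulr0 //.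
Qed.

Let UV i : (i < m)%N -> U * beta (V i) = V i.+1.
Proof.
move=> im; rewrite mulrDl mul1r mulr_suml (bigD1 (Ordinal im)) //= big1 => [|j ji].
  rewrite addr0 -mulrA -beta_st -betaM VV beta_f mulrBl -[in beta (V i) * f]beta_f -betaM !Vf.
  by rewrite addrC subrK.
by rewrite -mulrA -beta_st -betaM VVo ?raddf0 ?mulr0.
Qed.

Let Uf : U * f = f.
Proof.
rewrite mulrDl mul1r mulr_suml big1 ?addr0 // => j _.
by rewrite -mulrA -{1}beta_f -beta_st -betaM stVf // raddf0 mulr0.
Qed.

Let bnd_U : bnd (U - 1) d.
Proof. by rewrite /U addrC addKr. Qed.

Let zm := zeta R m.
Let zn := zeta R m.+1.
Let d2 : R := 4 * pi / m.+1%:R.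

(** Eigenvectors of [U * beta]: the Fourier transforms of the [V i] for the [m]-th
roots of unity, and [f], which [U * beta] fixes. *)
Let W l := if (l < m)%N then fourier sg (fun i : 'I_m => V i) l else f.

Let UW l : (l <= m)%N -> U * beta (W l) = sg (zm ^+ l)^*%R * W l.
Proof.
rewrite leq_eqVlt /W => /orP[/eqP ->|lm].
  by rewrite ltnn beta_f Uf /zm zeta_order // rmorph1 (rmorph1 sg) mul1r.
rewrite lm /fourier betaM beta_sg mulrA -sgC -mulrA [RHS]mulrA -(sgC _ (sg _)) -[RHS]mulrA.
congr (_ * _); rewrite raddf_sum !mulr_sumr.
pose F i := sg ((zm ^+ l)^*%R * zm ^+ (l * i)) * V i.
have Fm : F m = F 0%N by rewrite /F Vm muln0 mulnC exprM /zm zeta_order // expr1n expr0.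
transitivity (\sum_(i < m) F i.+1).
  apply: eq_bigr => i _ /=; rewrite betaM beta_sg mulrA -sgC -mulrA UV // /F.
  by rewrite mulnS exprD mulrA zeta_conj mul1r.
by rewrite (sum_shift Fm); apply: eq_bigr => i _; rewrite /F rmorphM mulrA.
Qed.

Let iW : isometries st f (fun l : 'I_m.+1 => W l).
Proof.
have [FF Ff] := fourier_isometries ax iV.
have fW l : (l < m)%N -> f * W l = 0.
  move=> lm; rewrite /W lm mulrA -sgC -mulrA mulr_sumr big1 ?mulr0 // => i _.
  by rewrite mulrA -sgC -mulrA fV // mulr0.
have stW l : (l < m)%N -> st (W l) * f = 0.
  by move=> lm; have := congr1 st (fW l lm); rewrite stM st_f raddf0.
split=> [i j|i]; rewrite /W; last by case: ifP => im; [exact: (Ff (Ordinal im))|case: pf].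
case: (ltnP i m) => im; case: (ltnP j m) => jm.
- by have := FF (Ordinal im) (Ordinal jm); rewrite -!val_eqE.
- have := stW _ im; rewrite /W im => ->; case: eqP => // ij.
  by move: im; rewrite ij ltnNge jm.
- have := fW _ jm; rewrite /W jm st_f => ->.
  by case: eqP => // ij; move: jm; rewrite -ij ltnNge im.
- have -> : i = j by apply: val_inj; apply/eqP; rewrite eqn_leq !(leq_trans _ im, leq_trans _ jm) //= -ltnS.
  by rewrite eqxx st_f; case: pf.
Qed.

(** [U2] moves the eigenvalues of [U beta], which are the [m]-th roots of unity
and once more 1 for [f], onto the [m.+1]-st roots of unity. *)
Let H := \sum_(l < m.+1) sg ((zn ^+ l)^*%R * zm ^+ l - 1) * (W l * st (W l)).
Let U2 := 1 + H.

Let oW := isometries_projections ax iW.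

Let bnd_H : bnd H d2.
Proof.
have d20 : 0 <= d2 by rewrite divr_ge0 // mulr_ge0 // pi_ge0.
have [pW orW] := oW.
have key (c k : R[i]) (x y : T) : x * y = 0 -> (sg c * x) * (sg k * y) = 0.
  by move=> xy; rewrite -mulrA (mulrA x) -(sgC k x) -(mulrA (sg k)) xy !mulr0.
apply: (bnd_orthogonal_sum ax bx) => // [i j ij|i].
  have sx (l : 'I_m.+1) (c : R[i]) : st (sg c * (W l * st (W l))) = sg c^*%R * (W l * st (W l)).
    by rewrite !stM stK (star_sg ax) sgC.
  by rewrite !sx; split; apply: key; exact: orW.
rewrite -[d2]mulr1; apply: (bndM bx); last by apply: (bnd_sproj ax bx); exact: pW.
apply: (bnd_le bx (bnd_sg bx _)).
have -> : (zn ^+ i)^*%R * zm ^+ i - 1 = (zn ^+ i)^*%R * (zm ^+ i - zn ^+ i).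
  by rewrite mulrBr zeta_conj.
rewrite -lecR -cnormE normrM norm_conjC.
have -> : `|zn ^+ i| = 1.
  apply/eqP; rewrite -(@eqrXn2 _ 2) // expr1n normCK mulrC; apply/eqP.
  exact: zeta_conj.
by rewrite mul1r cnormE lecR; apply: zeta_close => //; rewrite -ltnS.
Qed.

Let U2W l : (l <= m)%N -> U2 * W l = sg ((zn ^+ l)^*%R * zm ^+ l) * W l.
Proof.
move=> lm; have [WW Wf] := iW.
have lm' : (l < m.+1)%N by rewrite ltnS.
rewrite mulrDl mul1r mulr_suml (bigD1 (Ordinal lm')) //= big1 => [|j jl].
  rewrite addr0 -!mulrA (WW (Ordinal lm') (Ordinal lm')) eqxx (Wf (Ordinal lm')) /=.
  by rewrite rmorphB (rmorph1 sg) mulrBl mul1r addrC subrK.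
by rewrite -!mulrA (WW j (Ordinal lm')) (negPf jl) !mulr0.
Qed.

Let Psi := U2 * U.

Let bnd_Psi : bnd (Psi - 1) (d + d2 + d2 * d).
Proof.
have -> : Psi - 1 = G + H + H * G by rewrite /Psi /U2 /U; ncring.
by apply: (bndD bx); [exact: (bndD bx)|exact: (bndM bx)].
Qed.

Let PsiW l : (l <= m)%N -> Psi * beta (W l) = sg (zn ^+ l)^*%R * W l.
Proof.
move=> lm; rewrite -mulrA UW // mulrA -sgC -mulrA U2W // mulrA -rmorphM.
by congr (sg _ * _); rewrite mulrCA zeta_conj mulr1.
Qed.

(** The inverse transform of the [W l], now of length [m.+1], is shifted cyclically by
[Psi * beta]. The frequency is [m - j] modulo [m.+1], decreasing because [Psi * beta]
multiplies [W l] by a conjugate root of unity; its representative is such that the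
truncated subtraction is exact up to [j = m.+1]. *)
Let b j := fourier sg (fun l : 'I_m.+1 => W l) (m + (m.+1 - j)).

Let bper : b m.+1 = b 0%N.
Proof.
rewrite /b subnn subn0 addn0 /fourier; congr (_ * _); apply: eq_bigr => l _.
by rewrite mulnDl exprD [(m.+1 * l)%N]mulnC [zeta R m.+1 ^+ (l * _)]exprM -/zn mulnC; rewrite
  [_ ^+ l ^+ m.+1]exprAC zeta_order // expr1n mulr1 mulnC.
Qed.

Let Psib j : (j < m.+1)%N -> Psi * beta (b j) = b j.+1.
Proof.
move=> jm; rewrite /b /fourier betaM beta_sg mulrA -sgC -mulrA; congr (_ * _).
rewrite raddf_sum mulr_sumr; apply: eq_bigr => l _ /=.
have lm : (l <= m)%N by rewrite -ltnS.
rewrite betaM beta_sg mulrA -sgC -mulrA PsiW // mulrA -rmorphM; congr (sg _ * _).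
rewrite subSS subSn // addnS mulSn exprD mulrC mulrA zeta_conj mul1r //.
Qed.

Let bE (j : 'I_m.+1) : b j = fourier sg (fun l : 'I_m.+1 => W l) (rev_ord j).
Proof.
rewrite /b /fourier; congr (_ * _); apply: eq_bigr => l _; congr (sg _ * _).
have -> : (m + (m.+1 - j) = m.+1 + rev_ord j)%N by rewrite /=; have := ltn_ord j; lia.
by rewrite mulnDl exprD exprM zeta_order // expr1n mul1r.
Qed.

Let ib : isometries st f (fun j : 'I_m.+1 => b j).
Proof.
have [FF Ff] := fourier_isometries ax iW.
split=> [i j|i]; last by rewrite bE.
by rewrite !bE FF (inj_eq rev_ord_inj).
Qed.

Let sum_b : \sum_(j < m.+1) b j * st (b j) = \sum_(i < m) V i * st (V i) + f.
Proof.
transitivity (\sum_(l < m.+1) W l * st (W l)).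
  rewrite -(fourier_range ax (fun l : 'I_m.+1 => W l)) [RHS](reindex_inj rev_ord_inj) /=.
  by apply: eq_bigr => j _; rewrite bE.
have Wm : W m = f by rewrite /W ltnn.
rewrite big_ord_recr /= Wm st_f; case: pf => -> _; congr (_ + _).
rewrite -(fourier_range ax (fun i : 'I_m => V i)); apply: eq_bigr => i _.
by rewrite /W ltn_ord.
Qed.

(** What the [V i] leave of the stack; [P] is shifted cyclically like [E] and [V]. *)
Let P i := E i - V i * st (V i).

Let EVst i : E i * (V i * st (V i)) = V i * st (V i).
Proof. by rewrite mulrA EV. Qed.
Let VstE i : (V i * st (V i)) * E i = V i * st (V i).
Proof. by rewrite -mulrA VE. Qed.

Let oP : orthogonal_projections st m P.
Proof.
have [pV oV] := isometries_projections ax iV.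
split=> [i im|i j im jm ij].
  have [ee es] := pE i; have [vv vs] := pV i im.
  split; last by rewrite raddfB /= es vs.
  by rewrite /P mulrBl !mulrBr ee EVst VstE vv subrr subr0.
rewrite /P mulrBl !mulrBr Eo // oV // -(EVst j) (mulrA (E i)) Eo // mul0r.
by rewrite -(VstE i) -(mulrA _ (E i)) Eo // mulr0 !subr0.
Qed.

Let PV i l : (i < m)%N -> (l < m)%N -> P i * V l = 0.
Proof.
move=> im lm; rewrite mulrBl; have [->|il] := eqVneq i l.
  by rewrite EV -mulrA VV Vf subrr.
by rewrite -mulrA VVo // mulr0 subr0 -EV mulrA Eo // mul0r.
Qed.

Let Pf i : (i < m)%N -> P i * f = 0.
Proof. by move=> im; rewrite mulrBl Ef // -mulrA stVf // mulr0 subr0. Qed.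

Let Pb i j : (i < m)%N -> P i * b j = 0.
Proof.
move=> im; rewrite /b /fourier mulrA -sgC -mulrA mulr_sumr big1 ?mulr0 // => l _.
rewrite mulrA -sgC -mulrA [_ * W l](_ : _ = 0) ?mulr0 // /W.
case: ifP => lm; last exact: Pf.
rewrite /fourier mulrA -sgC -mulrA mulr_sumr big1 ?mulr0 // => i' _.
by rewrite mulrA -sgC -mulrA PV // mulr0.
Qed.

Let Zf : Z f.
Proof.
apply: (subB SZ); first exact: (ssub1 SZ).
by apply: (sub_sum SZ) => i _; exact: iterZ.
Qed.

Let ZW l : Z (W l).
Proof.
rewrite /W; case: ifP => // _; apply: (ssubZ SZ); apply: (sub_sum SZ) => i _.
by apply: (ssubZ SZ); exact: ZV.
Qed.

Let Zb j : Z (b j).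
Proof. by apply: (ssubZ SZ); apply: (sub_sum SZ) => i _; apply: (ssubZ SZ); exact: ZW. Qed.

Let ZP i : Z (P i).
Proof.
apply: (subB SZ); first exact: iterZ.
by apply: (ssubM SZ); [exact: ZV|apply: (ssub_st SZ); exact: ZV].
Qed.

(** The [m.+1] projections [b j * st (b j)] and the [m] projections [P i] sum up to 1
and are permuted by [beta] up to a small error. Grouping them by residues modulo
[k.+1] and [k] does not increase the error, since one map [x |-> u (beta x) u^*] with
[u] close to 1 permutes the whole family exactly. *)
Lemma towers k : (0 < k)%N -> (k %| m)%N -> (k.+1 %| m.+1)%N ->
  let c := 2 * (d + d2 + d2 * d) + (d + d2 + d2 * d) ^+ 2 in
  exists g h : nat -> T,
  [/\ forall r, [/\ Z (g r), sproj st (g r) & g (r %% k)%N = g r],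
      forall r, [/\ Z (h r), sproj st (h r) & h (r %% k.+1)%N = h r],
      [/\ forall r s, (r %% k != s %% k)%N -> g r * g s = 0,
          forall r s, (r %% k.+1 != s %% k.+1)%N -> h r * h s = 0
        & forall r s, g r * h s = 0],
      \sum_(r < k) g r + \sum_(r < k.+1) h r = 1
    & forall r, bnd (beta (g r) - g r.+1) c /\ bnd (beta (h r) - h r.+1) c].
Proof.
move=> k0 km km1 c.
have ob := isometries_projections ax ib.
exists (residue_sum m k P), (residue_sum m.+1 k.+1 (fun j => b j * st (b j))); split.
- move=> r; split; [|exact: residue_sum_sproj|exact: residue_sum_mod].
  by apply: (sub_sum SZ) => i _; exact: ZP.
- move=> r; split; [|exact: residue_sum_sproj|exact: residue_sum_mod].
  by apply: (sub_sum SZ) => i _; apply: (ssubM SZ); [exact: Zb|apply: (ssub_st SZ); exact: Zb].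
- split=> [r s|r s|r s].
  + by move=> /negPf rs; rewrite (residue_sumM _ oP) rs.
  + by move=> /negPf rs; rewrite (residue_sumM _ ob) rs.
  rewrite /residue_sum mulr_suml big1 // => i _; rewrite mulr_sumr big1 // => j _.
  by rewrite mulrA Pb // mul0r.
- rewrite !residue_sum_total // sum_b /P sumrB.
  by rewrite addrA subrK /f addrC subrK.
have d0 : 0 <= d by exact: (bnd_ge0 bx (dY 0)).
have d20 : 0 <= d2 by rewrite divr_ge0 // mulr_ge0 // pi_ge0.
have dc : 2 * d + d ^+ 2 <= c.
  have : 0 <= d2 * d by rewrite mulr_ge0.
  by rewrite /c; nra.
move=> r; split; last first.
  have h := cyclic_residue_sum ax bx betaM beta_st r km1 ib bper Psib bnd_Psi.
  exact: h.
have := cyclic_residue_sum ax bx betaM beta_st r km iV Vm UV bnd_U.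
move/(bndN bx)/(bnd_le bx)/(_ dc); congr bnd.
have -> : residue_sum m k P r = residue_sum m k E r - residue_sum m k (fun i => V i * st (V i)) r.
  exact: sumrB.
have -> : residue_sum m k P r.+1 = residue_sum m k E r.+1 - residue_sum m k (fun i => V i * st (V i)) r.+1.
  exact: sumrB.
have -> : residue_sum m k E r.+1 = beta (residue_sum m k E r).
  by rewrite -residue_sum_shift // raddf_sum.
by rewrite [beta (_ - _)]raddfB; ncring.
Qed.

End Towers.

(** * Lifting projections to sequences *)

Section Lifting.
Variables (R : realType) (A : cstarAlgType R).
Local Notation C := R[i].
Local Notation scal := (@scal R A).
Local Notation star := (@star R A).
Local Notation Q := (seqalg A).
Local Notation sst := (@seqalg_star R A).
Let ax := cstar_axioms A.
Variable Bs : nat -> csubalg A.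
Hypothesis fBs : forall n, fin_dim (Bs n).
Hypothesis incBs : forall n, Bs n `<=` Bs n.+1.
Hypothesis denseBs : dense (\bigcup_n Bs n).

Definition locally_finite : A -> Prop := fun x => exists n, unitization (Bs n) x.
Local Notation LF := locally_finite.

Let unitization_le m n : (m <= n)%N -> unitization (Bs m) `<=` unitization (Bs n).
Proof.
move=> mn x [b Bb [c ->]]; exists b; last by exists c.
exact: (le_subalgebras incBs mn).
Qed.

Let common x y : LF x -> LF y -> exists n, unitization (Bs n) x /\ unitization (Bs n) y.
Proof.
move=> [m hx] [n hy]; exists (maxn m n); split.
  by apply: unitization_le hx; exact: leq_maxl.
by apply: unitization_le hy; exact: leq_maxr.
Qed.

Lemma locally_finite_subalg : star_subalg scal star LF.
Proof.
split.
- by exists 0%N; exact: (ssub1 (unitization_subalg _)).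
- by move=> x y hx hy; have [n [h1 h2]] := common hx hy; exists n; exact: (ssubD (unitization_subalg _)).
- by move=> c x [n hx]; exists n; exact: (ssubZ (unitization_subalg _)).
- by move=> x y hx hy; have [n [h1 h2]] := common hx hy; exists n; exact: (ssubM (unitization_subalg _)).
- by move=> x [n hx]; exists n; exact: (ssub_st (unitization_subalg _)).
Qed.
Let SL := locally_finite_subalg.

Lemma nrm_sproj (p : A) : sproj star p -> nrm p <= 1.
Proof. by move=> hp; exact: (bnd_sproj ax (nrm_bound_axioms A) hp). Qed.

Lemma sproj_small (p : A) : sproj star p -> nrm p < 1 -> p = 0.
Proof.
move=> [pp ps] p1; apply: nrm_eq0.
by have := nrm_starM p; rewrite ps pp => h; have := nrm_ge0 p; nra.
Qed.

Lemma locally_finite_projection (h : A) : LF h -> star h = h ->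
  exists p, [/\ LF p, sproj star p, exists l, p = h * l & nrm (h - p) <= 2 * nrm (h * h - h)].
Proof.
move=> [n hn] hh; have SU := unitization_subalg (Bs n); have fU := unitization_finspan (fBs n).
have [p [k [l [b [[Up Uk Ul Ub] sp hp pl kb]]]]] :=
  near_projection ax SU fU (@nrm_proper _ _ _) hn hh.
exists p; split=> //; [by exists n|by exists l|].
rewrite hp mulrC (le_trans (nrmM _ _)) // ler_wpM2l ?nrm_ge0 //.
pose a (i : bool) := if i then k else b.
apply: (@nrm_le_sum_squares _ _ _ SU fU bool a 2 _ _ _ true) => //; first by case.
rewrite big_bool /= [LHS]kb; congr (scal _).
by rewrite -natrX rmorph_nat.
Qed.

Lemma invS_small (d : R) : 0 < d -> eventually (fun n => n.+1%:R^-1 <= d).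
Proof.
move=> d0; exists (Num.bound `|d^-1|) => n hn.
rewrite -[d]invrK lef_pV2 ?posrE ?ltr0n ?invr_gt0 // (le_trans (ler_norm _)) //.
rewrite ltW // (lt_le_trans (archi_boundP (normr_ge0 _))) // ler_nat.
exact: leq_trans hn _.
Qed.

(** Lifts are kept inside the union of the finite-dimensional subalgebras, where
approximate projections can be straightened. *)
Definition projection_lift (x : nat -> A) := forall n, LF (x n) /\ sproj star (x n).

Lemma projection_lift_bounded x : projection_lift x -> exists M, forall n, nrm (x n) <= M.
Proof. by move=> hx; exists 1 => n; apply: nrm_sproj; case: (hx n). Qed.

(** A hermitian representative of [p], compressed by [1 - g], is an approximate
projection orthogonal to [g]; straightening multiplies it on the right only, so
this orthogonality persists. *)
Lemma lift_projection (p : Q) (g : bseq A) : sproj sst p -> projection_lift g ->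
  class g * p = 0 ->
  exists x : bseq A, [/\ projection_lift x, forall n, g n * x n = 0 & class x = p].
Proof.
move=> [pp ps] lg gp.
have /choice[y yP] : forall n, exists y, LF y /\ nrm (repr p n - y) < n.+1%:R^-1.
  move=> n; have [|N [y [By ry]]] := dense_approx denseBs (repr p n) (e := n.+1%:R^-1).
    by rewrite invr_gt0 ltr0n.
  by exists y; split=> //; exists N; exact: unitization_sub.
have yb : exists M, forall n, nrm (y n) <= M.
  have [M hM] := bseqP (repr p); exists (M + 1) => n; have [_ h] := yP n.
  have := nrmB (repr p n) (repr p n - y n); rewrite opprB addrC subrK => h1.
  have h2 : n.+1%:R^-1 <= 1 :> R by rewrite invf_le1 ?ltr0n // ler1n.
  have h3 := hM n; have h4 := lt_le_trans h h2; clear h h2; lra.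
pose Y := BSeq yb.
have YE : class Y = p.
  rewrite -[p]class_repr; apply/classP => d d0; apply: eventually1 (invS_small d0) => n h.
  by rewrite -nrmN opprB (le_trans _ h) // ltW //; case: (yP n).
pose u := bseq_add (bseq_cst 1) (bseq_opp g).
pose h := bseq_mul (bseq_mul u (bseq_mul (bseq_cst (scal 2^-1)) (bseq_add Y (bseq_star Y)))) u.
have stg n : star (g n) = g n by case: (lg n) => _ [].
have conj2 : (2^-1 : C)^*%R = 2^-1 by rewrite fmorphV rmorph_nat.
have hh n : star (h n) = h n.
  by rewrite /= !starM !starD starK raddfN /= stg star1 (star_sg ax) conj2 -scal_comm (addrC (star _)) mulrA.
have hL n : LF (h n).
  have Lu : LF (1 - g n) by apply: (subB SL); [exact: (ssub1 SL)|case: (lg n)].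
  have Ly : LF (y n) by case: (yP n).
  apply: (ssubM SL) => //; apply: (ssubM SL) => //; apply: (ssubZ SL).
  by apply: (ssubD SL) => //; exact: (ssub_st SL).
have hE : class h = p.
  have pg : p * class g = 0.
    by rewrite -[LHS](star_stK (seqalg_axioms A)) (star_stM (seqalg_axioms A)) ps
      class_star (class_ext (y := g)) // gp raddf0.
  rewrite -!classM -!classD -!classN -class_star YE ps.
  rewrite -[class (bseq_cst 1)]/(1 : Q) -[class (bseq_cst (scal _))]/(seqscal A 2^-1).
  have E (T : pzRingType) (a b : T) : a * (b + b) = a * (1 + 1) * b by ncring.
  rewrite E -(rmorph1 (@seqscal R A)) -rmorphD -rmorphM -[1 + 1]/(2%:R).
  rewrite mulVf ?pnatr_eq0 // rmorph1 mul1r.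
  by rewrite mulrBl mul1r gp subr0 mulrBr mulr1 pg subr0.
have /choice[x xP] := fun n => locally_finite_projection (hL n) (hh n).
have lx : projection_lift x by move=> n; have [] := xP n.
pose X := BSeq (projection_lift_bounded lx); exists X; split=> //.
- move=> n /=; have [_ _ [l ->] _] := xP n; have [_ [gg _]] := lg n.
  by rewrite /= !mulrA (mulrBr (g n)) mulr1 gg subrr !mul0r.
rewrite -hE; apply/esym/classP.
have h0 : null_seq (fun n => h n * h n - h n).
  by apply/(classP (bseq_mul h h)); rewrite -classM hE.
by apply: (null_seq_le (M := 2)) h0 => n; have [] := xP n.
Qed.

(** One at a time, each orthogonal to the sum of the earlier ones. *)
Lemma lift_projections N (p : nat -> Q) :
  (forall i, (i < N)%N -> sproj sst (p i)) ->
  (forall i j, (i < N)%N -> (j < N)%N -> i != j -> p i * p j = 0) ->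
  exists x : nat -> bseq A, [/\ forall i, (i < N)%N -> projection_lift (x i) /\ class (x i) = p i
    & forall i j n, (i < N)%N -> (j < N)%N -> i != j -> x i n * x j n = 0].
Proof.
elim: N => [|N IH] pp po; first by exists (fun=> bseq_cst 0).
have [x [xP xo]] := IH (fun i iN => pp i (ltnW iN)) (fun i j iN jN => po i j (ltnW iN) (ltnW jN)).
pose g n := \sum_(i < N) x i n.
have lg : projection_lift g.
  move=> n; split.
    by apply: (sub_sum SL) => i _; have [/(_ n)[]] := xP i (ltn_ord i).
  split; last first.
    rewrite raddf_sum; apply: eq_bigr => i _.
    by have [/(_ n)[_ []]] := xP i (ltn_ord i).
  rewrite /g mulr_suml; apply: eq_bigr => i _; rewrite mulr_sumr (bigD1 i) //= big1 ?addr0.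
    by have [/(_ n)[_ []]] := xP i (ltn_ord i).
  by move=> j ji; rewrite xo // eq_sym.
pose G := BSeq (projection_lift_bounded lg).
have GE : class G = \sum_(i < N) p i.
  have : forall M, (M <= N)%N -> exists2 H : bseq A,
      (forall n, H n = \sum_(i < M) x i n) & class H = \sum_(i < M) p i.
    elim=> [|M IHM] MN; first by exists (bseq_cst 0) => [n|]; rewrite big_ord0.
    have [H H1 H2] := IHM (ltnW MN); exists (bseq_add H (x M)) => [n|].
      by rewrite big_ord_recr /= H1.
    by rewrite big_ord_recr /= -classD H2; have [_ ->] := xP M MN.
  case/(_ N (leqnn _)) => H H1 <-; apply: class_ext => n; by rewrite H1.
have Gp : class G * p N = 0.
  by rewrite GE mulr_suml big1 // => i _; rewrite po ?ltnS ?(ltnW (ltn_ord i)) // ltn_eqF.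
have lG : projection_lift G := lg.
have [y [ly gy yE]] := lift_projection (pp N (ltnSn N)) lG Gp.
have xy i n : (i < N)%N -> x i n * y n = 0.
  move=> iN; have gi : x i n * g n = x i n.
    rewrite /g mulr_sumr (bigD1 (Ordinal iN)) //= big1 ?addr0.
      by have [/(_ n)[_ []]] := xP i iN.
    by move=> j ji; rewrite xo // eq_sym.
  by rewrite -gi -mulrA [g n * _]gy mulr0.
have yx i n : (i < N)%N -> y n * x i n = 0.
  move=> iN; have [/(_ n)[_ [_ xs]] _] := xP i iN; have [_ [_ ys]] := ly n.
  by rewrite -[LHS]starK starM xs ys xy // raddf0.
exists (fun i => if (i < N)%N then x i else y); split=> [i|i j n].
  by rewrite ltnS leq_eqVlt => /orP[/eqP ->|iN]; [rewrite ltnn|rewrite iN; exact: xP].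
case: (ltnP i N) => iN; case: (ltnP j N) => jN iN1 jN1 ij.
- exact: xo.
- exact: xy.
- exact: yx.
- by move: ij; rewrite eqn_leq (leq_trans _ jN) // (leq_trans _ iN) // -ltnS.
Qed.

End Lifting.

(** * Central sequences *)

Section CentralSequences.
Variables (R : realType) (A : cstarAlgType R).
Local Notation C := R[i].
Local Notation scal := (@scal R A).
Local Notation star := (@star R A).
Local Notation Q := (seqalg A).
Local Notation sst := (@seqalg_star R A).
Let ax := cstar_axioms A.
Let qax := seqalg_axioms A.
Variable Bs : nat -> csubalg A.
Hypothesis fBs : forall n, fin_dim (Bs n).
Hypothesis incBs : forall n, Bs n `<=` Bs n.+1.
Hypothesis denseBs : dense (\bigcup_n Bs n).
Variable alpha : automorphism A.

Definition central (x : Q) := forall a, cst_seq a * x = x * cst_seq a.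

Lemma star_cst a : sst (cst_seq a) = cst_seq (star a).
Proof. by rewrite class_star; exact: class_ext. Qed.

Lemma central_subalg : star_subalg (@seqscal R A) sst central.
Proof.
split.
- by move=> a; rewrite mulr1 mul1r.
- by move=> x y hx hy a; rewrite mulrDr mulrDl hx hy.
- by move=> c x hx a; rewrite mulrA -(star_sgC qax) -mulrA hx mulrA.
- by move=> x y hx hy a; rewrite mulrA hx -mulrA hy mulrA.
- move=> x hx a; rewrite -[a]starK -star_cst -!(star_stM qax).
  by rewrite hx.
Qed.

Lemma central_map (ha : forall x : A, nrm (alpha x) = nrm x) x : central x -> central (seqmap ha x).
Proof.
move=> hx a; have [beta [ab ba]] := aut_inverse alpha.
have -> : cst_seq a = seqmap ha (cst_seq (beta a)).
  by rewrite seqmap_class; apply: class_ext => n /=; rewrite ba.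
by rewrite -!seqmapM hx.
Qed.

(** [y] is asymptotically contained in the subalgebras [Bs (nu n)]. *)
Definition tracked (nu : nat -> nat) (y : nat -> A) :=
  forall d : R, 0 < d -> eventually (fun n => exists2 b, csub_set (Bs (nu n)) b & nrm (y n - b) <= d).

Lemma tracked_star nu y : tracked nu y -> tracked nu (fun n => star (y n)).
Proof.
move=> h d /h; apply: eventually1 => n [b Bb yb]; exists (star b); first exact: csub_star.
by rewrite -raddfB nrm_star.
Qed.

Lemma tracked_cst nu a : (forall n, (n <= nu n)%N) -> tracked nu (fun=> a).
Proof.
move=> hnu d d0; have [N [b [Bb /ltW ab]]] := dense_approx denseBs a d0.
by exists N => n Nn; exists b => //; apply: (le_subalgebras incBs (leq_trans Nn (hnu n))).
Qed.

Lemma commutes_tracked nu (x y : bseq A) :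
  (forall n, commutant_set (Bs (nu n)) (x n)) -> tracked nu y -> class x * class y = class y * class x.
Proof.
move=> cx ty; have [M hM] := bseqP x; have M0 : 0 <= M := le_trans (nrm_ge0 _) (hM 0%N).
rewrite !classM; apply/classP => d d0.
have k0 : 0 < 2 * M + 1 by rewrite ltr_wpDl // mulr_ge0.
apply: eventually1 (ty _ (divr_gt0 d0 k0)) => n [b Bb yb] /=.
have -> : x n * y n - y n * x n = x n * (y n - b) - (y n - b) * x n.
  by rewrite mulrBr mulrBl (cx n b Bb) opprB addrA subrK.
rewrite (le_trans (nrmB _ _)) // (le_trans (lerD (nrmM _ _) (nrmM _ _))) //.
have h1 : nrm (x n) * nrm (y n - b) <= M * (d / (2 * M + 1)).
  by rewrite ler_pM ?nrm_ge0.
rewrite [nrm (y n - b) * _]mulrC (le_trans (lerD h1 h1)) // -mulrDl mulrA ler_pdivrMr //.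
nra.
Qed.

Lemma central_class nu (x : bseq A) : (forall n, (n <= nu n)%N) ->
  (forall n, commutant_set (Bs (nu n)) (x n)) -> central (class x).
Proof.
move=> hnu cx a; apply/esym/(commutes_tracked (y := bseq_cst a) cx).
exact: tracked_cst.
Qed.

Lemma class_close (x y : bseq A) : (forall n, nrm (x n - y n) <= n.+1%:R^-1) -> class x = class y.
Proof.
by move=> h; apply/classP => d /invS_small; apply: eventually1 => n; exact: le_trans.
Qed.

Lemma class_sum (I : Type) (r : seq I) (x : I -> bseq A) : exists s : bseq A,
  (forall n, s n = \sum_(i <- r) x i n) /\ class s = \sum_(i <- r) class (x i).
Proof.
elim: r => [|i r [s [sE cE]]].
  by exists (bseq_cst 0); split=> [n|]; rewrite big_nil.
exists (bseq_add (x i) s); split=> [n|]; first by rewrite big_cons /= sE.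
by rewrite big_cons -classD cE.
Qed.

Lemma invS_le1 n : n.+1%:R^-1 <= 1 :> R.
Proof. by rewrite invf_le1 ?ltr0n // ler1n. Qed.

Lemma almost_isometry_bounded (z f : A) (M d : R) : nrm f <= M -> d <= 1 ->
  nrm (star z * z - f) <= d -> nrm z <= M + 2.
Proof.
move=> fM d1 zf.
have h := nrmD (star z * z - f) f; rewrite subrK nrm_starM in h.
have := nrm_ge0 z; have := nrm_ge0 f; nra.
Qed.

Hypothesis approx : approx_rohlin_property alpha.
Hypothesis ha : forall x : A, nrm (alpha x) = nrm x.

(** The approximate stacks for [Bs n] with error [1 / (n + 1)] form, modulo null
sequences, an exact cyclic stack of central elements; the partial isometries come
from three copies of the remainder [1 - sum_i e i] under [e 0] in the K_0-groups
of the commutants. *)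
Lemma stack_sequence m : exists (e : 'I_m.+1 -> Q) (z : 'I_3 -> Q),
  [/\ forall i, central (e i) /\ sproj sst (e i),
      forall i j, i != j -> e i * e j = 0,
      forall i, seqmap ha (e i) = e (ordS i),
      forall i, central (z i) /\ e ord0 * z i = z i
    & forall i j, sst (z i) * z j = if i == j then 1 - \sum_i e i else 0].
Proof.
have e0 n : 0 < n.+1%:R^-1 :> R by rewrite invr_gt0 ltr0n.
have /choice[e /choice[z P]] : forall n, exists (e : 'I_m.+1 -> A) (z : 'I_3 -> A),
    [/\ forall i, commutant_set (Bs n) (e i), approx_cyclic_stack alpha n.+1%:R^-1 e,
        forall i, commutant_set (Bs n) (z i), forall i, e ord0 * z i = z i
      & forall i j, nrm (star (z i) * z j - (if i == j then 1 - \sum_i e i else 0)) <= n.+1%:R^-1].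
  move=> n; have [e [f [st fE _ le]]] := @approx m 3 _ _ isT (e0 n) (fBs n).
  have [z [zc ez zz]] := K0_le_copies fBs incBs denseBs (e0 n) le.
  exists (fun i => e i : A), z; split=> //; first by move=> i; exact: (projP (e _)).
  by move=> i j; rewrite -fE.
have pe n i : sproj star (e n i) by have [_ [h _ _] _ _ _] := P n; exact: h.
have eb i : exists M, forall n, nrm (e n i) <= M.
  by exists 1 => n; apply: nrm_sproj.
have fM n : nrm (1 - \sum_i e n i) <= 1 + m.+1%:R.
  rewrite (le_trans (nrmB _ _)) // lerD ?nrm1_le // (le_trans (nrm_sum _ _ _)) //.
  rewrite (le_trans (y := \sum_(i < m.+1) 1)) //; last by rewrite sumr_const card_ord.
  by apply: ler_sum => i _; exact: nrm_sproj.
have zb i : exists M, forall n, nrm (z n i) <= M.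
  exists (1 + m.+1%:R + 2) => n; have [_ _ _ _ /(_ i i)] := P n; rewrite eqxx.
  by apply: almost_isometry_bounded; [exact: fM|exact: invS_le1].
pose eQ i := BSeq (eb i); pose zQ i := BSeq (zb i).
exists (fun i => class (eQ i)), (fun i => class (zQ i)); split.
- move=> i; split.
    by apply: (central_class (nu := id)) => // n; have [h _ _ _ _] := P n; exact: h.
  split; rewrite ?classM ?class_star; apply: class_ext => n /=; by case: (pe n i).
- move=> i j ij; rewrite classM -[0]/(class (bseq_cst 0)); apply: class_ext => n /=.
  by have [_ [_ h _] _ _ _] := P n; exact: h.
- move=> i; rewrite seqmap_class; apply: class_close => n /=.
  have [_ [_ _ h] _ _ _] := P n.
  have := h i; rewrite -[`|_|]/(`|alpha (e n i) - e n (ordS i) : A|) normE ltcR.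
  exact: ltW.
- move=> i; split.
    by apply: (central_class (nu := id)) => // n; have [_ _ h _ _] := P n; exact: h.
  by rewrite classM; apply: class_ext => n /=; have [_ _ _ h _] := P n; exact: h.
move=> i j; have [s [sE cE]] := class_sum (index_enum 'I_m.+1) eQ.
rewrite class_star classM -cE.
have -> : (if i == j then 1 - class s else 0) =
    class (if i == j then bseq_add (bseq_cst 1) (bseq_opp s) else bseq_cst 0).
  by case: eqP => // _; rewrite -classD -classN.
apply: class_close => n /=; have [_ _ _ _ /(_ i j)] := P n.
by case: eqP => _ //=; rewrite sE.
Qed.

(** A stack of height two gives equivalent projections [q0] and [q1] whose complement
[q2] is smaller. To commute with given sequences [y j], which leave every [Bs n],
the stack at time [n] is taken in the commutant of a [Bs (nu n)] that is large
enough to approximate [y j] at time [n]. *)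
Lemma layer_sequence (J : finType) (y : J -> Q) : exists q0 q1 q2 a b c : Q,
  [/\ [/\ sproj sst q0, sproj sst q1 & sproj sst q2],
      [/\ q0 * q1 = 0, q0 * q2 = 0, q1 * q2 = 0 & q0 + q1 + q2 = 1],
      [/\ [/\ sst a * a = q1, q0 * a = a & a * q1 = a],
          [/\ sst b * b = q2, q0 * b = b & b * q2 = b]
        & [/\ sst c * c = q0, q1 * c = c & c * q0 = c]]
    & forall w, w \in [:: q0; q1; q2; a; b; c] -> central w /\
        forall j, w * y j = y j * w /\ w * sst (y j) = sst (y j) * w].
Proof.
have e0 n : 0 < n.+1%:R^-1 :> R by rewrite invr_gt0 ltr0n.
have /choice[N0 /choice[yy yP]] : forall n, exists N (yy : J -> A),
    forall j, csub_set (Bs N) (yy j) /\ nrm (repr (y j) n - yy j) < n.+1%:R^-1.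
  by move=> n; exact: (dense_approx_fin incBs denseBs (fun j => repr (y j) n) (e0 n)).
pose nu n := maxn n (N0 n).
have nun n : (n <= nu n)%N by exact: leq_maxl.
have ty j : tracked nu (repr (y j)).
  move=> d /invS_small; apply: eventually1 => n nd; exists (yy n j).
    by apply: (le_subalgebras incBs (leq_maxr _ _)); case: (yP n j).
  by rewrite (le_trans _ nd) // ltW //; case: (yP n j).
have /choice[q0 /choice[q1 /choice[a /choice[b /choice[c P]]]]] : forall n, exists q0 q1 a b c : A,
    [/\ [/\ commutant_set (Bs (nu n)) q0, commutant_set (Bs (nu n)) q1,
            commutant_set (Bs (nu n)) a, commutant_set (Bs (nu n)) b & commutant_set (Bs (nu n)) c],
        [/\ sproj star q0, sproj star q1 & q0 * q1 = 0],
        q0 * a = a /\ nrm (star a * a - q1) <= n.+1%:R^-1,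
        q0 * b = b /\ nrm (star b * b - (1 - (q0 + q1))) <= n.+1%:R^-1
      & q1 * c = c /\ nrm (star c * c - q0) <= n.+1%:R^-1].
  move=> n; have [e [f [[pe oe _] fE eqe le]]] := @approx 1 3 1 _ isT ltr01 (fBs (nu n)).
  have [a [ac ea aa]] := K0_eq_copy fBs incBs denseBs (e0 n) (eqe ord_max ord0).
  have [c [cc ec c1]] := K0_eq_copy fBs incBs denseBs (e0 n) (eqe ord0 ord_max).
  have [z [zc ez zz]] := K0_le_copies fBs incBs denseBs (e0 n) le.
  exists (e ord0), (e ord_max), a, (z ord0), c; split=> //.
  - by split=> //; exact: (projP (e _)).
  - by split; [exact: pe|exact: pe|exact: oe].
  - split=> //; have := zz ord0 ord0; rewrite eqxx fE big_ord_recr big_ord1 /=.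
    by rewrite (_ : widen_ord _ _ = ord0) //; exact: val_inj.
have pq0 n : sproj star (q0 n) by have [_ []] := P n.
have pq1 n : sproj star (q1 n) by have [_ []] := P n.
have q0b : exists M, forall n, nrm (q0 n) <= M by exists 1 => n; exact: nrm_sproj.
have q1b : exists M, forall n, nrm (q1 n) <= M by exists 1 => n; exact: nrm_sproj.
have ab : exists M, forall n, nrm (a n) <= M.
  exists (1 + 2) => n; have [_ _ [_ h] _ _] := P n.
  by apply: (almost_isometry_bounded _ (invS_le1 n) h); exact: nrm_sproj.
have cb : exists M, forall n, nrm (c n) <= M.
  exists (1 + 2) => n; have [_ _ _ _ [_ h]] := P n.
  by apply: (almost_isometry_bounded _ (invS_le1 n) h); exact: nrm_sproj.
have bb : exists M, forall n, nrm (b n) <= M.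
  exists (1 + (1 + 1) + 2) => n; have [_ _ _ [_ h] _] := P n.
  apply: (almost_isometry_bounded _ (invS_le1 n) h).
  rewrite (le_trans (nrmB _ _)) // lerD ?nrm1_le // (le_trans (nrmD _ _)) //.
  by rewrite lerD ?nrm_sproj.
pose Q0 := class (BSeq q0b); pose Q1 := class (BSeq q1b).
pose Aq := class (BSeq ab); pose Bq := class (BSeq bb); pose Cq := class (BSeq cb).
pose Q2 := 1 - (Q0 + Q1).
pose good (w : Q) := central w /\ forall j, w * y j = y j * w /\ w * sst (y j) = sst (y j) * w.
have goodc (x : bseq A) : (forall n, commutant_set (Bs (nu n)) (x n)) -> good (class x).
  move=> cx; split; first exact: central_class nun cx.
  move=> j; rewrite -[y j]class_repr; split; first exact: commutes_tracked cx (ty j).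
  rewrite class_star; apply: commutes_tracked cx _; exact: (tracked_star (ty j)).
have goodM v w : good v -> good w -> good (v * w).
  move=> [v1 v2] [w1 w2]; split; first exact: (ssubM central_subalg).
  move=> j; have [vy vy'] := v2 j; have [wy wy'] := w2 j.
  by rewrite -!mulrA wy wy' !mulrA vy vy'.
have good0 : good Q0 by apply: goodc => n; have [[]] := P n.
have good1 : good Q1 by apply: goodc => n; have [[]] := P n.
have goodA : good Aq by apply: goodc => n; have [[]] := P n.
have goodB : good Bq by apply: goodc => n; have [[]] := P n.
have goodC : good Cq by apply: goodc => n; have [[]] := P n.
have good2 : good Q2.
  have [c0 y0] := good0; have [c1 y1] := good1; split.
    apply: (subB central_subalg); first exact: (ssub1 central_subalg).
    exact: (ssubD central_subalg).
  move=> j; have [a0 b0] := y0 j; have [a1 b1] := y1 j.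
  by rewrite !(mulrBl, mulrBr, mulrDl, mulrDr) !(mul1r, mulr1) a0 b0 a1 b1.
have sq0 : sproj sst Q0.
  by split; rewrite ?classM ?class_star; apply: class_ext => n /=; case: (pq0 n).
have sq1 : sproj sst Q1.
  by split; rewrite ?classM ?class_star; apply: class_ext => n /=; case: (pq1 n).
have q01 : Q0 * Q1 = 0.
  by rewrite classM -[0]/(class (bseq_cst 0)); apply: class_ext => n /=; have [_ []] := P n.
have [q00 q0s] := sq0; have [q11 q1s] := sq1.
have q10 : Q1 * Q0 = 0.
  by rewrite -[LHS](star_stK qax) (star_stM qax) q0s q1s q01 raddf0.
have q02 : Q0 * Q2 = 0 by rewrite mulrBr mulr1 mulrDr q00 q01 addr0 subrr.
have q12 : Q1 * Q2 = 0 by rewrite mulrBr mulr1 mulrDr q10 q11 add0r subrr.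
have st1 : sst 1 = 1 := star_st1 qax.
have sq2 : sproj sst Q2.
  split; last by rewrite raddfB raddfD /= st1 q0s q1s.
  by rewrite {1}/Q2 mulrBl mul1r mulrDl q02 q12 addr0 subr0.
(* The limit of almost isometries need not vanish off the initial projection [q]
until it is cut by [q]. *)
have corner (x : bseq A) (v q : Q) (p : bseq A) : class x = v -> class p = q -> sproj sst q ->
    (forall n, nrm (star (x n) * x n - p n) <= n.+1%:R^-1) ->
    sst (v * q) * (v * q) = q /\ v * q * q = v * q.
  move=> <- pq [qq qs] h; split; last by rewrite -mulrA qq.
  have hx : sst (class x) * class x = q.
    by rewrite class_star classM -pq; apply: class_close => n /=.
  by rewrite (star_stM qax) qs -mulrA (mulrA (sst _)) hx !qq.
exists Q0, Q1, Q2, (Aq * Q1), (Bq * Q2), (Cq * Q0); split=> //.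
- by split=> //; rewrite /Q2 addrC subrK.
- split.
  + have [|h1 h2] := corner _ Aq Q1 (BSeq q1b) erefl erefl sq1.
      by move=> n; have [_ _ [_ h] _ _] := P n.
    split=> //; rewrite mulrA; congr (_ * _); rewrite classM; apply: class_ext => n /=.
    by have [_ _ [h _] _ _] := P n.
  + have [||h1 h2] := corner _ Bq Q2 (bseq_add (bseq_cst 1) (bseq_opp (bseq_add (BSeq q0b) (BSeq q1b)))) erefl _ sq2.
    * by rewrite -classD -classN -classD.
    * by move=> n; have [_ _ _ [_ h] _] := P n.
    split=> //; rewrite mulrA; congr (_ * _); rewrite classM; apply: class_ext => n /=.
    by have [_ _ _ [h _] _] := P n.
  + have [|h1 h2] := corner _ Cq Q0 (BSeq q0b) erefl erefl sq0.
      by move=> n; have [_ _ _ _ [_ h]] := P n.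
    split=> //; rewrite mulrA; congr (_ * _); rewrite classM; apply: class_ext => n /=.
    by have [_ _ _ _ [h _]] := P n.
move=> w; rewrite !inE => /or4P[/eqP->|/eqP->|/eqP->|/or3P[/eqP->|/eqP->|/eqP->]] //; exact: goodM.
Qed.

End CentralSequences.

(** * The Rohlin property *)

Section Conclusion.
Variables (R : realType) (A : cstarAlgType R).
Local Notation C := R[i].
Local Notation scal := (@scal R A).
Local Notation star := (@star R A).
Local Notation Q := (seqalg A).
Local Notation sst := (@seqalg_star R A).
Let qax := seqalg_axioms A.
Let qbx := seqbnd_axioms A.

Lemma tower_error_small (c : R) : 0 < c -> exists2 N, (0 < N)%N &
  forall m r, (N <= m)%N ->
    r = 4 / N%:R + 4 * pi / m.+1%:R + 4 * pi / m.+1%:R * (4 / N%:R) -> 2 * r + r ^+ 2 <= c.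
Proof.
move=> c0; pose N := (Num.bound `|8000 / c|).+1; exists N => // m r Nm rE.
have N0 : 0 < N%:R :> R by rewrite ltr0n.
pose t := N%:R^-1 : R; have t0 : 0 < t by rewrite invr_gt0.
have t1 : t <= 1 by rewrite invf_le1 ?ler1n.
have tc : 8000 * t <= c.
  rewrite ler_pdivrMr // mulrC -ler_pdivrMr //.
  rewrite (le_trans (ler_norm _)) // ltW // (lt_le_trans (archi_boundP (normr_ge0 _))) //.
  by rewrite ler_nat.
have pi4 : pi <= 4 :> R.
  have /andP[_ h] := @pihalf_02 R; lra.
have pi0 := @pi_ge0 R.
have hd : 4 / N%:R = 4 * t by [].
have hd2 : 4 * pi / m.+1%:R <= 16 * t.
  rewrite ler_pM ?mulr_ge0 ?invr_ge0 ?ler0n //; first by rewrite -[16]/(4 * 4)%:R natrM ler_wpM2l.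
  by rewrite lef_pV2 ?posrE ?ltr0n // ler_nat ltnW.
have hd20 : 0 <= 4 * pi / m.+1%:R :> R by rewrite !mulr_ge0 ?invr_ge0 ?ler0n.
have r0 : 0 <= r by rewrite rE hd addr_ge0 ?addr_ge0 ?mulr_ge0 // ltW.
have rle : r <= 84 * t.
  rewrite rE hd (mulrC (4 * pi / _)); have : 4 * t * (4 * pi / m.+1%:R) <= 4 * t * (16 * t).
    by rewrite ler_wpM2l // mulr_ge0 // ltW.
  have tt : 4 * t * (16 * t) <= 64 * t.
    by rewrite mulrACA -natrM ler_pM2l ?ltr0n // ler_piMl // ltW.
  move: hd2 tt; set u := _ / _; set v := 4 * t * u; set w := 4 * t * (16 * t).
  move=> *; lra.
have r2 : r ^+ 2 <= 84 * t * 84.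
  rewrite expr2 ler_pM // (le_trans rle) //; lra.
lra.
Qed.

Lemma iter_cancel (T : Type) (f g : T -> T) n : cancel f g -> cancel (iter n f) (iter n g).
Proof. by move=> fg; elim: n => //= n IH x; rewrite iterSr iterS fg IH. Qed.

Variable Bs : nat -> csubalg A.
Hypothesis fBs : forall n, fin_dim (Bs n).
Hypothesis incBs : forall n, Bs n `<=` Bs n.+1.
Hypothesis denseBs : dense (\bigcup_n Bs n).
Variable alpha : automorphism A.
Hypothesis approx : approx_rohlin_property alpha.
Hypothesis ha : forall x : A, nrm (alpha x) = nrm x.

Local Notation central := (@central R A).
Let SZ := central_subalg A.

(** The path leads from [z] to [z' = beta^(-m) z], so that its translate [beta^m Y m]
closes up with [Y 0]. *)
Lemma central_towers (k : nat) (c : R) : (0 < k)%N -> 0 < c -> exists g h : nat -> Q,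
  [/\ forall r, [/\ central (g r), sproj sst (g r) & g (r %% k)%N = g r],
      forall r, [/\ central (h r), sproj sst (h r) & h (r %% k.+1)%N = h r],
      [/\ forall r s, r != s %[mod k] -> g r * g s = 0,
          forall r s, r != s %[mod k.+1] -> h r * h s = 0 & forall r s, g r * h s = 0],
      \sum_(r < k) g r + \sum_(r < k.+1) h r = 1
    & forall r, seqbnd (seqmap ha (g r) - g r.+1) c /\ seqbnd (seqmap ha (h r) - h r.+1) c].
Proof.
move=> k0 c0; have [N N0 hN] := tower_error_small c0.
(* The height [m] is 0 modulo [k] and -1 modulo [k.+1], and leaves the path enough time. *)
pose m := (k + k * k.+1 * (N + (N + N)))%N.
have km : (k %| m)%N by rewrite dvdn_addr // -mulnA dvdn_mulr.
have k1m : (k.+1 %| m.+1)%N by rewrite -addSn dvdn_addr // mulnAC dvdn_mull.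
have Nm : (N + (N + N) <= m)%N.
  by rewrite (leq_trans _ (leq_addl _ _)) // leq_pmull // muln_gt0 k0.
have m0 : (0 < m)%N by rewrite addn_gt0 k0.
have [m' mE] : exists m', m = m'.+1 by exists m.-1; rewrite prednK.
have [e [z1 [eP eo be_e z1P z1z]]] := stack_sequence fBs incBs denseBs approx ha m'.
have [bi' [ab ba]] := aut_inverse alpha.
have hb := aut_nrm fBs denseBs bi'.
pose be : {additive Q -> Q} := seqmap ha; pose bi : {additive Q -> Q} := seqmap hb.
have K1 : cancel be bi by exact: seqmapK.
have K2 : cancel bi be by exact: seqmapK.
have iterM (g : {additive Q -> Q}) n : {morph g : x y / x * y} -> {morph iter n g : x y / x * y}.
  by move=> gM x y; elim: n => //= n ->; rewrite gM.
have ord_mod (n : nat) : (n %% m'.+1 < m'.+1)%N by rewrite ltn_mod.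
have iter_e n : iter n be (e ord0) = e (Ordinal (ord_mod n)).
  elim: n => [|n IH] /=; first by congr e; apply: val_inj; rewrite /= mod0n.
  rewrite IH [LHS]be_e; congr e; apply: val_inj; rewrite /= -addn1 modnDml.
  by rewrite addn1.
have iter_e' (i : 'I_m'.+1) : iter i be (e ord0) = e i.
  by rewrite iter_e; congr e; apply: val_inj; rewrite /= modn_small.
pose e0 := e ord0; pose f := 1 - \sum_i e i.
have fE : 1 - \sum_(i < m) iter i be e0 = f.
  by rewrite mE; congr (_ - _); apply: eq_bigr => i _; exact: iter_e'.
have be1 : be 1 = 1 by rewrite -(rmorph1 (@seqscal R A)) [LHS]seqmap_scal.
have be_f : be f = f.
  rewrite raddfB raddf_sum /= be1; congr (_ - _); rewrite [RHS](reindex_inj (@ordS_inj _)).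
  by apply: eq_bigr => i _; exact: be_e.
have bi_f n : iter n bi f = f by elim: n => //= n ->; rewrite -{1}be_f K1.
have em : iter m be e0 = e0.
  by rewrite iter_e; congr e; apply: val_inj; rewrite /= mE modnn.
have ime : iter m bi e0 = e0 by rewrite -{1}em (iter_cancel m K1).
have pf : sproj sst f.
  split; last by rewrite raddfB raddf_sum /= (star_st1 qax); congr (_ - _);
    apply: eq_bigr => i _; case: (eP i) => _ [].
  have ss : (\sum_i e i) * (\sum_i e i) = \sum_i e i.
    rewrite mulr_suml; apply: eq_bigr => i _; rewrite mulr_sumr (bigD1 i) //= big1 ?addr0.
      by case: (eP i) => _ [].
    by move=> j ji; rewrite eo // eq_sym.
  by rewrite mulrBl mul1r mulrBr mulr1 ss subrr subr0.
have [ff fs] := pf.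
have cf : central f.
  apply: (subB SZ); first exact: (ssub1 SZ).
  by apply: (sub_sum SZ) => i _; case: (eP i).
pose z i := z1 i * f; pose z' i := iter m bi (z i).
have zz i j : sst (z i) * z j = if i == j then f else 0.
  rewrite (star_stM qax) fs -mulrA (mulrA (sst _)) z1z.
  by case: eqP; rewrite ?mul0r ?mulr0 // -[1 - _]/f ff ff.
have iz i : isometry_into central e0 f (z i).
  have [cz ez] := z1P i; split.
  - exact: (ssubM SZ).
  - by rewrite mulrA ez.
  - by rewrite -mulrA ff.
have biM n : {morph iter n bi : x y / x * y} by apply: iterM => x y; exact: seqmapM.
have bi_st n x : iter n bi (sst x) = sst (iter n bi x).
  by elim: n => //= n ->; exact: seqmap_star.
have bi0 n : iter n bi 0 = 0 by elim: n => //= n ->; rewrite raddf0.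
have zz' i j : sst (z' i) * z' j = if i == j then f else 0.
  rewrite -bi_st -biM zz; by case: eqP => _.
have bi_c n x : central x -> central (iter n bi x).
  by move=> cx; elim: n => //= n IH; exact: central_map.
have iz' i : isometry_into central e0 f (z' i).
  have [cz ez zf] := iz i; split; first exact: bi_c.
  - by rewrite -{1}ime -biM ez.
  - by rewrite -{1}(bi_f m) -biM zf.
pose y (j : 'I_3 + 'I_3 + unit) := match j with inl (inl i) => z i | inl (inr i) => z' i | inr _ => e0 end.
have [q0 [q1 [q2 [a [b [cc [[p0 p1 p2] [q01 q02 q12 q1E] [Ha Hb Hc] Hw]]]]]]] :=
  layer_sequence fBs incBs denseBs approx y.
have L w : w \in [:: q0; q1; q2; a; b; cc] -> layer_symbol sst central e0 z z' w.
  move=> /Hw[cw wy]; split=> //; first by have [] := wy (inr tt).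
  - by move=> i; exact: (wy (inl (inl i))).
  - by move=> i; exact: (wy (inl (inr i))).
have [] := layered_path qax qbx SZ zz zz' iz iz' pf p0 p1 p2 q01 q02 q12 q1E
  Ha Hb Hc (L q0 _) (L q1 _) (L q2 _) (L a _) (L b _) (L cc _) N0;
  rewrite ?inE ?eqxx ?orbT //.
move=> Y [Y0 YN YP dY].
have [ce0 pe0] := eP ord0.
have eo' i j : (i < m)%N -> (j < m)%N -> i != j -> iter i be e0 * iter j be e0 = 0.
  move=> im jm ij; rewrite !iter_e eo //; apply: contra ij => /eqP[].
  by rewrite -mE !modn_small // => ->.
have [] := @towers _ _ _ _ _ qax qbx be (@seqmapM _ _ _ ha) (@seqmap_star _ _ _ ha)
  (@seqmap_scal _ _ _ ha) (@seqmap_bnd _ _ _ ha) central SZ (@central_map _ _ _ ha)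
  m e0 m0 ce0 pe0 em eo' Y (4 / N%:R) _ dY _ k k0 km k1m.
- by move=> i; rewrite fE; exact: YP.
- by rewrite Y0 YN // (iter_cancel m K2).
move=> g [h [gP hP o s d]]; exists g, h; split=> // r.
have hc := hN m _ (leq_trans (leq_addr _ _) Nm) erefl.
by have [d1 d2] := d r; split; [exact: (bnd_le qbx d1 hc)|exact: (bnd_le qbx d2 hc)].
Qed.

(** There are two towers, of heights [k] and [k + 1]. A family of lifts has all the
required properties at almost all times. *)
Lemma rohlin_of_central_towers : rohlin_property alpha.
Proof.
move=> k k0; pose ks (i : 'I_2) := (k + i)%N.
exists 2%N, ks; split=> //; first by move=> i; exact: leq_addr.
move=> F eps finF eps0; have c0 : 0 < eps / 2 by rewrite divr_gt0.
have [g [h [gP hP [go ho gh] s d]]] := central_towers k0 c0.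
pose n := (k + k.+1)%N; pose p i := if (i < k)%N then g i else h (i - k)%N.
have pp i : (i < n)%N -> sproj sst (p i).
  by move=> _; rewrite /p; case: ifP => _; [case: (gP i)|case: (hP (i - k)%N)].
have cp i : central (p i).
  by rewrite /p; case: ifP => _; [case: (gP i)|case: (hP (i - k)%N)].
have hg i j : h i * g j = 0.
  have [_ [_ gs] _] := gP j; have [_ [_ hs] _] := hP i.
  by rewrite -[LHS](star_stK qax) (star_stM qax) gs hs gh raddf0.
have po i j : (i < n)%N -> (j < n)%N -> i != j -> p i * p j = 0.
  rewrite /p /n; case: (ltnP i k) => ik; case: (ltnP j k) => jk hi hj ij.
  - by apply: go; rewrite !modn_small.
  - exact: gh.
  - exact: hg.
  - by apply: ho; rewrite !modn_small; lia.
have sp : \sum_(i < n) p i = 1.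
  rewrite -s big_split_ord /=; congr (_ + _); apply: eq_bigr => i _; rewrite /p /=.
    by rewrite ltn_ord.
  by rewrite ltnNge leq_addr /= addKn.
have [x [xP xo]] := lift_projections fBs incBs denseBs pp po.
have xp i m : (i < n)%N -> sproj star (x i m) by move=> /xP[/(_ m)[]].
(* The sum of the lifts is a projection at a distance less than 1 from the unit. *)
have xs : eventually (fun m => \sum_(i < n) x i m = 1).
  have [S [SE cS]] := class_sum (index_enum 'I_n) (fun i => x i).
  have cS1 : class S = class (bseq_cst 1).
    rewrite cS -[RHS]/(1 : Q) -sp; apply: eq_bigr => i _.
    by have [_ ->] := xP i (ltn_ord i).
  have half0 : 0 < 2^-1 :> R by rewrite invr_gt0.
  apply: eventually1 ((classP _ _).1 cS1 _ half0) => m; rewrite /= SE => hm.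
  have ss : (\sum_(i < n) x i m) * (\sum_(i < n) x i m) = \sum_(i < n) x i m.
    rewrite mulr_suml; apply: eq_bigr => i _; rewrite mulr_sumr (bigD1 i) //= big1 ?addr0.
      by case: (xp i m (ltn_ord i)).
    by move=> j ji; rewrite xo // eq_sym.
  apply/esym/eqP; rewrite -subr_eq0; apply/eqP/sproj_small.
    split; first by rewrite mulrBl mul1r mulrBr mulr1 ss subrr subr0.
    rewrite raddfB raddf_sum /= star1; congr (_ - _); apply: eq_bigr => i _.
    by case: (xp i m (ltn_ord i)).
  by rewrite -nrmN opprB (le_lt_trans hm) // invf_lt1 // ltr1n.
have eventually_all (P : nat -> nat -> Prop) :
    (forall i, (i < n)%N -> eventually (P i)) -> eventually (fun m => forall i, (i < n)%N -> P i m).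
  elim: {pp cp po sp xP xo xp xs} n => [|N IH] hP'; first by exists 0%N.
  apply: eventually2 (IH (fun i iN => hP' i (ltnW iN))) (hP' N (ltnSn N)) => m h1 h2 i.
  by rewrite ltnS leq_eqVlt => /orP[/eqP->|/h1].
(* The successor of [i] in the cyclic order of its tower. *)
pose nx i := if (i < k)%N then (i.+1 %% k)%N else (k + (i - k).+1 %% k.+1)%N.
have nxn i : (nx i < n)%N.
  rewrite /nx /n; case: ifP => _; first by rewrite ltn_addr // ltn_mod.
  by rewrite ltn_add2l ltn_mod.
have pnx i : seqbnd (seqmap ha (p i) - p (nx i)) (eps / 2).
  rewrite /p /nx; case: ifP => ik.
    by rewrite ltn_mod k0; have [_ _ ->] := gP i.+1; case: (d i).
  by rewrite ltnNge leq_addr /= addKn; have [_ _ ->] := hP (i - k).+1; case: (d (i - k)%N).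
have xa : eventually (fun m => forall i, (i < n)%N -> nrm (alpha (x i m) - x (nx i) m) < eps).
  apply: eventually_all => i iN; have c1 : 0 < eps / 4 by rewrite divr_gt0.
  have := pnx i; have [_ <-] := xP i iN; have [_ <-] := xP _ (nxn i).
  rewrite seqmap_class classN classD => h1.
  have := (seqbnd_class _ _).2 h1 _ c1.
  by apply: eventually1 => m /= hm; apply: (le_lt_trans hm); lra.
have xc : eventually (fun m => forall i, (i < n)%N -> forall a, F a ->
    nrm (a * x i m - x i m * a) < eps).
  apply: eventually_all => i iN; have /finite_seqP[r ->] := finF.
  elim: r => [|a r IH]; first by exists 0%N.
  have := cp i a; have [_ <-] := xP i iN; rewrite !classM => /classP/(_ _ c0) h1.
  apply: eventually2 h1 IH => m /= h1 h2 b; rewrite inE => /orP[/eqP->|/h2 //].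
  by rewrite (le_lt_trans h1) //; lra.
have [M hM] : eventually (fun m => [/\ \sum_(i < n) x i m = 1,
    forall i, (i < n)%N -> nrm (alpha (x i m) - x (nx i) m) < eps
  & forall i, (i < n)%N -> forall a, F a -> nrm (a * x i m - x i m * a) < eps]).
  apply: eventually2 xs (eventually2 (fun m h1 h2 => conj h1 h2) xa xc) => m h1 [h2 h3].
  by split.
have [Ms Ma Mc] := hM M (leqnn M).
pose v (i : 'I_2) (j : 'I_(ks i)) := (if i == ord0 then j : nat else k + j)%N.
have vn i j : (@v i j < n)%N.
  have jk : (j < k + i)%N := ltn_ord j; have i2 := ltn_ord i.
  by rewrite /v /n; case: (i == ord0); lia.
exists (fun i j => x (@v i j) M); split.
- by move=> i j; exact: xp.
- have sv (i : 'I_2) : \sum_(j < ks i) x (v i j) M =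
      \sum_(0 <= j < k + i) x (if i == ord0 then j else k + j)%N M by rewrite big_mkord.
  rewrite (eq_bigr _ (fun i _ => sv i)) big_ord_recl big_ord1 /= addn0 addn1 !big_mkord.
  by rewrite -Ms big_split_ord.
- move=> i j; rewrite normE ltcR.
  have -> : v i (ordS j) = nx (v i j); last exact: Ma.
  have := ltn_ord j; rewrite /v /nx /= /ks; move: {j} (j : nat) => j jk.
  case: ifPn => i0; first by move: jk; rewrite (eqP i0) addn0 => ->.
  have -> : i = 1%N :> nat by move: i0 (ltn_ord i); rewrite -val_eqE /=; lia.
  by rewrite ltnNge leq_addr /= addKn addn1.
- by move=> i j a Fa; rewrite normE ltcR; exact: Mc.
Qed.

End Conclusion.

Theorem theorem3p1 (R : realType) (A : cstarAlgType R) (alpha : automorphism A) :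
  is_AF A -> approx_rohlin_property alpha -> rohlin_property alpha.
Proof.
move=> [Bs [fBs incBs denseBs]] approx.
exact: (rohlin_of_central_towers fBs incBs denseBs approx (aut_nrm fBs denseBs alpha)).
Qed.
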